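(* Let $Q$ be a quiver of type $A_n$, let $c_Q$ be the Coxeter element of $S_{n+1}$ associated to $Q$, and let $w\in S_{n+1}$ be a $c_Q$-sortable element. Consider the corresponding torsion-free class $\mathcal{F}(w)$ of $\mathsf{mod}\,kQ$. Then: (1) Isomorphism classes of simple objects in the exact category $\mathcal{F}(w)$ are in bijection with Bruhat inversions of $w$. (2) $\mathcal{F}(w)$ satisfies the Jordan-Hölder property (JHP) if and only if the number of supports of $w$ is equal to the number of Bruhat inversions of $w$.
   Context: $k$ is a field, and $Q$ is a quiver whose underlying graph is the path $1 - 2 - \cdots - n$ (any orientation). Right $kQ$-modules are identified with representations of $Q$; $\mathsf{mod}\,kQ$ is the category of finitely generated (finite-dimensional) ones. Symmetric group. $S_{n+1}$ acts on $\{1,\dots,n+1\}$ from the left; $(i\;j)$ is a transposition; $s_i=(i\;i+1)$ for $1\le i\le n$ are the simple reflections; $\ell(w)$ is the minimal length of an expression of $w$ as a product of simple reflections, and an expression of this length is reduced. A transposition $t$ is an inversion of $w$ if $\ell(tw)<\ell(w)$ (for $t=(i\;j)$ with $i<j$: iff $w^{-1}(i)>w^{-1}(j)$), and a Bruhat inversion of $w$ if $\ell(tw)=\ell(w)-1$. Let $\mathsf{inv}(w)$ be the set of inversions. An index $i\in\{1,\dots,n\}$ is a support of $w$ if $s_i$ occurs in some reduced expression of $w$; $\mathsf{supp}(w)$ is the set of supports. Coxeter element. A Coxeter element is a product of all $s_1,\dots,s_n$, each once, in some order. $c_Q$ is the Coxeter element in which $s_i$ appears before $s_j$ whenever there is an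 arrow $i\leftarrow j$ (from $j$ to $i$) in $Q$. An element $w$ is $c$-sortable if it has a reduced expression $w=c^{(0)}c^{(1)}\cdots c^{(m)}$ with each $c^{(r)}$ a subword of $c$ and $\mathsf{supp}(c^{(0)})\supseteq \mathsf{supp}(c^{(1)})\supseteq\cdots\supseteq \mathsf{supp}(c^{(m)})$. Modules. For $1\le i<j\le n+1$, $M_{[i,j)}$ is the indecomposable representation with $k$ at the vertices $l$ with $i\le l<j$, $0$ at the other vertices, identity maps on arrows between vertices both carrying $k$, and zero maps on the other arrows. For $c_Q$-sortable $w$, $\mathcal{F}(w)=\mathsf{add}\{M_{[i,j)} : (i\;j)\in\mathsf{inv}(w),\ i<j\}$ (direct summands of finite direct sums); this is a torsion-free class of $\mathsf{mod}\,kQ$ (and $w\mapsto\mathcal{F}(w)$ is a bijection from $c_Q$-sortable elements to torsion-free classes). It is extension-closed and is an exact category whose conflations are the short exact sequences of $\mathsf{mod}\,kQ$ with all terms in it. Exact categories. For an exact category $\mathcal{E}$ and an object $X$, $\mathsf{P}(X)$ is the poset of inflations $A\to X$ up to isomorphism over $X$, with $A\leq B$ if there is an inflation $A\to B$ compatible with the inflations to $X$; $X/A$ is the cokernel of $A \to X$. $X$ is simple if $X\ne0$ and there is no conflation $L\to X\to N$ with $L,N\neq0$. $\mathcal{E}$ is length if for each $X$ the lengths of finite chains in $\mathsf{P}(X)$ are bounded (this holds for $\mathcal{F}(w)$). A composition series of $X$ is a finite maximal chain $0=X_0<\cdots<X_m=X$ in $\mathsf{P}(X)$; two composition series $(X_i),(Y_j)$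 are isomorphic if they have the same length $m$ and $X_i/X_{i-1}\cong Y_{\sigma(i)}/Y_{\sigma(i)-1}$ for all $i$ and some permutation $\sigma$ of $\{1,\dots,m\}$. A length exact category satisfies (JHP) if all composition series of each object are isomorphic to each other. *)

(* Defs.v *)
From HB Require Import structures.
From mathcomp Require Import all_boot all_order all_fingroup all_algebra.
Set Implicit Arguments.
Unset Strict Implicit.
Unset Printing Implicit Defensive.
Import GRing.Theory.

(* Indices are 0-based: the vertices 1, ..., n of the quiver and the indices of
   the simple reflections are the elements of 'I_n, and S_(n+1) acts on
   'I_n.+1, which stands for {1, ..., n+1}. *)

(* S_(n+1) acts from the left, so a product s t applies t first, whereas
   (s * t)%g of perm.v applies s first. *)
Definition lmul (T : finType) (s t : {perm T}) : {perm T} := (t * s)%g.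

Definition sref (n : nat) (i : 'I_n) : 'S_n.+1 :=
  tperm (widen_ord (leqnSn n) i) (lift ord0 i).

Definition wordprod (n : nat) (u : seq 'I_n) : 'S_n.+1 :=
  foldr (fun i v => lmul (sref i) v) 1%g u.

Lemma wordprod_cat (n : nat) (u v : seq 'I_n) :
  wordprod (u ++ v) = lmul (wordprod u) (wordprod v).
Proof.
elim: u => [|i u IHu] /=; first by rewrite /lmul mulg1.
by rewrite IHu /lmul mulgA.
Qed.

Lemma tperm_wordprod (n : nat) (a b : 'I_n.+1) :
  a < b -> exists u, wordprod u = tperm a b.
Proof.
case: b => b; elim: b => [|b IHb] ltb //; rewrite ltnS => leab.
have ltbn : b < n by [].
have bE : Ordinal ltb = lift ord0 (Ordinal ltbn) by apply: val_inj.
set b' := widen_ord (leqnSn n) (Ordinal ltbn).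
have [eq_ab | neq_ab] := eqVneq a b'.
  by exists [:: Ordinal ltbn]; rewrite /= /lmul mul1g /sref -bE -/b' eq_ab.
have ltab : a < b.
  by rewrite ltn_neqAle leab andbT; move: neq_ab; rewrite -val_eqE.
have [u uE] := IHb (ltnW ltbn : b < n.+1) ltab.
exists (Ordinal ltbn :: u ++ [:: Ordinal ltbn]).
rewrite /= wordprod_cat /= /lmul mul1g uE.
have -> : Ordinal (ltnW ltbn : b < n.+1) = b' by apply: val_inj.
have {1}-> : sref (Ordinal ltbn) = (sref (Ordinal ltbn))^-1%g.
  by rewrite /sref tpermV.
rewrite -mulgA -/(conjg _ _) tpermJ; congr tperm.
  rewrite /sref -bE tpermD //; first by rewrite eq_sym.
  by rewrite -val_eqE /= neq_ltn ltnS (ltnW ltab) orbT.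
by rewrite /sref tpermL bE.
Qed.

Lemma wordprod_exists (n : nat) (w : 'S_n.+1) :
  exists m, [exists u : m.-tuple 'I_n, wordprod u == w].
Proof.
suff [u uE] : exists u, wordprod u = w.
  by exists (size u); apply/existsP; exists (in_tuple u); rewrite /= uE.
have [ts -> _] := prod_tpermP w.
elim: ts => [|[a b] ts [v vE]]; first by exists [::]; rewrite big_nil.
have [u uE] : exists u, wordprod u = tperm a b.
  have [ltab | ltba | /val_inj ->] := ltngtP a b.
  - exact: tperm_wordprod.
  - by rewrite tpermC; apply: tperm_wordprod.
  - by exists [::]; rewrite tperm1.
by exists (v ++ u); rewrite wordprod_cat uE vE big_cons.
Qed.

Definition plength (n : nat) (w : 'S_n.+1) : nat := ex_minn (wordprod_exists w).

Definition reduced (n : nat) (u : seq 'I_n) : bool :=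
  size u == plength (wordprod u).

Definition is_transposition (n : nat) (t : 'S_n) : bool :=
  [exists i, exists j, (i != j) && (t == tperm i j)].

Definition inv (n : nat) (w : 'S_n.+1) : {set 'S_n.+1} :=
  [set t | is_transposition t & plength (lmul t w) < plength w].

Definition bruhat_inv (n : nat) (w : 'S_n.+1) : {set 'S_n.+1} :=
  [set t | is_transposition t & (plength (lmul t w)).+1 == plength w].

Definition supp (n : nat) (w : 'S_n.+1) : {set 'I_n} :=
  [set i | [exists u : (plength w).-tuple 'I_n, (wordprod u == w) && (i \in u)]].

(* A quiver without multiple arrows on the vertex set 'I_n is the relation
   [Q i j] = "there is an arrow from i to j". *)
Definition type_A (n : nat) (Q : rel 'I_n) : Prop :=
  forall i j : 'I_n,
    (Q i j || Q j i = (i.+1 == j) || (j.+1 == i)) /\ ~~ (Q i j && Q j i).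

Definition coxeter_of (n : nat) (Q : rel 'I_n) (c : 'S_n.+1) : Prop :=
  exists u : seq 'I_n,
    [/\ perm_eq u (enum 'I_n),
        forall i j, Q j i -> index i u < index j u
      & wordprod u = c].

(* [u] is a reduced word of [c], and [cs] is the list of the factors
   c^(0), ..., c^(m), each given by its word. *)
Definition sortable (n : nat) (c w : 'S_n.+1) : Prop :=
  exists (u : seq 'I_n) (cs : seq (seq 'I_n)),
    [/\ reduced u /\ wordprod u = c,
        reduced (flatten cs) /\ wordprod (flatten cs) = w,
        all (fun x => subseq x u) cs
      & sorted (fun x y => supp (wordprod y) \subset supp (wordprod x)) cs].

Section Representations.
Variables (k : fieldType) (n : nat) (Q : rel 'I_n).

Record rep := Rep {
  space :> 'I_n -> vectType k;
  arrow : forall i j, Q i j -> 'Hom(space i, space j)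
}.

Record hom (X Y : rep) := Hom {
  hmap :> forall i, 'Hom(X i, Y i);
  hom_comm : forall i j (a : Q i j),
    (hmap j \o arrow X a)%VF = (arrow Y a \o hmap i)%VF
}.

Definition is_iso (X Y : rep) (f : hom X Y) : Prop :=
  exists g : hom Y X, forall i, (g i \o f i)%VF = \1%VF /\ (f i \o g i)%VF = \1%VF.

Definition iso (X Y : rep) : Prop := exists f : hom X Y, is_iso f.

Definition is_zero (X : rep) : Prop := forall i (x : X i), x = 0%R.

Definition short_exact (L X N : rep) (f : hom L X) (g : hom X N) : Prop :=
  forall i, [/\ lker (f i) = 0%VS, limg (f i) = lker (g i) & limg (g i) = fullv].

Definition rep0 : rep :=
  Rep (space := fun _ => 'rV[k]_0) (fun _ _ _ => 0%R).

Definition prod_map (U1 V1 U2 V2 : vectType k) (f : 'Hom(U1, V1))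
  (g : 'Hom(U2, V2)) (x : U1 * U2) : V1 * V2 := (f x.1, g x.2).

Fact prod_map_linear (U1 V1 U2 V2 : vectType k) (f : 'Hom(U1, V1))
  (g : 'Hom(U2, V2)) : linear (prod_map f g).
Proof. by move=> a x y; rewrite /prod_map /= !linearP. Qed.
HB.instance Definition _ (U1 V1 U2 V2 : vectType k) (f : 'Hom(U1, V1))
    (g : 'Hom(U2, V2)) :=
  GRing.isLinear.Build k (U1 * U2)%type (V1 * V2)%type _ _
    (prod_map_linear f g).

Definition oplus (X Y : rep) : rep :=
  Rep (space := fun i => (X i * Y i)%type)
      (fun i j a => linfun (prod_map (arrow X a) (arrow Y a))).

Definition dsum (Xs : seq rep) : rep := foldr oplus rep0 Xs.

(* M_[i,j): the space at l is 'rV[k]_1 or 'rV[k]_0 according to whether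
   i <= l < j, and pid_mx 1 is the identity between spaces of dimension 1. *)
Definition interval (i j : 'I_n.+1) : rep :=
  Rep (space := fun l => 'rV[k]_((i <= l < j)%N))
      (fun l m _ => linfun (mulmxr (pid_mx 1))).

Definition torsion_free_class (w : 'S_n.+1) (X : rep) : Prop :=
  exists s : seq ('I_n.+1 * 'I_n.+1),
    all (fun p : 'I_n.+1 * 'I_n.+1 =>
           (p.1 < p.2)%N && (tperm p.1 p.2 \in inv w)) s /\
    exists Y : rep,
      iso (oplus X Y)
          (dsum [seq interval p.1 p.2 | p : 'I_n.+1 * 'I_n.+1 <- s]).

(* [linfun] is only meaningful on linear functions; the two functions to which
   it is applied above are linear. *)
Fact oplus_arrowE (X Y : rep) i j (a : Q i j) (x : oplus X Y i) :
  arrow (oplus X Y) a x = (arrow X a x.1, arrow Y a x.2).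
Proof. exact: lfunE. Qed.

Fact interval_arrowE (i j : 'I_n.+1) l m (a : Q l m) (x : interval i j l) :
  arrow (interval i j) a x = (x *m pid_mx 1)%R.
Proof. exact: lfunE. Qed.

Section Exact.
(* [E] is the class of objects of an extension-closed full subcategory. *)
Variable E : rep -> Prop.

Definition conflation (L X N : rep) (f : hom L X) (g : hom X N) : Prop :=
  [/\ E L, E X, E N & short_exact f g].

Definition inflation (L X : rep) (f : hom L X) : Prop :=
  exists (N : rep) (g : hom X N), conflation f g.

Definition simple_obj (X : rep) : Prop :=
  [/\ E X, ~ is_zero X
    & ~ exists (L N : rep) (f : hom L X) (g : hom X N),
        [/\ conflation f g, ~ is_zero L & ~ is_zero N]].

(* An element of P(X) is represented by an inflation to X; equality in P(X) is
   [sub_eq]. *)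
Record subobj (X : rep) := Subobj {
  dom : rep;
  incl : hom dom X;
  inclP : inflation incl
}.

Definition compatible (X : rep) (A B : subobj X) (h : hom (dom A) (dom B)) : Prop :=
  forall i, (incl B i \o h i)%VF = incl A i.

Definition sub_le (X : rep) (A B : subobj X) : Prop :=
  exists h : hom (dom A) (dom B), inflation h /\ compatible h.

Definition sub_eq (X : rep) (A B : subobj X) : Prop :=
  exists h : hom (dom A) (dom B), is_iso h /\ compatible h.

(* [N] is a cokernel B/A of the inflation witnessing A <= B. *)
Definition is_quotient (X : rep) (A B : subobj X) (N : rep) : Prop :=
  exists (h : hom (dom A) (dom B)) (g : hom (dom B) N),
    compatible h /\ conflation h g.

(* Only the terms X_0, ..., X_m of the family matter. *)
Definition composition_series (X : rep) (m : nat) (Xs : nat -> subobj X) : Prop :=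
  [/\ is_zero (dom (Xs 0)),
      is_iso (incl (Xs m)),
      forall i j, i < j <= m -> sub_le (Xs i) (Xs j) /\ ~ sub_eq (Xs i) (Xs j)
    & forall Z : subobj X,
        (forall i, i <= m -> sub_le Z (Xs i) \/ sub_le (Xs i) Z) ->
        exists2 i, i <= m & sub_eq Z (Xs i)].

Definition series_iso (X : rep) (m : nat) (Xs : nat -> subobj X)
    (m' : nat) (Ys : nat -> subobj X) : Prop :=
  m = m' /\
  exists sigma : 'S_m, forall i : 'I_m,
    exists N N' : rep,
      [/\ is_quotient (Xs i) (Xs i.+1) N,
          is_quotient (Ys (sigma i)) (Ys (sigma i).+1) N'
        & iso N N'].

Definition JHP : Prop :=
  forall (X : rep) (m m' : nat) (Xs Ys : nat -> subobj X),
    E X -> composition_series m Xs -> composition_series m' Ys ->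
    series_iso m Xs m' Ys.

End Exact.

(* A bijection from [T] to the set of isomorphism classes of the objects
   satisfying [P]. *)
Definition iso_classes_bij (P : rep -> Prop) (T : Type) : Prop :=
  exists F : T -> rep,
    [/\ forall t, P (F t),
        forall t t', iso (F t) (F t') -> t = t'
      & forall X, P X -> exists t, iso X (F t)].

End Representations.

Arguments interval k {n} Q i j.
Arguments torsion_free_class k {n} Q w X.

(* Main.v *)
(* Write p = w^-1; a pair a < b is an inversion when p b < p a.  Sortability only
   enters through alignment: if (a, d) is an inversion and a < b < d, then (a, b)
   or (b, d) is an inversion, according to the direction of the arrow between b-1
   and b; that is, inversions are closed under interval subrepresentations.  As
   inversions are also transitive, the representations whose interval
   subrepresentations all come from inversions are closed under subobjects and
   extensions, and since every representation is a sum of intervals, they are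
   the objects of F(w).  A subrepresentation of M_[i,j) with torsion-free
   quotient cuts [i, j) at inversions, hence the simple objects are the M_[i,j)
   for which (i, j) is not the composite of two inversions.

   The dimension vectors of the Bruhat inversions span the coordinate space of
   the support of w, so the two numbers in (2) agree if and only if these vectors
   are linearly independent.  Independence gives (JHP) by comparing dimension
   vectors.  Conversely, under (JHP) the multiplicity of a given simple object is
   additive on conflations, in particular on a composite of two inversions and
   on a pattern 3412 of inversions, whose four intervals always fit into an exact
   sequence.  Since triangles and 4-cycles generate the cycles of an inversion
   graph, the multiplicity in M_[a,b) is phi a - phi b for some function phi; it
   is therefore linear in the dimension vector, which forces independence. *)
Require Import Defs.
From HB Require Import structures.
From mathcomp Require Import all_boot all_order all_fingroup all_algebra.
From mathcomp Require Import zify ring lra.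
(* [hom] and [inv] are shadowed by mathcomp. *)
Import Defs.
Set Implicit Arguments.
Unset Strict Implicit.
Unset Printing Implicit Defensive.
Import GRing.Theory Num.Theory.

(** * Length and inversions *)

(** The quiver controls one word of [c], while sortability may use another; they are compared by
    recovering the order of two neighbouring letters of a duplicate-free word from its product. On
    the module side, subquotients are avoided where possible: an interval subrepresentation of V / U
    is given by vectors of [X] whose arrow relations hold modulo U, so that subobjects, quotients
    and extensions are all treated inside one representation. The same cutting argument, at the
    vertices where such vectors enter or leave an intermediate family, yields closure under
    extensions, simplicity of Bruhat intervals and maximality of composition series. For the
    converse in (2), additivity of multiplicities is known only on inversions, and it has to be
    shown that it comes from a linear functional; this functional then reads off one coefficient of
    any linear relation. Coefficients are rational whatever [k] is, because multiplicities must be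
    compared in characteristic 0. *)

Section Length.
Variable n : nat.
Implicit Types (w : 'S_n.+1) (a b c : 'I_n.+1) (i : 'I_n).

Definition ninv w : nat :=
  \sum_(a : 'I_n.+1) \sum_(b : 'I_n.+1) ((a < b) && (w^-1 b < w^-1 a) : nat)%g.

Lemma lmulVE (t w : 'S_n.+1) a : ((lmul t w)^-1 a = w^-1 (t^-1 a))%g.
Proof. by rewrite /lmul invMg permM. Qed.

(** A transposition of [x] and [y] only affects pairs meeting {x, y}; isolating them lets the
    remaining double sum cancel. *)
Lemma sum_pairs_split (T : finType) (x y : T) (F : T -> T -> nat) : x != y ->
  \sum_u \sum_v F u v =
    F x x + F x y + F y x + F y y
    + \sum_(z | (z != x) && (z != y)) (F x z + F y z + F z x + F z y)
    + \sum_(u | (u != x) && (u != y)) \sum_(v | (v != x) && (v != y)) F u v.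
Proof.
move=> nxy.
have split1 (G : T -> nat) :
    \sum_u G u = G x + G y + \sum_(u | (u != x) && (u != y)) G u.
  by rewrite (bigD1 x) //= (bigD1 y) 1?eq_sym //= addnA.
rewrite split1 !split1; under [X in _ + X = _]eq_bigr do rewrite split1.
rewrite !big_split /=; lia.
Qed.

Lemma ninv_tperm w a b : a < b -> (w^-1 b < w^-1 a)%g ->
  ninv w = (ninv (lmul (tperm a b) w)
    + 2 * #|[set c : 'I_n.+1 | (a < c < b) && (w^-1 b < w^-1 c < w^-1 a)%g]|).+1.
Proof.
move=> ltab ltq; have nab : a != b by rewrite neq_ltn ltab.
rewrite /ninv !(sum_pairs_split _ nab) !lmulVE tpermV tpermL tpermR.
have -> : #|[set c : 'I_n.+1 | (a < c < b) && (w^-1 b < w^-1 c < w^-1 a)%g]| =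
    \sum_(c | (c != a) && (c != b))
      (if (a < c < b) && (w^-1 b < w^-1 c < w^-1 a)%g then 1 else 0).
  rewrite -sum1dep_card big_mkcond [RHS]big_mkcond; apply: eq_bigr => c _ /=.
  by rewrite -!val_eqE /=; case: ifP; case: ifP => //=; lia.
rewrite !ltnn !andbF /= !addn0.
set S1 := \sum_(u | _) \sum_(v | _) _; set S2 := \sum_(u | _) \sum_(v | _) _.
have -> : S2 = S1.
  apply: eq_bigr => u /andP[ua ub]; apply: eq_bigr => v /andP[va vb].
  by rewrite !lmulVE tpermV !tpermD // eq_sym.
set S3 := \sum_(z | _) _; set S4 := \sum_(z | _) _; set S5 := \sum_(z | _) _.
have -> : S3 = S4 + 2 * S5; last first.
  by rewrite ltab ltq; move: (ltab) (ltq); case: ltngtP; case: ltngtP => //; lia.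
rewrite /S3 /S4 /S5 big_distrr -big_split /=.
apply: eq_bigr => c /andP[ca cb].
rewrite !lmulVE tpermV !tpermD 1?eq_sym //.
have na : (c : nat) != a by [].
have nb : (c : nat) != b by [].
have nqa : (w^-1 c != w^-1 a :> nat)%g by rewrite (inj_eq val_inj) (inj_eq perm_inj).
have nqb : (w^-1 c != w^-1 b :> nat)%g by rewrite (inj_eq val_inj) (inj_eq perm_inj).
by case: ifP; lia.
Qed.

Lemma ninv_sref w i :
  (w^-1 (lift ord0 i) < w^-1 (widen_ord (leqnSn n) i))%g ->
  ninv w = (ninv (lmul (sref i) w)).+1.
Proof.
move=> lti; rewrite (ninv_tperm _ lti) //.
rewrite [X in 2 * X](_ : _ = 0) ?addn0 //.
by apply: eq_card0 => c; rewrite inE /=; apply/negbTE; rewrite /bump; lia.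
Qed.

Lemma lmul_tpermK a b w : lmul (tperm a b) (lmul (tperm a b) w) = w.
Proof. by rewrite /lmul -mulgA tperm2 mulg1. Qed.

Lemma ninv_srefV w i :
  (w^-1 (widen_ord (leqnSn n) i) < w^-1 (lift ord0 i))%g ->
  ninv (lmul (sref i) w) = (ninv w).+1.
Proof.
move=> lti; rewrite (@ninv_sref _ i) ?lmul_tpermK //.
by rewrite !lmulVE tpermV tpermL tpermR.
Qed.

Lemma srefP w i :
  (w^-1 (lift ord0 i) < w^-1 (widen_ord (leqnSn n) i))%g /\
    ninv w = (ninv (lmul (sref i) w)).+1 \/
  (w^-1 (widen_ord (leqnSn n) i) < w^-1 (lift ord0 i))%g /\
    ninv (lmul (sref i) w) = (ninv w).+1.
Proof.
case: (ltngtP (w^-1 (lift ord0 i))%g (w^-1 (widen_ord (leqnSn n) i))%g) => [lt|lt|].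
- by left; split=> //; apply: ninv_sref.
- by right; split=> //; apply: ninv_srefV.
by move/val_inj/perm_inj/(congr1 val) => /=; rewrite /bump; lia.
Qed.

Lemma ninv1 : ninv 1%g = 0.
Proof.
rewrite /ninv big1 // => a _; rewrite big1 // => b _.
by rewrite invg1 !perm1; case: ltngtP.
Qed.

Lemma ninv_wordprod (u : seq 'I_n) : ninv (wordprod u) <= size u.
Proof.
elim: u => [|i u IHu] /=; first by rewrite ninv1.
by case: (srefP (wordprod u) i) => -[_ E]; lia.
Qed.

Lemma ltn_homo (f : 'I_n.+1 -> nat) :
  (forall i, f (widen_ord (leqnSn n) i) < f (lift ord0 i)) ->
  forall a b, a < b -> f a < f b.
Proof.
move=> fS a [b ltb]; elim: b ltb => [|b IHb] ltb //= leab.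
have ltbn : b < n by [].
have -> : Ordinal ltb = lift ord0 (Ordinal ltbn) by apply: val_inj.
move: (fS (Ordinal ltbn)); set b' := widen_ord _ _ => fb.
have [eq_ab | neq_ab] := eqVneq a b'; first by rewrite eq_ab.
have Eb : Ordinal (ltnW ltbn : b < n.+1) = b' by apply: val_inj.
apply: ltn_trans fb; rewrite -Eb; apply: IHb => /=.
by move: neq_ab; rewrite -val_eqE /=; lia.
Qed.

Lemma ltn_homo_geq (f : 'I_n.+1 -> 'I_n.+1) :
  (forall a b, a < b -> f a < f b) -> forall a, a <= f a.
Proof.
move=> fS [a]; elim: a => [|a IHa] lta //=.
apply: leq_ltn_trans (IHa (ltnW lta)) _; exact: fS.
Qed.

(** A descent of [w^-1] is removed by one simple reflection; without descents, [w] and its inverse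
    are increasing, so both are the identity. *)
Lemma ninv_word w : exists2 u, size u = ninv w & wordprod u = w.
Proof.
have [N] := ubnP (ninv w); elim: N w => // N IHN w leN.
have [/existsP[i di]|/existsPn nd] :=
  boolP [exists i, (w^-1 (lift ord0 i) < w^-1 (widen_ord (leqnSn n) i))%g].
  have E := ninv_sref di; have [|u su uE] := IHN (lmul (sref i) w); first by rewrite -ltnS -E.
  by exists (i :: u); rewrite /= ?su ?uE ?lmul_tpermK.
have homoV: forall a b, a < b -> (w^-1 a < w^-1 b)%g.
  apply: ltn_homo => i; case: (srefP w i) => -[] //.
  by move=> lt; case/negP: (nd i).
have homo a b : a < b -> w a < w b.
  move=> ltab; case: (ltngtP (w a) (w b)) => // [lt|/val_inj/perm_inj E].
    by have := homoV _ _ lt; rewrite !permK; lia.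
  by move: ltab; rewrite E ltnn.
have -> : w = 1%g.
  apply/permP => a; rewrite perm1; apply: val_inj => /=.
  apply/eqP; rewrite eqn_leq (ltn_homo_geq homo) andbT.
  by rewrite -{2}[a](permK w) (ltn_homo_geq homoV).
by exists [::]; rewrite ?ninv1.
Qed.

Lemma plengthE w : plength w = ninv w.
Proof.
rewrite /plength; case: ex_minnP => m /existsP[u /eqP uw] minm.
apply/eqP; rewrite eqn_leq; apply/andP; split; last first.
  by rewrite -uw; apply: leq_trans (ninv_wordprod u) _; rewrite size_tuple.
have [v sv vw] := ninv_word w; apply: minm; apply/existsP.
by rewrite -sv; exists (in_tuple v); rewrite /= vw.
Qed.

Definition inverted w a b := (a < b) && (w^-1 b < w^-1 a)%g.

Lemma is_transpositionP (t : 'S_n.+1) :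
  reflect (exists a b, a < b /\ t = tperm a b) (is_transposition t).
Proof.
apply: (iffP existsP) => [[a /existsP[b /andP[nab /eqP->]]]|[a [b [ltab ->]]]].
  case: (ltngtP a b) => [lt|lt|/val_inj E]; last by rewrite E eqxx in nab.
    by exists a, b.
  by exists b, a; rewrite tpermC.
by exists a; apply/existsP; exists b; rewrite eqxx neq_ltn ltab.
Qed.

Lemma is_transposition_tperm a b : a < b -> is_transposition (tperm a b).
Proof. by move=> ltab; apply/is_transpositionP; exists a, b. Qed.

Lemma plength_tperm_lt w a b : a < b -> (w^-1 a < w^-1 b)%g ->
  plength w < plength (lmul (tperm a b) w).
Proof.
move=> ltab ltq; rewrite !plengthE.
rewrite (@ninv_tperm (lmul (tperm a b) w) a b) //.
  by rewrite lmul_tpermK; lia.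
by rewrite !lmulVE tpermV tpermL tpermR.
Qed.

Lemma inv_neq w a b : a < b -> (w^-1 b < w^-1 a)%g = false -> (w^-1 a < w^-1 b)%g.
Proof.
move=> ltab; case: ltngtP => // /val_inj/perm_inj E.
by rewrite E ltnn in ltab.
Qed.

Lemma tperm_inv w a b : a < b -> (tperm a b \in Defs.inv w) = inverted w a b.
Proof.
move=> ltab; rewrite inE is_transposition_tperm // /inverted ltab /=.
case: (boolP (w^-1 b < w^-1 a)%g) => [lt|/negbTE/(inv_neq ltab) lt].
  by rewrite !plengthE (ninv_tperm ltab lt) ltnS leq_addr.
by apply/negbTE; rewrite -leqNgt ltnW // plength_tperm_lt.
Qed.

(** By [ninv_tperm] the length drops by 1 plus twice the number of intermediate [c]. *)
Lemma tperm_bruhat w a b : a < b -> (tperm a b \in bruhat_inv w) =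
  inverted w a b && [forall c, ~~ (inverted w a c && inverted w c b)].
Proof.
move=> ltab; rewrite inE is_transposition_tperm // {1}/inverted ltab /=.
case: (boolP (w^-1 b < w^-1 a)%g) => [lt|/negbTE/(inv_neq ltab) lt] /=; last first.
  by apply: gtn_eqF; rewrite ltnS ltnW // plength_tperm_lt.
rewrite !plengthE (ninv_tperm ltab lt) eqSS.
set S := [set c | _]; rewrite -[X in X == _]addn0 eqn_add2l.
rewrite eq_sym muln_eq0 /= cards_eq0; apply/eqP/forallP => [S0 c|nc].
  apply/negP => /andP[/andP[ac wac] /andP[cb wcb]].
  by have := in_set0 c; rewrite -S0 inE ac cb wac wcb.
apply/setP => c; rewrite [in RHS]inE; apply/negbTE; have := nc c; apply: contra.
by rewrite inE /inverted => /andP[/andP[-> ->] /andP[-> ->]].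
Qed.

End Length.

(** * Supports and sortable elements *)

Section Sortable.
Variable n : nat.
Implicit Types (w : 'S_n.+1) (a b d : 'I_n.+1) (i l m s : 'I_n) (u v : seq 'I_n).

Lemma sref_leq s i a : s != i -> (sref s a <= i) = (a <= i).
Proof.
rewrite -val_eqE /= /sref => nsi.
by case: tpermP => [-> | -> | _ _] //=; rewrite /bump; lia.
Qed.

Lemma wordprod_cons s u a : wordprod (s :: u) a = sref s (wordprod u a).
Proof. by rewrite /= /lmul permM. Qed.

Lemma wordprod_leq i u a : i \notin u -> (wordprod u a <= i) = (a <= i).
Proof.
elim: u => [|s u IHu]; first by rewrite perm1.
by rewrite inE negb_or wordprod_cons => /andP[ns nu]; rewrite sref_leq ?IHu // eq_sym.
Qed.

Lemma wordprodV_leq i u a : i \notin u -> ((wordprod u)^-1%g a <= i) = (a <= i).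
Proof. by move=> nu; rewrite -(wordprod_leq _ nu) permKV. Qed.

(** A word without the letter [l] preserves the set of indices at most [l], so it inverts no pair
    across that cut. *)
Lemma inverted_mem u a b l :
  inverted (wordprod u) a b -> a <= l < b -> l \in u.
Proof.
move=> /andP[_ lt] /andP[al lb]; apply: contraTT lt => nu.
have := wordprodV_leq a nu; rewrite al => pa.
have := wordprodV_leq b nu; rewrite [b <= l]leqNgt lb /= => /negbT; rewrite -ltnNge => pb.
by rewrite -leqNgt ltnW // (leq_ltn_trans pa).
Qed.

Lemma mem_split_first (T : eqType) (x : T) (s : seq T) :
  x \in s -> exists s1 s2 : seq T, s = s1 ++ x :: s2 /\ x \notin s1.
Proof.
elim: s => // y s IHs; have [-> _|nxy] := eqVneq x y; first by exists [::], s.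
rewrite inE (negbTE nxy) => /IHs[s1 [s2 [-> nx]]]; exists (y :: s1), s2.
by rewrite inE (negbTE nxy).
Qed.

Lemma suppP w i :
  reflect (exists a b, a <= i < b /\ inverted w a b) (i \in supp w).
Proof.
rewrite inE; apply: (iffP existsP) => [[u /andP[/eqP uw iu]]|[a [b [ib inv_ab]]]].
  (* Before the first occurrence of [i], the prefix preserves the indices at most [i]. Conjugating
     [sref i] by this prefix gives a reflection that deletes the letter, hence shortens [w], and
     that exchanges an index at most [i] with a larger one. *)
  have [u1 [u2 [uE nu1]]] := mem_split_first iu.
  set W1 := wordprod u1; set x := widen_ord (leqnSn n) i.
  have le1 : W1 x <= i by rewrite wordprod_leq.
  have lt2 : i < W1 (lift ord0 i) by rewrite ltnNge wordprod_leq // -ltnNge.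
  exists (W1 x), (W1 (lift ord0 i)); split; first by rewrite le1.
  rewrite -tperm_inv ?(leq_ltn_trans le1) // inE is_transposition_tperm ?(leq_ltn_trans le1) //=.
  have -> : lmul (tperm (W1 x) (W1 (lift ord0 i))) w = wordprod (u1 ++ u2).
    rewrite -uw uE !wordprod_cat /= /lmul -tpermJ /conjg -/W1.
    by rewrite !mulgA mulgK -[(_ * sref i * tperm _ _)%g]mulgA tperm2 mulg1.
  rewrite -(size_tuple u) uE plengthE; apply: leq_ltn_trans (ninv_wordprod _) _.
  by rewrite !size_cat /= addnS.
have [u su uw] := ninv_word w.
have su' : size u == plength w by rewrite su plengthE.
exists (Tuple su'); rewrite /= uw eqxx /=.
by apply: (@inverted_mem u a b) => //; rewrite uw.
Qed.

(** The only occurrence of [i] carries an index across the cut at [i], and no other letter can bring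
    it back; every word of the product must therefore contain [i]. *)
Lemma supp_uniq u : uniq u -> forall i, (i \in supp (wordprod u)) = (i \in u).
Proof.
move=> uu i; apply/idP/idP => [/suppP[a [b [ib inv_ab]]]|iu].
  exact: inverted_mem inv_ab ib.
have [v sv vE] := ninv_word (wordprod u).
have iv : i \in v.
  have [u1 [u2 [uE nu1]]] := mem_split_first iu.
  have nu2 : i \notin u2 by move: uu; rewrite uE cat_uniq /=; case/and3P => _ _ /andP[].
  apply/negPn/negP => nv.
  set x := widen_ord (leqnSn n) i.
  have := wordprod_leq ((wordprod u2)^-1%g x) nv.
  rewrite wordprodV_leq // leqnn vE uE wordprod_cat /lmul permM wordprod_leq //.
  by rewrite wordprod_cons permKV tpermL /= /bump; lia.
rewrite inE; apply/existsP.
have sv' : size v == plength (wordprod u) by rewrite sv plengthE.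
by exists (Tuple sv'); rewrite /= vE eqxx.
Qed.

(* [v] is obtained by reading the word [u] cyclically, each letter being either
   used and moved to the end of [u], or deleted for ever. *)
Inductive sorts : seq 'I_n -> seq 'I_n -> Prop :=
| sorts_nil u : sorts u [::]
| sorts_take s u v : sorts (rcons u s) v -> sorts (s :: u) (s :: v)
| sorts_skip s u v : sorts u v -> sorts (s :: u) v.

Lemma sorts_sub u v : sorts u v -> {subset v <= u}.
Proof.
elim=> {u v} [u|s u v _ IH|s u v _ IH] x //; last first.
  by move/IH; rewrite inE orbC => ->.
rewrite !inE => /orP[-> //|/IH]; rewrite mem_rcons inE => /orP[->|->] //.
by rewrite orbT.
Qed.

(* In the middle of a pass, [r] is still to be read, [x] is what will be used of
   it, and [e] is what has been used. *)
Lemma sorts_pass (cs : seq (seq 'I_n)) (r e x : seq 'I_n) :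
  subseq x r -> path (fun y z => subseq z y) (e ++ x) cs ->
  sorts (r ++ e) (x ++ flatten cs).
Proof.
elim: cs r e x => [|y cs IHcs] /=.
  elim=> [|s r IHr] e x /=; first by move/eqP=> -> _; apply: sorts_nil.
  case: x => [|z x] //=; first by move=> _ _; apply: sorts_nil.
  case: eqP => [->|_] sx _; last by apply: sorts_skip; apply: (IHr e (z :: x)).
  by apply: sorts_take; rewrite rcons_cat; apply: (IHr (rcons e s) x).
elim=> [|s r IHr] e x.
  by case: x => // _ /andP[sy py]; rewrite cats0 in sy; have := IHcs e [::] y sy py; rewrite cats0.
case: x => [|z x] /=.
  by move=> _; rewrite cats0 => H; apply: sorts_skip; apply: (IHr e [::]); rewrite ?sub0seq ?cats0.
case: eqP => [->|_] sx H; last by apply: sorts_skip; apply: (IHr e (z :: x)).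
by apply: sorts_take; rewrite rcons_cat; apply: IHr => //; rewrite cat_rcons.
Qed.

Lemma subseq_uniq_sub (T : eqType) (u x y : seq T) : uniq u ->
  subseq x u -> subseq y u -> {subset y <= x} -> subseq y x.
Proof.
move=> uu xu yu sub; apply/(subseq_uniqP (subseq_uniq xu uu)).
have /(subseq_uniqP uu) yE := yu; have /(subseq_uniqP uu) xE := xu.
rewrite {1}yE {1}xE -filter_predI; apply/eq_filter => z /=.
by case: (boolP (z \in y)) => //= /sub ->.
Qed.

(** A subword of the duplicate-free [u] is determined by its letters, so decreasing supports become
    decreasing subwords. This is why a letter omitted in one pass can be deleted for ever. *)
Lemma sortable_sorts (u : seq 'I_n) (cs : seq (seq 'I_n)) : uniq u ->
  all (fun x => subseq x u) cs ->
  sorted (fun x y => supp (wordprod y) \subset supp (wordprod x)) cs ->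
  sorts u (flatten cs).
Proof.
move=> uu; case: cs => [|x cs] /=; first by move=> _ _; apply: sorts_nil.
case/andP=> xu csu srtd; rewrite -[u]cats0; apply: sorts_pass => //=.
elim: cs x xu csu srtd => //= y cs IHcs x xu /andP[yu csu] /andP[sub_yx pcs].
rewrite IHcs // andbT; apply: (subseq_uniq_sub uu) => // z.
rewrite -(supp_uniq (subseq_uniq yu uu)) -(supp_uniq (subseq_uniq xu uu)).
exact: (subsetP sub_yx).
Qed.

Lemma reduced_cons s v : reduced (s :: v) -> reduced v /\
  inverted (wordprod (s :: v)) (widen_ord (leqnSn n) s) (lift ord0 s).
Proof.
rewrite /reduced !plengthE => /eqP E; have := ninv_wordprod v.
case: (srefP (wordprod (s :: v)) s) => -[lt]; rewrite /= lmul_tpermK; last first.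
  by rewrite /= in E => ->; rewrite -E /=; lia.
by rewrite -[ninv _]E => -[Ev] _; rewrite -Ev eqxx; split=> //; rewrite /inverted lt andbT /= /bump; lia.
Qed.

Lemma sref_val s a : sref s a =
  (if a == s :> nat then s.+1 else if a == s.+1 :> nat then s : nat else a) :> nat.
Proof.
rewrite /sref; case: tpermP => [->|->|] /=; rewrite /bump.
- by rewrite eqxx; lia.
- by rewrite add1n eqxx; case: eqP => //; lia.
move=> n1 n2; case: eqP => [E|_]; first by case: n1; apply: val_inj.
by case: eqP => [E|//]; case: n2; apply: val_inj; rewrite /= /bump; lia.
Qed.

Lemma sref_ltn s a b : a < b -> ~~ ((a == s :> nat) && (b == s.+1 :> nat)) ->
  sref s a < sref s b.
Proof. by move=> ab nab; rewrite !sref_val; repeat (case: ifP => ?); lia. Qed.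

Lemma inverted_sref s w a b : a < b -> sref s a < sref s b ->
  inverted (lmul (sref s) w) a b = inverted w (sref s a) (sref s b).
Proof. by move=> ab sab; rewrite /inverted ab sab /= !lmulVE tpermV. Qed.

Lemma index_rcons_mem (T : eqType) (x y : T) (u : seq T) :
  x \in u -> y \notin u -> index x (rcons u y) < index y (rcons u y).
Proof.
by move=> xu yu; rewrite -!cats1 !index_cat xu (negbTE yu) /= eqxx addn0 index_mem.
Qed.

Lemma index_rcons_ltn (T : eqType) (x y z : T) (u : seq T) : x != z -> y != z ->
  (index x (rcons u z) < index y (rcons u z)) = (index x u < index y u).
Proof.
move=> xz yz; have E t : t != z -> index t (rcons u z) = index t u + (t \notin u).
  move=> tz; rewrite -cats1 index_cat /= eq_sym (negbTE tz).
  by case: (boolP (t \in u)) => [_|/memNindex->]; rewrite ?addn0.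
rewrite !E // -!index_mem; have := index_size x u; have := index_size y u; lia.
Qed.

(** Taking the letter [s] replaces indices by their images under [sref s] and moves [s] behind all
    other letters, as conjugation by [s] does to a Coxeter word. If [(a, b)] or [(b, d)] is the pair
    exchanged by [s], it is inverted because the word is reduced, and it is the one that the order
    of the letters asks for. *)
Lemma sorts_aligned u v : sorts u v -> uniq u -> reduced v ->
  forall a b d l m, a < b < d -> inverted (wordprod v) a d ->
  l.+1 = m -> b = m :> nat ->
  (index l u < index m u -> inverted (wordprod v) a b) /\
  (index m u < index l u -> inverted (wordprod v) b d).
Proof.
elim=> {u v} [u|s u v suv IH|s u v suv IH] uu red_v a b d l m abd inv_ad lm bm.
- by move: inv_ad; rewrite /inverted /= invg1 !perm1; lia.
- have [/= su uu'] := andP uu; have [red_v' inv_s] := reduced_cons red_v.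
  have {}IH := IH (etrans (rcons_uniq _ _) uu) red_v'.
  have eq_ord (x y : 'I_n) : x = y :> nat -> x = y := @val_inj _ _ _ x y.
  have eq_ord1 (x y : 'I_n.+1) : x = y :> nat -> x = y := @val_inj _ _ _ x y.
  have [/andP[/eqP as_ /eqP bs]|nab] := boolP ((a == s :> nat) && (b == s.+1 :> nat)).
    have -> : a = widen_ord (leqnSn n) s by apply: eq_ord1.
    have -> : b = lift ord0 s by apply: eq_ord1.
    have -> : l = s by apply: eq_ord; clear - lm bm bs; lia.
    by rewrite /= eqxx.
  have [/andP[/eqP bs /eqP ds]|nbd] := boolP ((b == s :> nat) && (d == s.+1 :> nat)).
    have -> : b = widen_ord (leqnSn n) s by apply: eq_ord1.
    have -> : d = lift ord0 s by apply: eq_ord1.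
    have -> : m = s by apply: eq_ord; rewrite -bm.
    by rewrite /= eqxx.
  have [ab bd] := andP abd.
  have nad : ~~ ((a == s :> nat) && (d == s.+1 :> nat)) by clear - ab bd; lia.
  have lt_ab := sref_ltn ab nab; have lt_bd := sref_ltn bd nbd.
  have lt_ad := sref_ltn (ltn_trans ab bd) nad.
  move: inv_ad; rewrite /= !inverted_sref ?(ltn_trans ab bd) // => inv_ad.
  have abd' : sref s a < sref s b < sref s d by rewrite lt_ab.
  have mem_u (x : 'I_n) : sref s a <= x < sref s d -> x != s -> x \in u.
    move=> ltx xs; have := sorts_sub suv (inverted_mem inv_ad ltx).
    by rewrite mem_rcons inE (negbTE xs).
  (* The cut at [b] moves across [s]: its two letters become [s] and [s.+1], and [s] now comes last,
     so the induction hypothesis gives the second alternative. The letter [s.+1] is still in [u],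
     because the remaining word inverts a pair across it. *)
  have [bs|nbs] := eqVneq (b : nat) s.
    have Esb : sref s b = s.+1 :> nat by rewrite sref_val bs eqxx.
    have lt_sn : s.+1 < n.
      by have := ltn_ord (sref s d); clear - lt_bd Esb; lia.
    have [_ H] := IH _ _ _ s (Ordinal lt_sn) abd' inv_ad (erefl _) Esb.
    have -> : m = s by apply: eq_ord; rewrite -bm.
    split=> [|_]; first by rewrite /= eqxx.
    apply: H; apply: index_rcons_mem => //; apply: mem_u.
      by rewrite /= -Esb lt_bd andbT ltnW.
    by rewrite -val_eqE /= neq_ltn ltnSn orbT.
  have [bs1|nbs1] := eqVneq (b : nat) s.+1.
    have Esb : sref s b = s :> nat by rewrite sref_val bs1 eqxx; case: ifP => // /eqP.
    have s_gt0 : 0 < s by rewrite -Esb (leq_trans _ lt_ab).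
    have lt_sn : s.-1 < n by rewrite (leq_ltn_trans (leq_pred _)).
    have [H _] := IH _ _ _ (Ordinal lt_sn) s abd' inv_ad (prednK s_gt0) Esb.
    have -> : l = s by apply: eq_ord; clear - lm bm bs1; lia.
    split=> [_|]; last by rewrite /= eqxx.
    apply: H; apply: index_rcons_mem => //; apply: mem_u.
      by rewrite /=; clear - lt_ab lt_bd Esb; lia.
    by rewrite -val_eqE /=; clear - s_gt0; lia.
  have Esb : sref s b = b by apply: val_inj; rewrite /= sref_val (negbTE nbs) (negbTE nbs1).
  have [] := IH _ _ _ l m abd' inv_ad lm; first by rewrite Esb.
  have ls : l != s by rewrite -val_eqE /=; clear - lm bm nbs1; lia.
  have ms : m != s by rewrite -val_eqE /= -bm.
  by rewrite !index_rcons_ltn //= ![s == _]eq_sym (negbTE ls) (negbTE ms) !ltnS.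
(* A skipped letter does not occur in [v], so it is outside the range of every inversion; deleting
   it does not change the order of [l] and [m]. *)
have [/= su uu'] := andP uu.
have ns (x : 'I_n) : a <= x < d -> x != s.
  move=> ltx; apply: contraNneq su => <-; exact/(sorts_sub suv)/(inverted_mem inv_ad).
have [H1 H2] := IH uu' red_v a b d l m abd inv_ad lm bm.
have ls : l != s by apply: ns; clear - lm bm abd; lia.
have ms : m != s by apply: ns; clear - bm abd; lia.
by rewrite /= ![s == _]eq_sym (negbTE ls) (negbTE ms) !ltnS.
Qed.

(** Whichever of [l] and [m] comes first moves [b] across a cut that the remaining letters preserve.
    The order of the two letters thus depends on the product only. *)
Lemma wordprod_index u l m b : uniq u -> l \in u -> m \in u -> l.+1 = m -> b = m :> nat ->
  (index l u < index m u) = ((wordprod u)^-1%g b < b).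
Proof.
move=> + + + lm bm; have nlm : (l == m) = false by apply/negbTE; rewrite -val_eqE /=; lia.
elim: u => //= s u IHu /andP[su uu].
rewrite !inE lmulVE tpermV ![s == _]eq_sym.
have [ls _|nls /= lu] := eqVneq l s.
  have -> : m == s = false by rewrite -ls eq_sym.
  have -> : b = lift ord0 s by apply: val_inj; rewrite /= bm -lm ls /bump.
  rewrite tpermR /= => _; apply/esym.
  by apply: (@leq_ltn_trans s); rewrite ?wordprodV_leq // /bump; lia.
have [ms _|nms /= mu] := eqVneq m s.
  have -> : b = widen_ord (leqnSn n) s by apply: val_inj; rewrite /= bm ms.
  rewrite tpermL ltn0; apply/esym/negbTE; rewrite -leqNgt ltnW // ltnNge.
  by rewrite wordprodV_leq // -ltnNge /= /bump; lia.
rewrite ltnS IHu // tpermD //; rewrite -val_eqE /= ?/bump; move: nls nms; rewrite -!val_eqE /=; lia.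
Qed.

Theorem sortable_aligned (Q : rel 'I_n) (c w : 'S_n.+1) :
  coxeter_of Q c -> sortable c w ->
  forall a b d l m, a < b < d -> inverted w a d -> l.+1 = m -> b = m :> nat ->
  (Q m l -> inverted w a b) /\ (Q l m -> inverted w b d).
Proof.
move=> [u0 [perm_u0 u0Q u0c]] [u [cs [[red_u uc] [red_w csw] sub_cs sort_cs]]].
have uu0 : uniq u0 by rewrite (perm_uniq perm_u0) enum_uniq.
have u0T i : i \in u0 by rewrite (perm_mem perm_u0) mem_enum.
have uT i : i \in u.
  have: i \in supp (wordprod u) by rewrite uc -u0c supp_uniq.
  by case/suppP => a [b [ib inv_ab]]; apply: inverted_mem inv_ab ib.
(* [u] contains every letter and, being reduced, is no longer than [u0]. *)
have uu : uniq u.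
  apply: (@leq_size_uniq _ u0) => //.
  move/eqP: red_u => ->; rewrite uc -u0c plengthE; exact: ninv_wordprod.
move=> a b d l m abd inv_ad lm bm.
have := sorts_aligned (sortable_sorts uu sub_cs sort_cs) uu red_w abd.
rewrite csw => /(_ _ _ inv_ad lm bm).
have E : (index l u0 < index m u0) = (index l u < index m u).
  by rewrite !(@wordprod_index _ l m b) // u0c uc.
have nlm : index l u != index m u.
  by apply/negP => /eqP/(index_inj l (uT l) (uT m))/(congr1 val) /=; lia.
case=> H1 H2; split=> /u0Q; first by rewrite E.
by move=> lt; apply: H2; rewrite ltn_neqAle eq_sym nlm leqNgt -E -leqNgt ltnW.
Qed.

End Sortable.

Local Open Scope ring_scope.

(** * Interval subrepresentations of subquotients *)

Section Chains.
Variables (k : fieldType) (n : nat) (Q : rel 'I_n) (I : rel nat).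
Hypothesis hQ : type_A Q.
Hypothesis I_trans : forall a b d, I a b -> I b d -> I a d.
Implicit Types (X Y L N : rep k Q).

Definition fam X := forall l, {vspace X l}.
Definition fam0 X : fam X := fun l => 0%VS.
Definition famT X : fam X := fun l => fullv.

Definition stable X (U : fam X) :=
  forall l m (a : Q l m) x, x \in U l -> arrow X a x \in U m.

Definition fam_le X (U V : fam X) := forall l, (U l <= V l)%VS.

(* Such an [x] in [V] spans an interval subrepresentation M_[i,j) of V / U, and
   [tfree U V] says that all of these have their bounds in [I]. *)
Definition chain X (U : fam X) (i j : nat) (x : forall l, X l) :=
  [/\ (i < j <= n)%N, forall l, (x l \notin U l) = (i <= l < j)%N
    & forall l m (a : Q l m), (i <= l < j)%N -> arrow X a (x l) - x m \in U m].

Definition tfree X (U V : fam X) :=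
  forall i j x, (forall l, x l \in V l) -> chain U i j x -> I i j.

Definition torsion_free X := tfree (fam0 X) (famT X).

Lemma adjacent l m : Q l m -> (m = l.+1 :> nat) \/ (l = m.+1 :> nat).
Proof.
move=> q; have [+ _] := hQ l m; rewrite q /= => /esym/orP[/eqP<-|/eqP<-]; first by left.
by right.
Qed.

Section Switch.
Variables (X : rep k Q) (U V W : fam X).
Hypotheses (leUV : fam_le U V) (stV : stable V).
Hypotheses (tfUV : tfree U V) (tfVW : tfree V W).
Variables (i j : nat) (x : forall l, X l).
Hypotheses (xW : forall l, x l \in W l) (xch : chain U i j x).

Let P (b : nat) : bool := oapp (fun l => x l \in V l) false (insub b).

Let PE (l : 'I_n) : P l = (x l \in V l).
Proof. by rewrite /P valK. Qed.

(** The ends of the interval and the points where [x] enters or leaves [V]. [P] matters only at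
    vertices of [i, j), so its default value is harmless. *)
Definition switch (b : nat) := [|| b == i, b == j | (i < b < j)%N && (P b.-1 != P b)].

(** Restrict [x] to the run [a, b). If it lies in [V] there, stability of [V] forbids arrows from
    the run to the rest of [i, j), and a chain of V / U is obtained. Otherwise such arrows end where
    [x] lies in [V], and a chain of W / V is obtained. *)
Lemma switch_run a b : switch a -> switch b -> (i <= a)%N -> (a < b)%N -> (b <= j)%N ->
  (forall c, (a < c < b)%N -> ~~ switch c) -> I a b.
Proof.
move=> swa swb ia ltab bj nsw; case: xch => ijn xU arrx.
have Pconst c : (a <= c < b)%N -> P c = P a.
  elim: c => [|c IHc] ltc; first by have -> : a = 0%N by lia.
  have [<-//|nac] := eqVneq a c.+1.
  rewrite -IHc; last by lia.
  apply: contraNeq (nsw c.+1 ltac:(lia)) => ne.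
  by rewrite /switch /= [P c == _]eq_sym ne; lia.
have Pout (l m : 'I_n) (q : Q l m) : (a <= l < b)%N -> ~~ (a <= m < b)%N ->
    (i <= m < j)%N -> P m != P l.
  move=> ltl nm ltm; have [E|E] := adjacent q.
    have Eb : b = m by lia.
    by move: swb; rewrite /switch Eb E /= eq_sym -E; lia.
  have Ea : a = l by lia.
  by move: swa; rewrite /switch Ea E /= -E; lia.
have xout (m : 'I_n) : ~~ (i <= m < j)%N -> x m \in U m by rewrite -xU negbK.
pose y (l : 'I_n) := if (a <= l < b)%N then x l else 0.
have [Pa|nPa] := boolP (P a).
  apply: (tfUV (x := y)) => [l|].
    by rewrite /y; case: ifP => [lt|_]; rewrite ?mem0v // -PE Pconst.
  split=> [|l|l m q ltl]; first lia.
    rewrite /y; case: ifP => lt; last by rewrite mem0v.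
    by rewrite xU; lia.
  have Pl : x l \in V l by rewrite -PE Pconst.
  have q1 := arrx _ _ q ltac:(lia).
  rewrite /y ltl; case: ifP => [//|/negbT nm]; rewrite subr0.
  rewrite -[arrow X q _](subrK (x m)) rpredD // xout //.
  apply/negP => ltm; have := Pout _ _ q ltl nm ltm.
  rewrite !PE Pl eqb_id => /negP[].
  rewrite -[x m](subKr (arrow X q (x l))) rpredB ?stV //.
  exact: (subvP (leUV m)).
apply: (tfVW (x := y)) => [l|].
  by rewrite /y; case: ifP => [lt|_]; rewrite ?mem0v.
split=> [|l|l m q ltl]; first lia.
  rewrite /y; case: ifP => lt; last by rewrite mem0v.
  by rewrite -PE Pconst.
have q1 := subvP (leUV m) _ (arrx _ _ q ltac:(lia)).
rewrite /y ltl; case: ifP => [//|/negbT nm]; rewrite subr0.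
rewrite -[arrow X q _](subrK (x m)) rpredD //.
have [ltm|nltm] := boolP (i <= m < j)%N; last by apply/(subvP (leUV m))/xout.
by have := Pout _ _ q ltl nm ltm; rewrite [P l]Pconst // PE (negbTE nPa); case: (x m \in V m).
Qed.

Lemma switch_inv a b : switch a -> switch b -> (i <= a)%N -> (a < b)%N -> (b <= j)%N -> I a b.
Proof.
have [N] := ubnP (b - a); elim: N a b => // N IHN a b leN swa swb ia ab bj.
have [/hasP[c]|/hasPn nc] := boolP (has switch (iota a.+1 (b - a.+1))).
  rewrite mem_iota => ltc swc.
  by apply: (@I_trans _ c); apply: IHN => //; lia.
by apply: switch_run => // c ltc; apply: nc; rewrite mem_iota; lia.
Qed.

Lemma switch_ends : I i j.
Proof.
by case: xch => ijn _ _; apply: switch_inv; rewrite /switch ?eqxx ?orbT //; lia.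
Qed.

Lemma switch_inner (l m : 'I_n) : (i <= l < j)%N -> (i <= m < j)%N ->
  x l \in V l -> x m \notin V m -> exists b, [/\ (i < b < j)%N, I i b & I b j].
Proof.
move=> ltl ltm Vl nVm; case: xch => ijn _ _.
have [/hasP[c]|/hasPn nc] := boolP (has switch (iota i.+1 (j - i.+1))).
  rewrite mem_iota => ltc swc; exists c; split; first lia.
    by apply: switch_inv => //; rewrite /switch ?eqxx //; lia.
  by apply: switch_inv => //; rewrite /switch ?eqxx ?orbT //; lia.
have Pconst c : (i <= c < j)%N -> P c = P i.
  elim: c => [|c IHc] ltc; first by have -> : i = 0%N by lia.
  have [<-//|nac] := eqVneq i c.+1.
  rewrite -IHc; last by lia.
  apply: contraNeq (nc c.+1 _) => [ne|]; last by rewrite mem_iota; lia.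
  by rewrite /switch /= [P c == _]eq_sym ne; lia.
by move: nVm; rewrite -PE Pconst // -(Pconst l) // PE Vl.
Qed.

End Switch.

(** Each run between two switches has its bounds in [I], and transitivity composes the runs. *)
Lemma tfree_ext X (U V W : fam X) : fam_le U V -> stable V ->
  tfree U V -> tfree V W -> tfree U W.
Proof. by move=> leUV stV tfUV tfVW i j x xW; apply: (switch_ends leUV stV tfUV tfVW xW). Qed.

Lemma tfree_sub X (U V W : fam X) : fam_le V W -> tfree U W -> tfree U V.
Proof. by move=> le tfUW i j x xV; apply: tfUW => l; apply/(subvP (le l)). Qed.

End Chains.

(** * Linear algebra, morphisms, subrepresentations and quotients *)

Section LinearMaps.
Variables (k : fieldType) (U V : vectType k).

Definition lfun_of (f : U -> V) (lf : linear f) : 'Hom(U, V) :=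
  linfun (HB.pack_for {linear U -> V} f (GRing.isLinear.Build _ _ _ _ f lf)).

Lemma lfun_ofE f lf x : @lfun_of f lf x = f x.
Proof. by rewrite lfunE. Qed.

Lemma lker0_inv (f : 'Hom(U, V)) : lker f = 0%VS -> forall x, (f^-1)%VF (f x) = x.
Proof. by move=> /eqP kf x; rewrite lker0_lfunK. Qed.

Lemma limgT_inv (f : 'Hom(U, V)) : limg f = fullv -> forall y, f ((f^-1)%VF y) = y.
Proof. by move=> If y; rewrite limg_lfunVK // If memvf. Qed.

End LinearMaps.

Section Quotient.
Variables (k : fieldType) (V : vectType k) (U : {vspace V}).

(** The quotient by [U] is realised on a complement of [U], the image of the idempotent
    [1 - projv U]. *)
Definition qmap : 'Hom(V, subvs_of (limg (\1 - projv U)%VF)) :=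
  (linfun (vsproj (limg (\1 - projv U)%VF)) \o (\1 - projv U))%VF.

Lemma qmap_eq0 x : (qmap x == 0) = (x \in U).
Proof.
rewrite comp_lfunE lfunE -(inj_eq val_inj) /= vsprojK ?memv_img ?memvf //.
rewrite add_lfunE opp_lfunE id_lfunE subr_eq0 eq_sym.
apply/eqP/idP => [<-|/projv_id //]; exact: memv_proj.
Qed.

Lemma qmap_surj : limg qmap = fullv.
Proof.
apply/vspaceP => y; rewrite memvf; apply/memv_imgP.
have /memv_imgP[x _ E] := valP y.
by exists x; rewrite ?memvf // comp_lfunE lfunE; apply: val_inj; rewrite /= vsprojK ?memv_img ?memvf.
Qed.

End Quotient.

Section Reps.
Variables (k : fieldType) (n : nat) (Q : rel 'I_n).
Implicit Types (X Y L N : rep k Q).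

Lemma hom_arrow X Y (f : hom X Y) l m (a : Q l m) x :
  f m (arrow X a x) = arrow Y a (f l x).
Proof. by have /lfunP/(_ x) := hom_comm f a; rewrite !comp_lfunE. Qed.

Definition mkhom X Y (f : forall l, 'Hom(X l, Y l))
  (fa : forall l m (a : Q l m) x, f m (arrow X a x) = arrow Y a (f l x)) : hom X Y.
Proof. by exists f => l m a; apply/lfunP => x; rewrite !comp_lfunE. Defined.

Definition homcomp X Y N (g : hom Y N) (f : hom X Y) : hom X N.
Proof.
apply: (@mkhom X N (fun l => (g l \o f l)%VF)) => l m a x.
by rewrite !comp_lfunE !hom_arrow.
Defined.

Lemma homcompE X Y N (g : hom Y N) (f : hom X Y) l x :
  homcomp g f l x = g l (f l x).
Proof. exact: comp_lfunE. Qed.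

Definition mono X Y (f : hom X Y) := forall l, lker (f l) = 0%VS.
Definition epi X Y (f : hom X Y) := forall l, limg (f l) = fullv.

Lemma mono_inj X Y (f : hom X Y) : mono f -> forall l, injective (f l).
Proof. by move=> mf l; apply/lker0P; rewrite mf. Qed.

Lemma injective_mono X Y (f : hom X Y) : (forall l x, f l x = 0 -> x = 0) -> mono f.
Proof.
move=> inj l; apply/vspaceP => x; rewrite memv_ker memv0.
by apply/eqP/eqP => [/inj//|->]; rewrite linear0.
Qed.

Lemma surjective_epi X Y (f : hom X Y) : (forall l y, exists x, f l x = y) -> epi f.
Proof.
move=> sf l; apply/vspaceP => y; rewrite memvf; apply/memv_imgP.
by have [x <-] := sf l y; exists x; rewrite ?memvf.
Qed.

Lemma epi_surj X Y (f : hom X Y) : epi f -> forall l y, exists x, f l x = y.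
Proof. by move=> ef l y; exists ((f l)^-1%VF y); apply: limgT_inv. Qed.

Lemma mono_eq0 X Y (f : hom X Y) l x : mono f -> (f l x == 0) = (x == 0).
Proof. by move=> mf; rewrite -(linear0 (f l)) (inj_eq (mono_inj mf (l:=l))). Qed.

Lemma iso_bij X Y (f : hom X Y) : is_iso f -> mono f /\ epi f.
Proof.
case=> g gf; split.
  apply: injective_mono => l x fx; have [/lfunP/(_ x) E _] := gf l.
  by rewrite comp_lfunE fx linear0 id_lfunE in E.
apply: surjective_epi => l y; exists (g l y); have [_ /lfunP/(_ y)] := gf l.
by rewrite comp_lfunE id_lfunE.
Qed.

Lemma bij_iso X Y (f : hom X Y) : mono f -> epi f -> is_iso f.
Proof.
move=> mf ef.
have gE l m (a : Q l m) y : (f m)^-1%VF (arrow Y a y) = arrow X a ((f l)^-1%VF y).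
  by apply: (mono_inj mf); rewrite hom_arrow !limgT_inv.
exists (mkhom gE) => l; split; apply/lfunP => x; rewrite comp_lfunE id_lfunE /=.
  exact: lker0_inv.
exact: limgT_inv.
Qed.

Lemma iso_sym X Y : iso X Y -> iso Y X.
Proof. by case=> f [g gf]; exists g, f => l; have [] := gf l. Qed.

Lemma iso_trans X Y N : iso X Y -> iso Y N -> iso X N.
Proof.
case=> f /iso_bij[mf ef] [g /iso_bij[mg eg]].
exists (homcomp g f); apply: bij_iso.
  by apply: injective_mono => l x /eqP; rewrite comp_lfunE !mono_eq0 // => /eqP.
apply: surjective_epi => l y; have [z <-] := epi_surj eg y.
by have [x <-] := epi_surj ef z; exists x; rewrite comp_lfunE.
Qed.

Definition img X Y (f : hom X Y) : fam Y := fun l => limg (f l).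
Definition kern X Y (f : hom X Y) : fam X := fun l => lker (f l).

Lemma mem_img X Y (f : hom X Y) l y : reflect (exists x, y = f l x) (y \in img f l).
Proof. by apply: (iffP memv_imgP) => [[x _ ->]|[x ->]]; exists x; rewrite ?memvf. Qed.

Lemma img_mem X Y (f : hom X Y) l x : f l x \in img f l.
Proof. by rewrite memv_img ?memvf. Qed.

Lemma img_stable X Y (f : hom X Y) : stable (img f).
Proof. by move=> l m a x /mem_img[y ->]; rewrite -hom_arrow img_mem. Qed.

Lemma short_exactP L X N (f : hom L X) (g : hom X N) : mono f -> epi g ->
  (forall l x, (g l x == 0) = (x \in img f l)) -> short_exact f g.
Proof.
move=> mf eg fg l; split=> //; apply/vspaceP => x.
by rewrite memv_ker fg.
Qed.

Lemma se_mono L X N (f : hom L X) (g : hom X N) : short_exact f g -> mono f.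
Proof. by move=> fg l; have [] := fg l. Qed.
Lemma se_epi L X N (f : hom L X) (g : hom X N) : short_exact f g -> epi g.
Proof. by move=> fg l; have [] := fg l. Qed.
Lemma se_ker L X N (f : hom L X) (g : hom X N) : short_exact f g ->
  forall l x, (g l x == 0) = (x \in img f l).
Proof. by move=> fg l x; have [_ E _] := fg l; rewrite /img E memv_ker. Qed.

Section Sub.
Variables (X : rep k Q) (U : fam X).
Hypothesis stU : stable U.

Definition subrep : rep k Q :=
  Rep (space := fun l => subvs_of (U l) : vectType k)
    (fun l m a => (linfun (vsproj (U m)) \o arrow X a \o linfun vsval)%VF).

Lemma subinclE l m (a : Q l m) (x : subrep l) :
  linfun (vsval : subrep m -> X m) (arrow subrep a x) = arrow X a (linfun (vsval : subrep l -> X l) x).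
Proof.
rewrite /= !lfunE /= !comp_lfunE !lfunE /= vsprojK // stU //.
exact: (valP x).
Qed.

Definition subincl : hom subrep X := mkhom subinclE.

Lemma subincl_mono : mono subincl.
Proof.
by apply: injective_mono => l x; rewrite /= lfunE /= => E; apply: val_inj; rewrite /= E.
Qed.

Lemma subincl_img l : img subincl l = U l.
Proof.
apply/vspaceP => x; apply/mem_img/idP => [[y ->]|xU].
  by rewrite /= lfunE; apply: (valP y).
by exists (vsproj (U l) x); rewrite /= lfunE /= vsprojK.
Qed.

(** Arrows act on an arbitrary preimage; stability of [U] makes the choice immaterial, as [qprojE]
    shows. *)
Definition quotrep : rep k Q :=
  Rep (space := fun l => subvs_of (limg (\1 - projv (U l))%VF) : vectType k)
    (fun l m a => (qmap (U m) \o arrow X a \o (qmap (U l))^-1)%VF).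

Lemma qprojE l m (a : Q l m) x :
  (qmap (U m) : 'Hom(X m, quotrep m)) (arrow X a x) = arrow quotrep a (qmap (U l) x).
Proof.
pose y := ((qmap (U l))^-1)%VF (qmap (U l) x).
have: qmap (U m) (arrow X a x - arrow X a y) == 0.
  rewrite qmap_eq0 -linearB stU // -qmap_eq0 linearB subr_eq0.
  exact/eqP/esym/limgT_inv/qmap_surj.
rewrite linearB subr_eq0 => /eqP E; rewrite [LHS]E.
by apply/esym; rewrite [LHS]comp_lfunE [LHS]comp_lfunE.
Qed.

Definition qproj : hom X quotrep := mkhom qprojE.

Lemma qproj_epi : epi qproj.
Proof. by move=> l; apply: qmap_surj. Qed.

Lemma qproj_eq0 l x : (qproj l x == 0) = (x \in U l).
Proof. exact: qmap_eq0. Qed.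

Lemma sub_quot_exact : short_exact subincl qproj.
Proof.
apply: short_exactP; [exact: subincl_mono|exact: qproj_epi|move=> l x].
by rewrite qproj_eq0 subincl_img.
Qed.

End Sub.

Section ChainHom.
Variables (X Y : rep k Q) (f : hom X Y) (U : fam X) (V : fam Y).
Hypothesis UV : forall l x, (f l x \in V l) = (x \in U l).

(** Only the fact that [U] is the preimage of [V] matters, so this serves both for embeddings with
    zero families and for projections with their kernels. *)
Lemma chain_hom i j x : chain U i j x <-> chain V i j (fun l => f l (x l)).
Proof.
split=> -[ij xU ax].
  split=> // [l|l m a lt]; first by rewrite UV xU.
  by rewrite -hom_arrow -linearB UV ax.
split=> // [l|l m a lt]; first by rewrite -UV xU.
by rewrite -UV linearB /= hom_arrow ax.
Qed.

Variable I : rel nat.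

Lemma tfree_pull (A : fam X) (B : fam Y) :
  (forall l x, x \in A l -> f l x \in B l) -> tfree I V B -> tfree I U A.
Proof.
move=> AB tfY i j x xA /chain_hom ch; apply: tfY ch => l; exact: AB.
Qed.

Lemma tfree_push (A : fam X) (B : fam Y) :
  (forall l y, y \in B l -> exists2 x, x \in A l & f l x = y) ->
  tfree I U A -> tfree I V B.
Proof.
move=> BA tfX i j y yB ch.
(* Lifts are chosen vertex by vertex: arrow relations are required only modulo the family, so no
   compatibility between them is needed. *)
have [x xy] := fin_all_exists2 (fun l => BA l _ (yB l)).
move=> xE; apply: (tfX i j x) => //; apply/chain_hom.
case: ch => ij yV ay; split=> // [l|l m a lt]; first by rewrite xE.
by rewrite !xE ay.
Qed.

End ChainHom.

End Reps.

(** * Splitting off an interval *)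

Section Splitting.
Variables (k : fieldType) (n : nat) (Q : rel 'I_n).
Hypothesis hQ : type_A Q.
Implicit Types (X Y L N : rep k Q).

Lemma hyperplane (V : vectType k) (U : {vspace V}) x : x \notin U ->
  exists C : {vspace V}, [/\ (U <= C)%VS, x \notin C & forall y, y \in (C + <[x]>)%VS].
Proof.
move=> xU; exists (U + (U + <[x]>)^C)%VS; split; first exact: addvSl.
  apply: contra xU => /memv_addP[u uU [c cC E]].
  suff : c \in ((U + <[x]>) :&: (U + <[x]>)^C)%VS.
    by rewrite capv_compl memv0 => /eqP c0; rewrite E c0 addr0.
  rewrite memv_cap cC andbT -[c](addKr u) -E addrC rpredB //.
    exact/(subvP (addvSr _ _))/memv_line.
  exact: (subvP (addvSl _ _)).
move=> y; rewrite -addvA [(_^C + _)%VS]addvC addvA addv_complf.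
exact: memvf.
Qed.

Lemma mem_add_line (V : vectType k) (C : {vspace V}) x y :
  reflect (exists c, y - c *: x \in C) (y \in (C + <[x]>)%VS).
Proof.
apply: (iffP memv_addP) => [[u uC [_ /vlineP[c ->] ->]]|[c yC]].
  by exists c; rewrite addrK.
exists (y - c *: x) => //; exists (c *: x); first by rewrite memvZ ?memv_line.
by rewrite subrK.
Qed.

(** On the vertices from [l] on, [X] splits as [C] plus the interval [l, j) spanned by [x]. The
    conditions involving [S] and [N] are what allows the splitting to be continued to the left of
    [l]. *)
Definition tail_summand X (l : 'I_n) (N S : {vspace X l}) (j : nat)
    (x : forall m, X m) (C : fam X) : Prop :=
  [/\ (l < j <= n)%N, x l \in S, (N <= C l)%VS,
      forall m : 'I_n, if (l <= m < j)%N then x m \notin C m else x m == 0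
    & (forall m y, y \in (C m + <[x m]>)%VS) /\
      forall m m' (a : Q m m'), (l <= m)%N -> (l <= m')%N ->
      ((m < j)%N -> arrow X a (x m) = x m') /\
      forall y, y \in C m -> arrow X a y \in C m'].

Lemma succ_neq (l m : 'I_n) : m = l.+1 :> nat -> l != m.
Proof. by move=> E; rewrite -val_eqE /= E neq_ltn ltnSn. Qed.

(** The interval consists of the vertex [l] alone, and [C] is a hyperplane there. The last two
    hypotheses treat the two directions of the next arrow: it kills [x], or its image stays in a
    space avoiding [x]. *)
Lemma tail_summand_stop X l (N S T : {vspace X l}) x :
  (N <= T)%VS -> x \in S -> x \notin T ->
  (forall m (a : Q l m), m = l.+1 :> nat -> arrow X a x = 0) ->
  (forall m (a : Q m l) y, m = l.+1 :> nat -> arrow X a y \in T) ->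
  exists j x C, @tail_summand X l N S j x C.
Proof.
move=> NT xS xT ax aT; have [C [TC xC Cx]] := hyperplane xT.
exists l.+1, (dfwith (fun m => 0 : X m) x), (dfwith (fun m => fullv : {vspace X m}) C).
split; rewrite ?dfwith_in ?ltnSn ?(ltn_ord l) //; first exact: (subv_trans NT TC).
  move=> m; have [<-|nlm] := eqVneq l m; first by rewrite !dfwith_in leqnn ltnSn.
  rewrite !dfwith_out // ltnS -eqn_leq [nat_of_ord l == m](_ : _ = false) ?eqxx //.
  exact/negbTE.
split=> [m y|m m' a lm lm'].
  have [E|nlm] := eqVneq l m; first by case: m / E y => y; rewrite !dfwith_in.
  by rewrite !dfwith_out // (subvP (addvSl _ _)) // memvf.
have [mE|m'E] := adjacent hQ a.
  have nlm' : l != m' by rewrite -val_eqE /= mE neq_ltn ltnS lm.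
  rewrite ![dfwith _ _ m']dfwith_out //; split=> [lt|y _]; last exact: memvf.
  have lmE : l = m by apply/val_inj/eqP; rewrite eqn_leq lm -ltnS.
  by case: m / lmE a mE {lm lt} => a mE; rewrite dfwith_in ax.
have nlm : l != m by rewrite -val_eqE /= m'E neq_ltn ltnS lm'.
rewrite ![dfwith _ _ m]dfwith_out //; split=> [|y _]; first by rewrite ltnS m'E ltnNge lm'.
have [E|nlm'] := eqVneq l m'; last by rewrite dfwith_out // memvf.
by case: m' / E a m'E {lm'} => a m'E; rewrite dfwith_in (subvP TC) // aT.
Qed.

Lemma tail_summand_glue X (l l1 : 'I_n) (N S : {vspace X l}) (N1 S1 : {vspace X l1})
    (x1 : X l) (C1 : {vspace X l}) j (x : forall m, X m) (C : fam X) :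
  l1 = l.+1 :> nat -> tail_summand N1 S1 j x C ->
  x1 \in S -> (N <= C1)%VS -> x1 \notin C1 -> (forall y, y \in (C1 + <[x1]>)%VS) ->
  (forall a : Q l l1, arrow X a x1 = x l1 /\ forall y, y \in C1 -> arrow X a y \in C l1) ->
  (forall a : Q l1 l, arrow X a (x l1) = x1 /\ forall y, y \in C l1 -> arrow X a y \in C1) ->
  exists j x C, @tail_summand X l N S j x C.
Proof.
move=> l1E [ltj _ _ xC [full aC]] x1S NC1 x1C1 full1 a1 a1'.
have after (m : 'I_n) : l != m -> (l1 <= m)%N = (l <= m)%N.
  by rewrite l1E -val_eqE /= ltn_neqAle => ->.
have next (m : 'I_n) : (l <= m)%N -> m = l.+1 :> nat \/ l = m.+1 :> nat -> m = l1.
  by move=> lm [E|E]; [apply: val_inj; rewrite /= l1E|rewrite E ltnn in lm].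
exists j, (dfwith x x1), (dfwith C C1).
split; rewrite ?dfwith_in //; first by case/andP: ltj => + ->; rewrite l1E => /ltnW ->.
  move=> m; have [E|nlm] := eqVneq l m.
    case: m / E; rewrite !dfwith_in leqnn /= ifT //.
    by case/andP: ltj => + _; rewrite l1E => /ltnW.
  by rewrite !dfwith_out // -(after _ nlm); apply: xC.
split=> [m y|m m' a lm lm'].
  have [E|nlm] := eqVneq l m; first by case: m / E y => y; rewrite !dfwith_in.
  by rewrite !dfwith_out.
have [E|nlm] := eqVneq l m.
  case: m / E a {lm} => a; have Em' := next m' lm' (adjacent hQ a); subst m'.
  by rewrite !dfwith_in !dfwith_out ?succ_neq //; have [-> H] := a1 a.
rewrite ![dfwith _ _ m]dfwith_out //; have [E|nlm'] := eqVneq l m'.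
  case: m' / E a {lm'} => a.
  have Em : m = l1 by apply: next => //; case: (adjacent hQ a); [right|left].
  by subst m; rewrite !dfwith_in; have [-> H] := a1' a.
by rewrite ![dfwith _ _ m']dfwith_out //; apply: aC; rewrite after.
Qed.

(* [S] and [N] stand for the elements of [X l] related to some element, resp. to
   zero, by the composite of the linear relations on the arrows to the left of
   [l]; the summand ends at the first vertex where an element of [S] outside of
   [N] can stop. *)
Lemma tail_summand_exists X r : forall (l : 'I_n), (n - l <= r)%N ->
  forall N S : {vspace X l}, (N <= S)%VS -> ~~ (S <= N)%VS ->
  exists j x C, @tail_summand X l N S j x C.
Proof.
elim: r => [|r IHr] l ler N S NS nSN; first by have := ltn_ord l; lia.
have /subvPn[x0 x0S x0N] := nSN.
have [ln|ln] := eqVneq l.+1 n.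
  by apply: (tail_summand_stop (subvv N) x0S x0N) => m a; have := ltn_ord m; lia.
have ltl1 : (l.+1 < n)%N by have := ltn_ord l; lia.
pose l1 := Ordinal ltl1.
have l1E (m : 'I_n) : m = l.+1 :> nat -> m = l1 by move=> E; apply: val_inj.
have ler1 : (n - l1 <= r)%N by rewrite /=; lia.
have := (hQ l l1).1; rewrite /= eqxx /= => /orP[a|a].
  have na' : ~ Q l1 l by move=> a'; have := (hQ l l1).2; rewrite a a'.
  (* An element of [S] outside [N] that the arrow kills can stop here. If there is none, the arrow
     is injective on S / N, and a summand found on the right is pulled back along it. *)
  have [sub|/subvPn[x /[!memv_cap] /andP[xS xk] xN]] :=
      boolP (S :&: lker (arrow X a) <= N)%VS; last first.
    apply: (tail_summand_stop (subvv N) xS xN) => [m b /l1E E|m b y /l1E E].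
      subst m; rewrite (bool_irrelevance b a).
      by apply/eqP; rewrite -memv_ker.
    by subst m; case: na'.
  have [||j [x [C xCP]]] :=
      IHr l1 ler1 (arrow X a @: N)%VS (arrow X a @: S)%VS; first exact: limgS.
    apply/negP => /subvP le; case/negP: x0N.
    have /memv_imgP[y yN E] := le _ (memv_img (arrow X a) x0S).
    have yS := subvP NS _ yN.
    rewrite -(subrK y x0) rpredD // (subvP sub) // memv_cap rpredB //=.
    by rewrite memv_ker linearB /= E subrr.
  have [ltj /memv_imgP[x1 x1S x1E] NC xC [full _]] := xCP.
  apply: (tail_summand_glue (x1 := x1) (C1 := arrow X a @^-1: C l1) _ xCP) => //.
  - by apply/subvP => y yN; rewrite -memv_preim (subvP NC) // memv_img.
  - by have := xC l1; rewrite -memv_preim -x1E leqnn; case/andP: ltj => ->.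
  - move=> y; apply/mem_add_line; have /mem_add_line[c cC] := full l1 (arrow X a y).
    by exists c; rewrite -memv_preim linearB linearZ /= -x1E.
  - move=> b; rewrite (bool_irrelevance b a) -x1E; split=> // y.
    by rewrite -memv_preim.
have na' : ~ Q l l1 by move=> a'; have := (hQ l l1).2; rewrite a a'.
(* Now the arrow points to [l]: an element of [S] can stop if it is not in [N] plus the image.
   Otherwise all of [S] is reached modulo [N], and a summand on the right is pushed forward, with a
   hyperplane containing the image of its complement. *)
have [/subvP sub|/subvPn[x xS xT]] := boolP (S <= N + limg (arrow X a))%VS; last first.
  apply: (tail_summand_stop (addvSl _ _) xS xT) => [m b /l1E E|m b y /l1E E].
    by subst m; case: na'.
  subst m; rewrite (bool_irrelevance b a).
  by rewrite (subvP (addvSr _ _)) // memv_img ?memvf.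
have [||j [x [C xCP]]] :=
    IHr l1 ler1 (arrow X a @^-1: N)%VS (arrow X a @^-1: S)%VS.
- by apply/subvP => y; rewrite -!memv_preim => /(subvP NS).
- apply/negP => /subvP le; case/negP: x0N.
  have /memv_addP[y yN [_ /memv_imgP[z _ ->] E]] := sub _ x0S.
  rewrite E rpredD // memv_preim le // -memv_preim.
  by rewrite -[arrow X a z](addKr y) -E addrC rpredB // (subvP NS) // yN.
have [ltj x1S NC xC [full _]] := xCP.
have [|C1 [UC1 x1C1 full1]] := @hyperplane _ (N + arrow X a @: C l1)%VS (arrow X a (x l1)).
  apply/negP => /memv_addP[y yN [_ /memv_imgP[c cC ->] E]].
  have := xC l1; rewrite leqnn; case/andP: ltj => -> _ /= /negP; apply.
  rewrite -(subrK c (x l1)) rpredD // (subvP NC) // -memv_preim linearB /= E.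
  by rewrite addrK.
apply: (tail_summand_glue (x1 := arrow X a (x l1)) (C1 := C1) _ xCP) => //.
- by rewrite memv_preim.
- exact: subv_trans (addvSl _ _) UC1.
- move=> b; rewrite (bool_irrelevance b a); split=> // y yC.
  by rewrite (subvP UC1) // (subvP (addvSr _ _)) // memv_img.
Qed.

Lemma interval_summand X : ~ is_zero X ->
  exists (i j : nat) (x : forall l, X l) (C : fam X),
  [/\ chain (fam0 X) i j x, chain C i j x, stable C
    & forall l y, y \in (C l + <[x l]>)%VS].
Proof.
move=> nzX; have nz : exists l, (fullv : {vspace X l}) != 0%VS.
  case: (boolP [exists l, (fullv : {vspace X l}) != 0%VS]) => [/existsP//|/existsPn z].
  case: nzX => l x; have := z l; rewrite negbK => /eqP E.
  by apply/eqP; rewrite -memv0 -E memvf.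
have [l Xl minl] : exists2 l : 'I_n, (fullv : {vspace X l}) != 0%VS &
    forall m : 'I_n, (m < l)%N -> (fullv : {vspace X m}) = 0%VS.
  have [l0 Xl0] := nz; case: (@arg_minnP _ l0 (fun l => (fullv : {vspace X l}) != 0%VS) (fun l : 'I_n => l : nat) Xl0) => l Xl minl.
  exists l => // m ml; apply/eqP/negPn/negP => Xm; have := minl m Xm; lia.
(* At the leftmost vertex where [X] is nonzero, nothing on the left imposes a condition, so [N] is
   zero and [S] is everything. *)
have [||j [x [C [ltj _ _ xC [full aC]]]]] :=
  @tail_summand_exists X n l (leq_subr _ _) 0%VS fullv; rewrite ?sub0v ?subv0 //.
have X0 m (y : X m) : (m < l)%N -> y = 0.
  by move=> /minl E; apply/eqP; rewrite -memv0 -E memvf.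
have aC' m m' (a : Q m m') : ((l <= m < j)%N -> arrow X a (x m) = x m') /\
      forall y, y \in C m -> arrow X a y \in C m'.
  have [lm|ml] := leqP l m; last first.
    by split=> [lt|y _]; [lia|rewrite [y]X0 // linear0 mem0v].
  have [lm'|ml'] := leqP l m'; last first.
    by split=> *; rewrite [arrow _ _ _]X0 ?mem0v // [RHS]X0.
  by have [H ?] := aC _ _ a lm lm'; split=> // /andP[_]; apply: H.
have x0 m : (x m == 0) = ~~ (l <= m < j)%N.
  have := xC m; case: ifP => [_|_ ->] //.
  by move=> xm; apply/negbTE; apply: contraNneq xm => ->; rewrite mem0v.
have {}xC m : (x m \notin C m) = (l <= m < j)%N.
  by have := xC m; case: ifP => // _ /eqP->; rewrite mem0v.
exists l, j, x, C; split=> //.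
- split=> // [m|m m' a lt]; first by rewrite memv0 x0 negbK.
  by rewrite (aC' _ _ a).1 // subrr mem0v.
- by split=> // m m' a lt; rewrite (aC' _ _ a).1 // subrr mem0v.
- by move=> m m' a y; apply: (aC' _ _ a).2.
Qed.

End Splitting.

(** * Interval representations in coordinates *)

Section Coordinate.
Variable k : fieldType.
Implicit Type b : bool.

(** Multiplying by the all-ones matrix gives a scalar for both lengths, 0 when the row is empty;
    this avoids case analysis on a type that depends on the vertex. *)
Definition crd b (v : 'rV[k]_b) : k := (v *m const_mx 1 : 'M_1) 0 0.

Lemma crd_linear b : scalar (@crd b).
Proof. by move=> c u v; rewrite /crd mulmxDl -scalemxAl !mxE. Qed.

Lemma crdZ b c (v : 'rV[k]_b) : crd (c *: v) = c * crd v.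
Proof. by rewrite /crd -scalemxAl mxE. Qed.

Lemma crd0 b : crd (0 : 'rV[k]_b) = 0.
Proof. by rewrite /crd mul0mx mxE. Qed.

Lemma crdE b (v : 'rV[k]_b) : v = crd v *: const_mx 1.
Proof.
rewrite /crd; case: b v => /= v; apply/rowP => i; last by case: i.
by rewrite !mxE big_ord1 !mxE mulr1 mulr1 [i]ord1.
Qed.

Lemma crd_one b : crd (const_mx 1 : 'rV[k]_b) = b%:R.
Proof.
rewrite /crd; case: b => /=; rewrite mxE ?big_ord0 // big_ord1 !mxE mulr1 //.
Qed.

Lemma crd_eq0 b (v : 'rV[k]_b) : (crd v == 0) = (v == 0).
Proof.
apply/eqP/eqP => [E|->]; first by rewrite [v]crdE E scale0r.
exact: crd0.
Qed.

Lemma row_false b (v : 'rV[k]_b) : ~~ b -> v = 0.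
Proof. by case: b v => // v _; apply: thinmx0. Qed.

Lemma crd_pid b b' (v : 'rV[k]_b) : crd (v *m pid_mx 1 : 'rV[k]_b') = crd v * b'%:R.
Proof.
case: b v => /= v; last by rewrite [v]thinmx0 mul0mx /crd !mul0mx !mxE mul0r.
rewrite /crd; case: b' => /=; last first.
  by rewrite !mxE big_ord0 mulr0.
by rewrite !mxE !big_ord1 !mxE !big_ord1 !mxE.
Qed.

End Coordinate.

Section Intervals.
Variables (k : fieldType) (n : nat) (Q : rel 'I_n).
Hypothesis hQ : type_A Q.
Implicit Types (X Y L N : rep k Q) (i j : 'I_n.+1).

Definition ione i j : forall l, interval k Q i j l := fun l => const_mx 1.

Lemma intervalE i j l (v : interval k Q i j l) : v = crd v *: ione i j l.
Proof. exact: crdE. Qed.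

Lemma interval_crd_arrow i j l m (a : Q l m) (v : interval k Q i j l) :
  crd (arrow (interval k Q i j) a v) = crd v * (i <= m < j)%N%:R.
Proof. by rewrite interval_arrowE crd_pid. Qed.

Lemma interval_out i j l (v : interval k Q i j l) : ~~ (i <= l < j)%N -> v = 0.
Proof.
exact: row_false.
Qed.

Lemma interval_chain i j : (i < j)%N -> chain (fam0 (interval k Q i j)) i j (ione i j).
Proof.
move=> ij; split; first by rewrite ij -ltnS ltn_ord.
  move=> l; rewrite memv0 -crd_eq0 crd_one; case: (_ <= l < _)%N => /=.
    by rewrite oner_eq0.
  by rewrite eqxx.
move=> l m a lt; rewrite memv0 subr_eq0; apply/eqP.
rewrite [LHS]intervalE [RHS]intervalE interval_crd_arrow !crd_one lt mul1r.
by case: (_ <= m < _)%N; rewrite // !scale0r.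
Qed.

Section ChainMap.
Variables (X : rep k Q) (i j : 'I_n.+1) (x : forall l, X l).
Hypothesis xch : chain (fam0 X) i j x.

Lemma chain_map_linear l : linear (fun v : interval k Q i j l => crd v *: x l).
Proof. by move=> c u v; rewrite crd_linear scalerDl scalerA. Qed.

Lemma chain_out (l : 'I_n) : ~~ (i <= l < j)%N -> x l = 0.
Proof. by case: xch => _ xE _; rewrite -xE negbK memv0 => /eqP. Qed.

Lemma chain_arrow (l m : 'I_n) (a : Q l m) : (i <= l < j)%N -> arrow X a (x l) = x m.
Proof. by case: xch => _ _ xa /(xa _ _ a); rewrite memv0 subr_eq0 => /eqP. Qed.

Lemma chain_map_comm l m (a : Q l m) v :
  lfun_of (@chain_map_linear m) (arrow (interval k Q i j) a v) =
  arrow X a (lfun_of (@chain_map_linear l) v).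
Proof.
rewrite !(lfun_ofE (@chain_map_linear _)); cbv beta; rewrite interval_crd_arrow linearZ /=.
have [lt|nlt] := orP (orbN (i <= l < j)%N); last first.
  by rewrite [v]interval_out // crd0 mul0r !scale0r.
rewrite chain_arrow //; have [lm|/chain_out ->] := orP (orbN (i <= m < j)%N); last by rewrite !scaler0.
by rewrite lm mulr1.
Qed.

(** A chain relative to [fam0] amounts to an embedding of an interval; [x] is the image of the
    generators [ione]. *)
Definition chain_map : hom (interval k Q i j) X := mkhom chain_map_comm.

Lemma chain_mapE l v : chain_map l v = crd v *: x l.
Proof. exact: lfun_ofE. Qed.

Lemma chain_map_mono : mono chain_map.
Proof.
apply: injective_mono => l v; rewrite chain_mapE => /eqP; rewrite scaler_eq0 crd_eq0.
case/orP => [/eqP //|/eqP xl0].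
have [lt|] := orP (orbN (i <= l < j)%N); last exact: interval_out.
by case: xch => _ /(_ l); rewrite lt xl0 mem0v.
Qed.

Lemma chain_map_img l y : (y \in img chain_map l) = (y \in <[x l]>%VS).
Proof.
apply/mem_img/vlineP => [[v ->]|[c ->]]; first by rewrite chain_mapE; exists (crd v).
exists (c *: ione i j l); rewrite chain_mapE.
have [lt|/chain_out ->] := orP (orbN (i <= l < j)%N); last by rewrite !scaler0.
by rewrite crdZ crd_one lt mulr1.
Qed.

Lemma chain_iso : (forall l y, y \in <[x l]>%VS) -> iso (interval k Q i j) X.
Proof.
move=> xT; exists chain_map; apply: bij_iso; first exact: chain_map_mono.
by move=> l; apply/vspaceP => y; rewrite memvf -[RHS](xT l y) -chain_map_img.
Qed.

End ChainMap.

End Intervals.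

(** * Closure properties of torsion-free representations *)

Section TorsionFree.
Variables (k : fieldType) (n : nat) (Q : rel 'I_n) (I : rel nat).
Hypothesis hQ : type_A Q.
Hypothesis I_trans : forall a b d, I a b -> I b d -> I a d.
(* If the arrow between b-1 and b points to b-1, then M_[a,b) is a subrepresentation of
   M_[a,d); otherwise M_[b,d) is. *)
Hypothesis I_aligned : forall a b d (l m : 'I_n), (a < b < d)%N -> I a d ->
  l.+1 = m -> b = m -> (Q m l -> I a b) /\ (Q l m -> I b d).
Implicit Types (X Y L N : rep k Q) (i j : 'I_n.+1).

Lemma tf_mono X Y (f : hom X Y) : mono f -> torsion_free I Y -> torsion_free I X.
Proof.
move=> mf; apply: (tfree_pull (f := f)) => [l x|l x _]; last exact: memvf.
by rewrite !memv0 mono_eq0.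
Qed.

Lemma tf_iso X Y : iso X Y -> torsion_free I X -> torsion_free I Y.
Proof. by case/iso_sym => f /iso_bij[mf _]; apply: tf_mono mf. Qed.

Lemma tf_img X Y (f : hom X Y) : mono f -> torsion_free I X -> tfree I (fam0 Y) (img f).
Proof.
move=> mf; apply: (tfree_push (f := f)) => [l x|l y /mem_img[x ->]].
  by rewrite !memv0 mono_eq0.
by exists x => //; apply: memvf.
Qed.

Lemma tf_quot X Y (f : hom X Y) (U : fam X) :
  (forall l x, (f l x == 0) = (x \in U l)) -> torsion_free I Y -> tfree I U (famT X).
Proof.
move=> fU; apply: (tfree_pull (f := f)) => [l x|l x _]; last exact: memvf.
by rewrite memv0 fU.
Qed.

Lemma quot_tf X Y (f : hom X Y) (U : fam X) : epi f ->
  (forall l x, (f l x == 0) = (x \in U l)) -> tfree I U (famT X) -> torsion_free I Y.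
Proof.
move=> ef fU; apply: (tfree_push (f := f)) => [l x|l y _]; first by rewrite memv0 fU.
by have [x <-] := epi_surj ef y; exists x => //; apply: memvf.
Qed.

Lemma tf_ext L X N (f : hom L X) (g : hom X N) :
  short_exact f g -> torsion_free I L -> torsion_free I N -> torsion_free I X.
Proof.
move=> fg tfL tfN; apply: (tfree_ext hQ I_trans (V := img f)).
- by move=> l; apply: sub0v.
- exact: img_stable.
- exact: tf_img (se_mono fg) tfL.
- exact: tf_quot (se_ker fg) tfN.
Qed.

Lemma tf_zero X : is_zero X -> torsion_free I X.
Proof.
move=> X0 i j x _ [/andP[ij jn] xU _].
have := xU (Ordinal (leq_trans ij jn)).
by rewrite [x _]X0 mem0v /= leqnn ij.
Qed.

(** A subrepresentation [a, b) has no arrow into the rest of [i, j). If [a] is not [i], the arrow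
    there thus points to [a] and alignment gives [I a j]; if [b] is not [j], the arrow there points
    to [b.-1] and alignment trims the right end. *)
Lemma tf_interval i j : I i j -> (i < j)%N -> torsion_free I (interval k Q i j).
Proof.
move=> Iij ij a b x _ [/andP[ab bn] xU xa].
have x0 l : (x l == 0) = ~~ (a <= l < b)%N by rewrite -xU memv0 negbK.
have lt_in (l : 'I_n) : (a <= l < b)%N -> (i <= l < j)%N.
  move=> lt; apply/negPn/negP => /interval_out E; move: (x0 l).
  by rewrite [x l]E eqxx lt.
have no_out (l m : 'I_n) : Q l m -> (a <= l < b)%N -> (i <= m < j)%N -> (a <= m < b)%N.
  move=> q lt ltm; have := xa _ _ q lt; rewrite memv0 subr_eq0 => /eqP E.
  apply/negPn; rewrite -x0 -E -crd_eq0 interval_crd_arrow ltm mulr1 crd_eq0 x0.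
  by rewrite lt.
have an : (a < n)%N by lia.
have bn' : (b.-1 < n)%N by lia.
have := lt_in (Ordinal an) ltac:(rewrite /=; lia).
have := lt_in (Ordinal bn') ltac:(rewrite /=; lia).
move=> /= ltb lta.
have Iaj : I a j.
  have [<- //|nia] := eqVneq (i : nat) a.
  have an' : (a.-1 < n)%N by lia.
  pose l := Ordinal an'; pose m := Ordinal an.
  have lm : l.+1 = m by rewrite /=; lia.
  have [H1 H2] := @I_aligned i a j l m ltac:(lia) Iij lm (erefl _).
  have := (hQ l m).1; rewrite lm eqxx /= => /orP[//|q].
  by have := no_out _ _ q ltac:(rewrite /=; lia) ltac:(rewrite /=; lia); rewrite /=; lia.
have [-> //|njb] := eqVneq b j.
have bn2 : (b < n)%N by have := ltn_ord j; lia.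
pose l := Ordinal bn'; pose m := Ordinal bn2.
have lm : l.+1 = m by rewrite /=; lia.
have [H1 H2] := @I_aligned a b j l m ltac:(lia) Iaj lm (erefl _).
have := (hQ l m).1; rewrite lm eqxx /= => /orP[q|//].
  by have := no_out _ _ q ltac:(rewrite /=; lia) ltac:(rewrite /=; lia); rewrite /=; lia.
Qed.

End TorsionFree.

(** * Direct sums and decomposition into intervals *)

Section DirectSums.
Variables (k : fieldType) (n : nat) (Q : rel 'I_n).
Implicit Types (X Y L N : rep k Q).

Section Oplus.
Variables (X Y : rep k Q).

Lemma inl_linear l : linear (fun x : X l => (x, 0) : oplus X Y l).
Proof. by move=> c u v; congr pair; rewrite /= scaler0 addr0. Qed.

Lemma snd_linear l : linear (fun x : oplus X Y l => x.2 : Y l).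
Proof. by []. Qed.

Lemma oplus_inl_comm l m (a : Q l m) (x : X l) :
  lfun_of (@inl_linear m) (arrow X a x) = arrow (oplus X Y) a (lfun_of (@inl_linear l) x).
Proof. by rewrite oplus_arrowE !(lfun_ofE (@inl_linear _)) /= linear0. Qed.

Lemma oplus_snd_comm l m (a : Q l m) (x : oplus X Y l) :
  lfun_of (@snd_linear m) (arrow (oplus X Y) a x) = arrow Y a (lfun_of (@snd_linear l) x).
Proof. by rewrite oplus_arrowE !(lfun_ofE (@snd_linear _)). Qed.

Definition oplus_inl : hom X (oplus X Y) := mkhom oplus_inl_comm.
Definition oplus_snd : hom (oplus X Y) Y := mkhom oplus_snd_comm.

Lemma oplus_inlE l x : oplus_inl l x = (x, 0).
Proof. exact: lfun_ofE. Qed.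

Lemma oplus_sndE l x : oplus_snd l x = x.2.
Proof. exact: lfun_ofE. Qed.

Lemma oplus_exact : short_exact oplus_inl oplus_snd.
Proof.
apply: short_exactP.
- by apply: injective_mono => l x; rewrite oplus_inlE => -[].
- by apply: surjective_epi => l y; exists (0, y); rewrite oplus_sndE.
move=> l z; apply: (sameP eqP); apply: (iffP (mem_img oplus_inl z)).
  by case=> x ->; rewrite oplus_inlE oplus_sndE.
by rewrite oplus_sndE => z0; exists z.1; rewrite oplus_inlE -z0; case: z {z0}.
Qed.

Lemma oplus_zero_iso : is_zero Y -> iso X (oplus X Y).
Proof.
move=> Y0; exists oplus_inl; apply: bij_iso; first exact: se_mono oplus_exact.
by apply: surjective_epi => l [x y]; exists x; rewrite oplus_inlE [y]Y0.
Qed.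

End Oplus.

Section OplusMap.
Variables (X Y N : rep k Q) (f : hom X N) (g : hom Y N).

Lemma copair_linear l : linear (fun x : oplus X Y l => f l x.1 + g l x.2 : N l).
Proof. by move=> c u v; rewrite /= !linearP scalerDr addrACA. Qed.

Lemma copair_comm l m (a : Q l m) (x : oplus X Y l) :
  lfun_of (@copair_linear m) (arrow (oplus X Y) a x) =
  arrow N a (lfun_of (@copair_linear l) x).
Proof. by rewrite oplus_arrowE !(lfun_ofE (@copair_linear _)) linearD /= !hom_arrow. Qed.

Definition copair : hom (oplus X Y) N := mkhom copair_comm.

Lemma copairE l x : copair l x = f l x.1 + g l x.2.
Proof. exact: lfun_ofE. Qed.

End OplusMap.

Definition rep_dim X := (\sum_l \dim (fullv : {vspace X l}))%N.

Lemma rep_dim0 X : rep_dim X = 0%N -> is_zero X.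
Proof.
move=> /eqP; rewrite sum_nat_eq0 => /forallP X0 l x.
by have := X0 l; rewrite dimv_eq0 => /eqP E; apply/eqP; rewrite -memv0 -E memvf.
Qed.

Lemma dim_subvs (V : vectType k) (U : {vspace V}) : \dim (fullv : {vspace subvs_of U}) = \dim U.
Proof. by rewrite dimvf. Qed.

Section Summand.
Hypothesis hQ : type_A Q.
Variables (X Y : rep k Q) (i j : 'I_n.+1) (x : forall l, X l) (C : fam X).
Hypotheses (xch : chain (fam0 X) i j x) (xC : chain C i j x) (stC : stable C).
Hypothesis full : forall l y, y \in (C l + <[x l]>)%VS.

Lemma summand_dim : (rep_dim (subrep C) < rep_dim X)%N.
Proof.
case: xC => /andP[ij jn] xE _; pose l := Ordinal (leq_trans ij jn).
rewrite /rep_dim (bigD1 l) //= [X in (_ < X)%N](bigD1 l) //= -addSn.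
apply: leq_add; last by apply: leq_sum => m _; rewrite dim_subvs dimvS ?subvf.
rewrite dim_subvs ltn_neqAle dimvS ?subvf // andbT; apply/eqP => E.
have := xE l; rewrite /= leqnn ij; case/negP.
suff -> : C l = fullv by exact: memvf.
by apply/eqP; rewrite eqEdim subvf E /=.
Qed.

Lemma summand_iso (h : hom Y (subrep C)) : is_iso h ->
  iso (oplus (interval k Q i j) Y) X.
Proof.
move=> /iso_bij[mh eh]; exists (copair (chain_map xch) (homcomp (subincl stC) h)).
have inclC l (y : Y l) : subincl stC l (h l y) \in C l by rewrite -(subincl_img stC) img_mem.
apply: bij_iso.
  apply: injective_mono => l [v y]; rewrite copairE homcompE chain_mapE => E.
  have xC0 : crd v *: x l \in C l.
    by rewrite -[_ *: _](addrK (subincl stC l (h l y))) E sub0r rpredN inclC.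
  have v0 : v = 0.
    have [lt|] := orP (orbN (i <= l < j)%N); last exact: interval_out.
    apply/eqP; rewrite -crd_eq0; apply/negPn/negP => c0.
    case: xC => _ /(_ l); rewrite lt => /negP[].
    by rewrite -[x l](scalerK c0) memvZ.
  rewrite v0 crd0 scale0r add0r in E; congr pair => //.
  apply/eqP; rewrite -(mono_eq0 _ mh) -(mono_eq0 _ (subincl_mono stC)).
  by rewrite E.
apply: surjective_epi => l y.
have /mem_add_line[c] := full y; rewrite -(subincl_img stC) => /mem_img[z zE].
have [u uE] := epi_surj eh z.
have : c *: x l \in <[x l]>%VS by rewrite memvZ ?memv_line.
rewrite -(chain_map_img xch) => /mem_img[v vE].
by exists (v, u); rewrite copairE homcompE uE -vE -zE addrC subrK.
Qed.

End Summand.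

Section Decomposition.
Variable I : rel nat.
Hypothesis hQ : type_A Q.
Hypothesis I_trans : forall a b d, I a b -> I b d -> I a d.
Hypothesis I_aligned : forall a b d (l m : 'I_n), (a < b < d)%N -> I a d ->
  l.+1 = m -> b = m -> (Q m l -> I a b) /\ (Q l m -> I b d).

Definition dsum_intervals (s : seq ('I_n.+1 * 'I_n.+1)) : rep k Q :=
  dsum [seq interval k Q p.1 p.2 | p : 'I_n.+1 * 'I_n.+1 <- s].

Definition I_seq (s : seq ('I_n.+1 * 'I_n.+1)) :=
  all (fun p : 'I_n.+1 * 'I_n.+1 => (p.1 < p.2)%N && I p.1 p.2) s.

Lemma tf_dsum s : I_seq s -> torsion_free I (dsum_intervals s).
Proof.
elim: s => [|p s IHs] /=; first by move=> _; apply: tf_zero => l x; apply: thinmx0.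
case/andP=> /andP[ltp Ip] Is.
apply: (tf_ext hQ I_trans (oplus_exact _ _)); last exact: IHs.
exact: tf_interval.
Qed.

Lemma zero_iso X Y : is_zero X -> is_zero Y -> iso X Y.
Proof.
move=> X0 Y0; have fa l m (a : Q l m) x : (0 : 'Hom(X m, Y m)) (arrow X a x) =
    arrow Y a ((0 : 'Hom(X l, Y l)) x) by rewrite !zero_lfunE linear0.
exists (mkhom fa); apply: bij_iso; first by apply: injective_mono => l x _; apply: X0.
by apply: surjective_epi => l y; exists 0; rewrite linear0 [y]Y0.
Qed.

(** Induction on the total dimension: the interval split off embeds in [X], so its bounds lie in
    [I], and the complement [C] is torsion-free as a subrepresentation. *)
Lemma tf_decomposition X : torsion_free I X -> exists2 s, I_seq s & iso (dsum_intervals s) X.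
Proof.
have [N] := ubnP (rep_dim X); elim: N X => // N IHN X leN tfX.
have [/rep_dim0 X0|nz] := eqVneq (rep_dim X) 0%N.
  by exists [::] => //; apply: zero_iso => // l x; apply: thinmx0.
have [|i [j [x [C [xch xC stC full]]]]] := @interval_summand _ _ _ hQ X.
  move=> X0; case/negP: nz; rewrite /rep_dim big1 // => l _.
  apply/eqP; rewrite dimv_eq0 -subv0; apply/subvP => y _.
  by rewrite [y]X0 mem0v.
have [/andP[ij jn] _ _] := xch.
have ltin : (i < n.+1)%N by lia.
pose i' := Ordinal ltin; pose j' := Ordinal (jn : (j < n.+1)%N).
have [||s Is [h hiso]] := IHN (subrep C).
- by apply: leq_trans (@summand_dim X i' j' x C xC) _.
- exact: tf_mono (subincl_mono stC) tfX.
exists ((i', j') :: s); last exact: (@summand_iso X _ i' j' x C xch xC stC full h hiso).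
rewrite /= Is ij andbT; apply: (tfX i j x) => // l; exact: memvf.
Qed.

Theorem tf_summand X : torsion_free I X <->
  exists s, I_seq s /\ exists Y, iso (oplus X Y) (dsum_intervals s).
Proof.
split=> [/tf_decomposition[s Is sX]|[s [/tf_dsum tfs [Y /iso_sym sX]]]].
  exists s; split=> //; exists (rep0 k Q).
  by apply: iso_trans (iso_sym (oplus_zero_iso _ _)) (iso_sym sX) => l x; apply: thinmx0.
exact: tf_mono (se_mono (oplus_exact _ _)) (tf_iso sX tfs).
Qed.

End Decomposition.

End DirectSums.

(** * Simple objects *)

Section Exactness.
Variables (k : fieldType) (n : nat) (Q : rel 'I_n) (I : rel nat).
Hypothesis hQ : type_A Q.
Hypothesis I_trans : forall a b d, I a b -> I b d -> I a d.
Hypothesis I_lt : forall a b, I a b -> (a < b)%N.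
Hypothesis I_aligned : forall a b d (l m : 'I_n), (a < b < d)%N -> I a d ->
  l.+1 = m -> b = m -> (Q m l -> I a b) /\ (Q l m -> I b d).
Variable E : rep k Q -> Prop.
Hypothesis EP : forall X, E X <-> torsion_free I X.
Implicit Types (X Y L N : rep k Q) (i j : 'I_n.+1).

Definition bruhat i j := I i j && [forall c : 'I_n.+1, ~~ (I i c && I c j)].

Lemma bruhat_inner i j b : bruhat i j -> (i < b < j)%N -> I i b -> I b j -> False.
Proof.
move=> /andP[_ /forallP nc] lt ib bj.
have ltb : (b < n.+1)%N by have := ltn_ord j; lia.
by have := nc (Ordinal ltb); rewrite /= ib bj.
Qed.

Lemma zeroP X : is_zero X \/ exists l (x : X l), x != 0.
Proof.
case: (boolP [exists l, (fullv : {vspace X l}) != 0%VS]) => [/existsP[l]|/existsPn z].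
  rewrite -subv0 => /subvPn[x _ x0]; right; exists l, x.
  by rewrite memv0 in x0.
left=> l x; have := z l; rewrite negbK => /eqP X0.
by apply/eqP; rewrite -memv0 -X0 memvf.
Qed.

Lemma chain_ext X (U : fam X) i j x y :
  (forall l, x l = y l) -> chain U i j x -> chain U i j y.
Proof.
move=> xy [ij xU xa]; split=> // [l|l m a]; first by rewrite -xy.
by rewrite -!xy; apply: xa.
Qed.

Lemma chain_nonzero X i j x : (i < j)%N -> chain (fam0 X) i j x -> ~ is_zero X.
Proof.
move=> ij [_ xE _] X0; have := xE (Ordinal (leq_trans ij (ltn_ord j : (j <= n)%N))).
by rewrite [x _]X0 mem0v /= leqnn ij.
Qed.

Lemma iso_nonzero X Y : iso X Y -> ~ is_zero X -> ~ is_zero Y.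
Proof.
case=> f /iso_bij[mf _] nX Y0; apply: nX => l x; apply/eqP.
by rewrite -(mono_eq0 x mf) [f l x]Y0.
Qed.

Lemma mono_line X Y (f : hom X Y) l (x y : X l) : mono f ->
  f l y \in <[f l x]>%VS -> y \in <[x]>%VS.
Proof.
move=> mf /vlineP[c]; rewrite -linearZ => /(mono_inj mf) ->.
by rewrite memvZ ?memv_line.
Qed.

(** All spaces have dimension at most 1, so nonzero [L] and [N] mean that the generator lies in the
    image of [f] at one vertex and outside it at another; [switch_inner] then gives a forbidden
    intermediate point. *)
Lemma simple_interval i j : bruhat i j -> simple_obj E (interval k Q i j).
Proof.
move=> bij; have /andP[Iij _] := bij; have ij := I_lt Iij.
split; first exact/EP/tf_interval.
  exact: chain_nonzero ij (interval_chain k Q ij).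
case=> L [N [f [g [[/EP tfL _ /EP tfN fg] nL nN]]]].
have [/nL//|[l [x x0]]] := zeroP L; have [/nN//|[m [y y0]]] := zeroP N.
have fx0 : f l x != 0 by rewrite (mono_eq0 x (se_mono fg)).
have lin : (i <= l < j)%N by apply: contraNT fx0 => nl; rewrite [f l x]interval_out.
have [z zy] := epi_surj (se_epi fg) y.
have z0 : z != 0 by apply: contraNneq y0 => z0; rewrite -zy z0 linear0.
have min : (i <= m < j)%N by apply: contraNT z0 => nl; rewrite [z]interval_out.
have le0 : fam_le (fam0 _) (img f) by move=> o; apply: sub0v.
have Vl : ione k Q i j l \in img f l.
  have /(rpredZ (crd (f l x))^-1) : f l x \in img f l by apply: img_mem.
  by rewrite {2}[f l x]intervalE scalerA mulVf ?scale1r // crd_eq0.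
have nVm : ione k Q i j m \notin img f m.
  rewrite -(se_ker fg); apply: contraNneq y0 => E0.
  by rewrite -zy [z]intervalE linearZ /= E0 scaler0.
have [b [ltb ib bj]] := switch_inner hQ I_trans le0 (@img_stable _ _ _ _ _ f)
  (tf_img (se_mono fg) tfL) (tf_quot (se_ker fg) tfN) (W := famT _)
  (fun o => memvf (ione k Q i j o)) (interval_chain k Q ij) lin min Vl nVm.
exact: bruhat_inner bij ltb ib bj.
Qed.

Lemma conflationI L X N (f : hom L X) (g : hom X N) :
  E X -> E N -> short_exact f g -> conflation E f g.
Proof. by move=> EX EN fg; split=> //; apply/EP/(tf_mono (se_mono fg))/EP. Qed.

(** The arrow between [c.-1] and [c] decides which half is the subobject, with bounds [p], and which
    the quotient, with bounds [q]. *)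
Lemma thin_split X i j (c : 'I_n.+1) x : chain (fam0 X) i j x ->
  (forall l y, y \in <[x l]>%VS) -> (i < c < j)%N ->
  exists (U : fam X) (stU : stable U) (p q : 'I_n.+1 * 'I_n.+1),
  [/\ (p = (i, c) /\ q = (c, j)) \/ (p = (c, j) /\ q = (i, c)),
      iso (interval k Q p.1 p.2) (subrep U) &
      iso (interval k Q q.1 q.2) (quotrep U)].
Proof.
move=> xch full ltc; have [/andP[ij jn] xE xa] := xch.
have cn : (c < n)%N by lia.
have cn' : (c.-1 < n)%N by lia.
pose m := Ordinal cn; pose l := Ordinal cn'.
have lm : l.+1 = m by rewrite /=; lia.
have part (p q : 'I_n.+1 * 'I_n.+1) :
    (p.1 < p.2)%N -> (q.1 < q.2)%N ->
    (forall o : 'I_n, (i <= o < j)%N = (p.1 <= o < p.2)%N || (q.1 <= o < q.2)%N) ->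
    (forall o : 'I_n, ~~ ((p.1 <= o < p.2)%N && (q.1 <= o < q.2)%N)) ->
    (forall o o', Q o o' -> (p.1 <= o < p.2)%N -> ~~ (q.1 <= o' < q.2)%N) ->
    exists (U : fam X) (stU : stable U),
      iso (interval k Q p.1 p.2) (subrep U) /\ iso (interval k Q q.1 q.2) (quotrep U).
  move=> ltp ltq pq npq Qpq.
  pose U : fam X := fun o => if (p.1 <= o < p.2)%N then fullv else 0%VS.
  have x0 (o : 'I_n) : ~~ (i <= o < j)%N -> x o = 0.
    by rewrite -xE negbK memv0 => /eqP.
  have X0 (o : 'I_n) (y : X o) : ~~ (i <= o < j)%N -> y = 0.
    by move=> /x0 E0; have := full o y; rewrite E0 => /vlineP[d ->]; rewrite scaler0.
  have xn0 (o : 'I_n) : (x o == 0) = ~~ (i <= o < j)%N by rewrite -xE memv0 negbK.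
  have xarr (o o' : 'I_n) (a : Q o o') : (i <= o < j)%N -> arrow X a (x o) = x o'.
    by move=> /(xa _ _ a); rewrite memv0 subr_eq0 => /eqP.
  have stU : stable U.
    move=> o o' a y; rewrite /U; case: ifP => [lt _|_]; last first.
      by rewrite memv0 => /eqP ->; rewrite linear0 mem0v.
    case: ifP => [_|np]; first exact: memvf.
    by rewrite [arrow _ _ _]X0 ?mem0v // pq np (negbTE (Qpq _ _ a lt)).
  exists U, stU; split.
    pose x' (o : 'I_n) : X o := if (p.1 <= o < p.2)%N then x o else 0.
    have x'U o : x' o \in U o by rewrite /x' /U; case: ifP; rewrite ?memvf ?mem0v.
    pose z o : subrep U o := vsproj (U o) (x' o).
    have zE o : x' o = subincl stU o (z o) by rewrite /= lfunE /= vsprojK.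
    have zch : chain (fam0 (subrep U)) p.1 p.2 z.
      have UV o y : (subincl stU o y \in fam0 X o) = (y \in fam0 (subrep U) o).
        by rewrite !memv0 mono_eq0 //; apply: subincl_mono.
      apply/(chain_hom UV)/(chain_ext zE); split=> [|o|o o' a lt].
      + by rewrite ltp -ltnS ltn_ord.
      + rewrite /x' memv0; case: ifP => lt; last by rewrite eqxx.
        by rewrite xn0 negbK pq lt.
      + rewrite /x' lt memv0 xarr ?pq ?lt // subr_eq0; case: ifP => // np.
        by apply/eqP/x0; rewrite pq np (negbTE (Qpq _ _ a lt)).
    apply: (chain_iso zch) => o y; apply: (mono_line (subincl_mono stU)).
    rewrite -zE; have := img_mem (subincl stU) y; rewrite subincl_img.
    by rewrite /U /x'; case: ifP => _; [rewrite full|rewrite memv0 => /eqP ->; rewrite ?mem0v ?eqxx].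
  have UV o y : (qproj stU o y \in fam0 (quotrep U) o) = (y \in U o).
    by rewrite memv0 qproj_eq0.
  have zch : chain (fam0 (quotrep U)) q.1 q.2 (fun o => qproj stU o (x o)).
    apply/(chain_hom UV); split=> [|o|o o' a lt].
    - by rewrite ltq -ltnS ltn_ord.
    - rewrite /U; have := npq o; case: ifP => lt /=; first by rewrite memvf => /negbTE.
      by rewrite memv0 xn0 negbK pq lt.
    - by rewrite xarr ?subrr ?mem0v // pq lt orbT.
  apply: (chain_iso zch) => o y; have [u <-] := epi_surj (@qproj_epi _ _ _ _ _ stU) y.
  by have /vlineP[d ->] := full o u; rewrite linearZ memvZ ?memv_line.
have := (hQ l m).1; rewrite lm eqxx /= => /orP[a|a].
  have na : ~ Q m l by move=> a'; have := (hQ l m).2; rewrite a a'.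
  have [||o|o|o o' b lt|U [stU [isoU isoQ]]] := part (c, j) (i, c); rewrite /= ?[in LHS]/=; try lia.
    apply/negP => /= lt'; apply: na.
    have -> : m = o by apply: val_inj; have [|] := adjacent hQ b; move: lt lt' => /=; lia.
    by have <- : o' = l by apply: val_inj; have [|] := adjacent hQ b; move: lt lt' => /=; lia.
  by exists U, stU, (c, j), (i, c); split=> //; right.
have na : ~ Q l m by move=> a'; have := (hQ l m).2; rewrite a a'.
have [||o|o|o o' b lt|U [stU [isoU isoQ]]] := part (i, c) (c, j); rewrite /= ?[in LHS]/=; try lia.
  apply/negP => /= lt'; apply: na.
  have -> : l = o by apply: val_inj; have [|] := adjacent hQ b; move: lt lt' => /=; lia.
  by have <- : o' = m by apply: val_inj; have [|] := adjacent hQ b; move: lt lt' => /=; lia.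
by exists U, stU, (i, c), (c, j); split=> //; left.
Qed.

(** A nonzero complement of a split-off interval would give a conflation with nonzero ends, so [X]
    is an interval; an intermediate pair of inversions would cut it in two. *)
Theorem simple_classification X : simple_obj E X ->
  exists i j, bruhat i j /\ iso X (interval k Q i j).
Proof.
case=> /EP tfX nX simX; have [a [b [x [C [xch xC stC full]]]]] := interval_summand hQ nX.
have [/andP[ab bn] _ _] := xch.
have an : (a < n.+1)%N by lia.
pose i := Ordinal an; pose j := Ordinal (bn : (b < n.+1)%N).
have ij : (i < j)%N by [].
have Iij : I i j by apply: (tfX a b x) => // l; apply: memvf.
have UV o y : (qproj stC o y \in fam0 (quotrep C) o) = (y \in C o).
  by rewrite memv0 qproj_eq0.
have C0 : is_zero (subrep C).
  have [//|[l [y /negP y0]]] := zeroP (subrep C); case: simX.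
  exists (subrep C), (quotrep C), (subincl stC), (qproj stC).
  have zch : chain (fam0 (quotrep C)) i j (fun o => qproj stC o (x o)) by apply/(chain_hom UV).
  split; last by apply: chain_nonzero zch.
    apply: conflationI; [exact/EP| |exact: sub_quot_exact].
    apply/EP/(tf_iso _ (tf_interval hQ I_aligned Iij ij)).
    apply: (chain_iso zch) => o z; have [u <-] := epi_surj (@qproj_epi _ _ _ _ _ stC) z.
    have /mem_add_line[d] := full o u; rewrite -(qproj_eq0 stC) linearB subr_eq0 => /eqP ->.
    by rewrite linearZ memvZ ?memv_line.
  by move=> C0; apply: y0; rewrite [y]C0.
have {}full l y : y \in <[x l]>%VS.
  have /mem_add_line[d] := full l y; rewrite -(subincl_img stC) => /mem_img[u].
  rewrite [u]C0 linear0 => /eqP; rewrite subr_eq0 => /eqP ->.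
  by rewrite memvZ ?memv_line.
have Xij : iso (interval k Q i j) X by apply: (chain_iso (i := i) (j := j) xch).
exists i, j; split; last exact: iso_sym.
rewrite /bruhat Iij; apply/forallP => c; apply/negP => /andP[Iic Icj].
have ltc : (i < c < j)%N by rewrite !I_lt.
have [U [stU [p [q [pq isoU isoQ]]]]] := @thin_split X i j c x xch full ltc.
have [Ip Iq] : I p.1 p.2 /\ I q.1 q.2 by case: pq => -[-> ->].
apply: simX; exists (subrep U), (quotrep U), (subincl stU), (qproj stU).
have nz (r : 'I_n.+1 * 'I_n.+1) : I r.1 r.2 -> ~ is_zero (interval k Q r.1 r.2).
  by move=> /I_lt lt; apply: chain_nonzero lt (interval_chain k Q lt).
split; [|exact: iso_nonzero isoU (nz _ Ip)|exact: iso_nonzero isoQ (nz _ Iq)].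
apply: conflationI; [exact/EP| |exact: sub_quot_exact].
exact/EP/(tf_iso isoQ)/tf_interval/I_lt.
Qed.

End Exactness.

(** * The poset of subobjects *)

Section Series.
Variables (k : fieldType) (n : nat) (Q : rel 'I_n) (I : rel nat).
Hypothesis hQ : type_A Q.
Hypothesis I_trans : forall a b d, I a b -> I b d -> I a d.
Hypothesis I_lt : forall a b, I a b -> (a < b)%N.
Hypothesis I_aligned : forall a b d (l m : 'I_n), (a < b < d)%N -> I a d ->
  l.+1 = m -> b = m -> (Q m l -> I a b) /\ (Q l m -> I b d).
Variable E : rep k Q -> Prop.
Hypothesis EP : forall X, E X <-> torsion_free I X.
Implicit Types (X Y L N : rep k Q) (i j : 'I_n.+1).

Lemma factor_through X Y N (f : hom X N) (g : hom Y N) : mono g ->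
  fam_le (img f) (img g) -> exists h : hom X Y, forall l x, g l (h l x) = f l x.
Proof.
move=> mg le.
have hE l x : g l (((g l)^-1 \o f l)%VF x) = f l x.
  by rewrite comp_lfunE limg_lfunVK // (subvP (le l)) // img_mem.
have ha l m (a : Q l m) x : ((g m)^-1 \o f m)%VF (arrow X a x) =
    arrow Y a (((g l)^-1 \o f l)%VF x).
  by apply: (mono_inj mg); rewrite hE !hom_arrow hE.
by exists (mkhom ha) => l x; apply: hE.
Qed.

Lemma sub_inflation X (U : fam X) (stU : stable U) : E X -> tfree I U (famT X) ->
  inflation E (subincl stU).
Proof.
move=> EX tfU; exists (quotrep U), (qproj stU).
apply: (conflationI EP) => //; last exact: sub_quot_exact.
exact/EP/(quot_tf (@qproj_epi _ _ _ _ _ stU) (qproj_eq0 stU)).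
Qed.

Lemma inflationP X Y (f : hom X Y) : inflation E f -> mono f /\ tfree I (img f) (famT Y).
Proof.
case=> N [g [_ _ /EP tfN fg]]; split; first exact: se_mono fg.
exact: tf_quot (se_ker fg) tfN.
Qed.

Section Subobjects.
Variables (X : rep k Q).
Hypothesis EX : E X.
Implicit Types A B : subobj E X.

Definition mksub (U : fam X) (stU : stable U) (tfU : tfree I U (famT X)) : subobj E X :=
  Subobj (sub_inflation stU EX tfU).

Lemma mksub_img U stU tfU l : img (incl (@mksub U stU tfU)) l = U l.
Proof. exact: subincl_img. Qed.

Lemma incl_mono A : mono (incl A).
Proof. by case: (inflationP (inclP A)). Qed.

Lemma incl_tf A : tfree I (img (incl A)) (famT X).
Proof. by case: (inflationP (inclP A)). Qed.

Lemma dom_tf A : torsion_free I (dom A).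
Proof. exact/(tf_mono (incl_mono A))/EP. Qed.

Lemma img_compat A B (h : hom (dom A) (dom B)) : compatible h ->
  forall l y, (incl B l y \in img (incl A) l) = (y \in img h l).
Proof.
move=> ch l y; apply/mem_img/mem_img => [[x]|[x ->]].
  by rewrite -ch comp_lfunE => /(mono_inj (incl_mono B)) ->; exists x.
by exists x; rewrite -ch comp_lfunE.
Qed.

Lemma compat_mono A B (h : hom (dom A) (dom B)) : compatible h -> mono h.
Proof.
move=> ch; apply: injective_mono => l x hx0; apply/eqP.
by rewrite -(mono_eq0 x (incl_mono A)) -ch comp_lfunE hx0 linear0.
Qed.

Lemma compat_le A B (h : hom (dom A) (dom B)) : compatible h ->
  fam_le (img (incl A)) (img (incl B)).
Proof.
move=> ch l; apply/subvP => y /mem_img[x ->].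
by rewrite -ch comp_lfunE img_mem.
Qed.

(** The quotient of [dom B] by [dom A] embeds in that of [X] by [dom A], hence is torsion-free: an
    inclusion of images is automatically an inflation. *)
Lemma sub_leP A B : sub_le A B <-> fam_le (img (incl A)) (img (incl B)).
Proof.
split=> [[h [_ ch]]|le]; first exact: compat_le ch.
have [h hE] := factor_through (incl_mono B) le.
have ch : compatible h by move=> l; apply/lfunP => x; rewrite comp_lfunE hE.
exists h; split=> //; have stU : stable (img h) := @img_stable _ _ _ _ _ h; exists (quotrep (img h)), (qproj stU).
apply: (conflationI EP).
- exact/EP/dom_tf.
- apply/EP/(quot_tf (@qproj_epi _ _ _ _ _ stU) (qproj_eq0 stU)).
  apply: (@tfree_pull _ _ _ _ _ (incl B) _ (img (incl A)) _ _ _ (famT X)) => [l y|l y _|].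
  - exact: img_compat.
  - exact: memvf.
  - exact: incl_tf.
- apply: short_exactP; [exact: compat_mono ch|exact: qproj_epi|exact: qproj_eq0].
Qed.

Lemma sub_eqP A B : sub_eq A B <-> forall l, img (incl A) l = img (incl B) l.
Proof.
split=> [[h [/iso_bij[_ eh] ch]] l|eqAB].
  apply/eqP; rewrite eqEsubv (compat_le ch) /=; apply/subvP => y /mem_img[x ->].
  by have [z <-] := epi_surj eh x; rewrite -comp_lfunE ch img_mem.
have [||h hE] := @factor_through _ _ _ (incl A) (incl B); first exact: incl_mono.
  by move=> l; rewrite eqAB.
have ch : compatible h by move=> l; apply/lfunP => x; rewrite comp_lfunE hE.
exists h; split=> //; apply: bij_iso; first exact: compat_mono ch.
apply: surjective_epi => l y; have := img_mem (incl B) y; rewrite -eqAB => /mem_img[x].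
by rewrite -hE => /(mono_inj (incl_mono B)) ->; exists x.
Qed.

Lemma sub_le_quotient A B : sub_le A B -> exists N, is_quotient A B N.
Proof. by case=> h [[N [g gh]] ch]; exists N, h, g. Qed.

Lemma quotient_dim A B N : is_quotient A B N -> forall l,
  \dim (img (incl B) l) = (\dim (img (incl A) l) + \dim (fullv : {vspace N l}))%N.
Proof.
case=> h [g [ch [_ _ _ hg]]] l.
have dim_mono L Y (f : hom L Y) : mono f -> \dim (img f l) = \dim (fullv : {vspace L l}).
  move=> mf; rewrite -(limg_ker_dim (f l) fullv) [lker (f l)]mf.
  by rewrite capv0 dimv0.
rewrite !dim_mono; try exact: incl_mono.
rewrite -(limg_ker_dim (g l) fullv) capfv -[X in _ = (_ + \dim X)%N](se_epi hg l).
congr (_ + _)%N; have [_ <- _] := hg l.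
exact: dim_mono (se_mono hg).
Qed.

End Subobjects.

End Series.

(** * Composition series and dimension vectors *)

Section Composition.
Variables (k : fieldType) (n : nat) (Q : rel 'I_n) (I : rel nat).
Hypothesis hQ : type_A Q.
Hypothesis I_trans : forall a b d, I a b -> I b d -> I a d.
Hypothesis I_lt : forall a b, I a b -> (a < b)%N.
Hypothesis I_aligned : forall a b d (l m : 'I_n), (a < b < d)%N -> I a d ->
  l.+1 = m -> b = m -> (Q m l -> I a b) /\ (Q l m -> I b d).
Variable E : rep k Q -> Prop.
Hypothesis EP : forall X, E X <-> torsion_free I X.
Implicit Types (X Y L N : rep k Q) (i j : 'I_n.+1).
Notation bounds := ('I_n.+1 * 'I_n.+1)%type.

(** A conflation of [N] with nonzero ends pulls back to a subobject [W] strictly between two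
    consecutive terms. The quotient of [X] by [W] is torsion-free, as an extension of X / B by
    [N']. *)
Lemma series_quotient_simple X m (Xs : nat -> subobj E X) r N :
  E X -> composition_series m Xs -> (r < m)%N -> is_quotient (Xs r) (Xs r.+1) N ->
  simple_obj E N.
Proof.
move=> EX [_ _ Xs_lt Xs_max] rm [h [g [ch [EA EB EN hg]]]].
set A := Xs r in h g ch EA hg *; set B := Xs r.+1 in h g ch EA EB hg *.
have leAB := compat_le ch.
have [_ neqAB] := Xs_lt r r.+1 ltac:(lia).
have leXs a b : (a <= b <= m)%N -> fam_le (img (incl (Xs a))) (img (incl (Xs b))).
  move=> /andP[]; rewrite leq_eqVlt => /orP[/eqP -> _ l|ab bm]; first exact: subvv.
  by apply/(sub_leP EP EX); case: (Xs_lt a b); rewrite ?ab.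
split=> //.
  move=> N0; apply: neqAB; apply/(sub_eqP EP) => l; apply/eqP.
  rewrite eqEsubv leAB /=; apply/subvP => y /mem_img[z ->].
  by rewrite (img_compat EP ch) -(se_ker hg) [g l z]N0.
case=> L [N' [f [g' [[_ _ /EP tfN' fg] nL nN']]]].
pose K := kern (homcomp g' g).
have KE l y : (y \in K l) = (g' l (g l y) == 0) by rewrite memv_ker homcompE.
pose W : fam X := fun l => (incl B l @: K l)%VS.
have WE l y : (incl B l y \in W l) = (y \in K l).
  apply/memv_imgP/idP => [[z zK /(mono_inj (incl_mono EP B)) ->] //|yK].
  by exists y.
have leWB : fam_le W (img (incl B)) by move=> l; apply: limgS; apply: subvf.
have stW : stable W.
  move=> l o a y /memv_imgP[z zK ->]; rewrite -hom_arrow WE KE !hom_arrow.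
  by move: zK; rewrite KE => /eqP ->; rewrite linear0.
have tfW : tfree I W (famT X).
  apply: (tfree_ext hQ I_trans leWB (@img_stable _ _ _ _ _ (incl B))); last exact: (incl_tf EP (A := B)).
  apply: (tfree_push WE (A := famT _)) => [l y /mem_img[z ->]|].
    by exists z => //; apply: memvf.
  apply: (tf_quot (f := homcomp g' g)) tfN' => l y.
  by rewrite memv_ker.
have leAW : fam_le (img (incl A)) W.
  move=> l; apply/subvP => y /mem_img[z ->].
  by rewrite -ch comp_lfunE WE KE (eqP (_ : g l (h l z) == 0)) ?linear0 // (se_ker hg) img_mem.
have leP b : (b <= m)%N -> sub_le (mksub EP EX stW tfW) (Xs b) \/
    sub_le (Xs b) (mksub EP EX stW tfW).
  move=> bm; have [br|rb] := leqP b r.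
    right; apply/(sub_leP EP EX) => l; rewrite mksub_img.
    by apply: subv_trans (leAW l); apply: leXs; lia.
  left; apply/(sub_leP EP EX) => l; rewrite mksub_img.
  by apply: subv_trans (leWB l) _; apply: leXs; lia.
(* Maximality makes [W] a term of the series: an index at most [r] forces [L] to vanish, a larger
   one forces [N'] to vanish. *)
have [b bm /(sub_eqP EP) WXb] := Xs_max _ leP.
have [br|rb] := leqP b r.
  apply: nL => l x; have [y yE] := epi_surj (se_epi hg) (f l x).
  have : g l y == 0.
    rewrite (se_ker hg) -(img_compat EP ch); apply: (subvP (leXs b r _ l)); first lia.
    by rewrite -WXb mksub_img WE KE yE (se_ker fg) img_mem.
  by rewrite yE (mono_eq0 _ (se_mono fg)) => /eqP.
apply: nN' => l y; have [z <-] := epi_surj (se_epi fg) y.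
have [u <-] := epi_surj (se_epi hg) z.
apply/eqP; rewrite -KE -WE -(mksub_img EP EX stW tfW) WXb.
by apply: (subvP (leXs r.+1 b _ l)); [lia|apply: img_mem].
Qed.

Lemma iso_dim X Y : iso X Y -> forall l,
  \dim (fullv : {vspace X l}) = \dim (fullv : {vspace Y l}).
Proof.
case=> f /iso_bij[mf ef] l; rewrite -(limg_ker_dim (f l) fullv) [lker (f l)]mf.
by rewrite capv0 dimv0 [limg _]ef.
Qed.

Lemma interval_dim i j l :
  \dim (fullv : {vspace interval k Q i j l}) = (i <= l < j)%N.
Proof. by rewrite dimvf /dim /= mul1n. Qed.

Lemma series_types X m (Xs : nat -> subobj E X) : E X -> composition_series m Xs ->
  exists t : 'I_m -> bounds,
  [/\ forall r, bruhat I (t r).1 (t r).2,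
      forall r : 'I_m, exists2 N, is_quotient (Xs r) (Xs r.+1) N
        & iso N (interval k Q (t r).1 (t r).2)
    & forall l, \dim (fullv : {vspace X l}) =
        (\sum_r ((t r).1 <= l < (t r).2)%N)%N].
Proof.
move=> EX cs; have [X0 Xm Xs_lt _] := cs.
have ex_t (r : 'I_m) : exists p : bounds, bruhat I p.1 p.2 /\
    exists2 N, is_quotient (Xs r) (Xs r.+1) N & iso N (interval k Q p.1 p.2).
  have [le_r _] := Xs_lt r r.+1 ltac:(have := ltn_ord r; lia).
  have [N qN] := sub_le_quotient le_r.
  have := series_quotient_simple EX cs (ltn_ord r) qN.
  case/(simple_classification hQ I_lt I_aligned EP) => i [j [bij NM]].
  by exists (i, j); split=> //; exists N.
have [t tP] := fin_all_exists ex_t; exists t; split=> [r|r|l]; try by case: (tP r).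
have dimXs b : (b <= m)%N -> \dim (img (incl (Xs b)) l) =
    (\sum_(r < m | (r < b)%N) ((t r).1 <= l < (t r).2)%N)%N.
  elim: b => [|b IHb] bm.
    rewrite big_pred0 //; apply/eqP; rewrite dimv_eq0 -subv0; apply/subvP => y /mem_img[x ->].
    by rewrite [x]X0 linear0 mem0v.
  rewrite (bigD1 (Ordinal bm)) //=.
  have [_ [N qN NM]] := tP (Ordinal bm).
  rewrite (quotient_dim EP qN) (iso_dim NM) interval_dim (IHb (ltnW bm)) addnC.
  congr (_ + _)%N; apply: eq_bigl => r.
  by rewrite -val_eqE /=; lia.
have [_ em] := iso_bij Xm.
have -> : (fullv : {vspace X l}) = img (incl (Xs m)) l by rewrite /img em.
by rewrite dimXs //; apply: eq_bigl => r; rewrite ltn_ord.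
Qed.

Definition dim_vector (s : seq bounds) (l : 'I_n) : nat :=
  \sum_(p <- s) (p.1 <= l < p.2)%N.

Theorem independent_JHP :
  (forall s s' : seq bounds, all (fun p => bruhat I p.1 p.2) s ->
     all (fun p => bruhat I p.1 p.2) s' ->
     (forall l, dim_vector s l = dim_vector s' l) -> perm_eq s s') ->
  JHP E.
Proof.
move=> ind X m m' Xs Ys EX csX csY.
have [t [tb tq td]] := series_types EX csX; have [t' [tb' tq' td']] := series_types EX csY.
pose T := [tuple t r | r < m]; pose T' := [tuple t' r | r < m'].
have dimT l : dim_vector T l = dim_vector T' l.
  rewrite /dim_vector !big_tuple; under eq_bigr do rewrite tnth_mktuple.
  by under [RHS]eq_bigr do rewrite tnth_mktuple; rewrite -td -td'.
have pT : perm_eq T T'.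
  by apply: ind => //; apply/allP => p /mapP[r _ ->].
have mm' : m = m' by rewrite -(size_tuple T) (perm_size pT) size_tuple.
subst m'; split=> //; have /tuple_permP[p pE] := pT.
exists p => r; have [N qN NM] := tq r; have [N' qN' NM'] := tq' (p r).
exists N, N'; split=> //; apply: iso_trans NM _.
have -> : t r = t' (p r).
  have := congr1 (fun s => nth (t r) s r) pE; rewrite -!tnth_nth !tnth_mktuple.
  by [].
exact: iso_sym.
Qed.

End Composition.

(** * Flags *)

Section Flags.
Variables (k : fieldType) (n : nat) (Q : rel 'I_n) (I : rel nat).
Hypothesis hQ : type_A Q.
Hypothesis I_trans : forall a b d, I a b -> I b d -> I a d.
Hypothesis I_lt : forall a b, I a b -> (a < b)%N.
Hypothesis I_aligned : forall a b d (l m : 'I_n), (a < b < d)%N -> I a d ->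
  l.+1 = m -> b = m -> (Q m l -> I a b) /\ (Q l m -> I b d).
Variable E : rep k Q -> Prop.
Hypothesis EP : forall X, E X <-> torsion_free I X.
Implicit Types (X Y L N : rep k Q) (i j : 'I_n.+1).
Notation bounds := ('I_n.+1 * 'I_n.+1)%type.
Implicit Types (p q : bounds) (s : seq bounds).

(* V / U is isomorphic to the interval with bounds [p]. *)
Definition layer X (U V : fam X) p :=
  exists2 x, chain U p.1 p.2 x & forall l, V l = (U l + <[x l]>)%VS.

Lemma layer_push X Y (f : hom X Y) (U V : fam X) (U' V' : fam Y) p : mono f ->
  (forall l, U' l = f l @: U l)%VS -> (forall l, V' l = f l @: V l)%VS ->
  layer U V p -> layer U' V' p.
Proof.
move=> mf U'E V'E [x xch VE]; exists (fun l => f l (x l)).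
  apply/(chain_hom (U := U)) => // l y; rewrite U'E.
  by apply/memv_imgP/idP => [[z zU /(mono_inj mf) ->]|yU] //; exists y.
by move=> l; rewrite V'E VE limgD limg_line U'E.
Qed.

Lemma layer_pull X Y (f : hom X Y) (U V : fam Y) (U' V' : fam X) p : epi f ->
  (forall l, U' l = f l @^-1: U l)%VS -> (forall l, V' l = f l @^-1: V l)%VS ->
  layer U V p -> layer U' V' p.
Proof.
move=> ef U'E V'E [x xch VE].
have [z zE] := fin_all_exists (fun l => epi_surj ef (x l)).
exists z.
  apply/(chain_hom (f := f) (V := U)) => [l y|]; first by rewrite U'E memv_preim.
  by apply: chain_ext xch => l; apply/esym/zE.
move=> l; apply/vspaceP => y; rewrite V'E -memv_preim VE U'E.
have key c : (y - c *: z l \in f l @^-1: U l)%VS = (f l y - c *: x l \in U l).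
  by rewrite -memv_preim linearB linearZ /= [f l (z l)](zE l).
by apply/mem_add_line/mem_add_line => -[c yc]; exists c; rewrite ?key // -key.
Qed.

Lemma layer_le X (U V : fam X) p : layer U V p -> fam_le U V.
Proof. by case=> x _ VE l; rewrite VE addvSl. Qed.

Lemma layer_neq X (U V : fam X) p : layer U V p -> exists l, U l != V l.
Proof.
case=> x [/andP[ab bn] xU _] VE; pose l := Ordinal (leq_trans ab bn).
exists l; apply/eqP => UV; have := xU l; rewrite /= leqnn ab; case/negP.
by rewrite UV VE (subvP (addvSr _ _)) ?memv_line.
Qed.

Lemma layer_tfree X (U V : fam X) p : stable U -> layer U V p -> I p.1 p.2 -> tfree I U V.
Proof.
move=> stU [x xch VE] Ip.
have UV o y : (qproj stU o y \in fam0 (quotrep U) o) = (y \in U o).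
  by rewrite memv0 qproj_eq0.
have zch : chain (fam0 (quotrep U)) p.1 p.2 (fun o => qproj stU o (x o)) by apply/(chain_hom UV).
apply: (tfree_pull UV (B := img (chain_map zch))).
  move=> l y; rewrite VE (chain_map_img zch) => /mem_add_line[c].
  rewrite -qproj_eq0 linearB subr_eq0 => /eqP ->.
  by rewrite linearZ memvZ ?memv_line.
by apply: tf_img (chain_map_mono zch) _; apply: tf_interval => //; apply: I_lt.
Qed.

Lemma quotient_layer X (A B : subobj E X) N p : is_quotient A B N ->
  layer (img (incl A)) (img (incl B)) p -> iso (interval k Q p.1 p.2) N.
Proof.
case=> h [g [ch [_ _ _ hg]]] [x xch BE].
have xB l : exists y, incl B l y = x l.
  have : x l \in img (incl B) l by rewrite BE (subvP (addvSr _ _)) ?memv_line.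
  by case/mem_img => y ->; exists y.
have [y yE] := fin_all_exists xB.
have gE l z : (g l z == 0) = (incl B l z \in img (incl A) l).
  by rewrite (se_ker hg) (img_compat EP ch).
have zch : chain (fam0 N) p.1 p.2 (fun l => g l (y l)).
  pose K : fam (dom B) := fun l => lker (g l).
  apply/(chain_hom (f := g) (U := K)) => [l z|]; first by rewrite memv0 memv_ker.
  apply/(chain_hom (f := incl B) (V := img (incl A))) => [l z|].
    by rewrite memv_ker gE.
  by apply: chain_ext xch => l; apply/esym/yE.
apply: (chain_iso zch) => l u; have [z <-] := epi_surj (se_epi hg) u.
have : incl B l z \in img (incl B) l by apply: img_mem.
rewrite BE => /mem_add_line[c]; rewrite -(yE l) -linearZ -linearB -gE linearB subr_eq0.
by move=> /eqP ->; rewrite linearZ memvZ ?memv_line.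
Qed.

(** A composition series with prescribed factors, phrased with families of subspaces so that it can
    be carried along images and preimages. *)
Definition is_flag X s (U : nat -> fam X) :=
  [/\ forall r, stable (U r), forall l, U 0%N l = 0%VS,
      forall r l, (size s <= r)%N -> U r l = fullv
    & forall r, (r < size s)%N ->
        bruhat I (nth (ord0, ord0) s r).1 (nth (ord0, ord0) s r).2 /\
        layer (U r) (U r.+1) (nth (ord0, ord0) s r)].

Definition flag X s := exists U, @is_flag X s U.

Lemma flag_simple i j : bruhat I i j -> flag (interval k Q i j) [:: (i, j)].
Proof.
move=> bij; exists (fun r => if r is 0%N then fam0 _ else famT _); split=> //.
- by case=> [|r] l m a x; rewrite ?memvf // !memv0 => /eqP->; rewrite linear0.
- by case.
case=> // _; split=> //; exists (ione k Q i j).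
  by apply: interval_chain; apply: I_lt; case/andP: bij.
move=> l; rewrite add0v; apply/vspaceP => x; rewrite memvf [x]intervalE.
by rewrite memvZ ?memv_line.
Qed.

Lemma flag_iso X Y s : iso X Y -> flag X s -> flag Y s.
Proof.
case=> f /iso_bij[mf ef] [U [stU U0 UT Ulay]].
exists (fun r l => (f l @: U r l)%VS); split=> [r l m a x|l|r l sr|r lr].
- by move=> /memv_imgP[y yU ->]; rewrite -hom_arrow memv_img ?stU.
- by rewrite U0 limg0.
- by rewrite UT // [(_ @: _)%VS]ef.
by have [? lay] := Ulay _ lr; split=> //; apply: layer_push lay.
Qed.

Lemma flag_cat L X N (f : hom L X) (g : hom X N) s s' : short_exact f g ->
  flag L s -> flag N s' -> flag X (s ++ s').
Proof.
move=> fg [U [stU U0 UT Ulay]] [V [stV V0 VT Vlay]].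
have mf := se_mono fg; have eg := se_epi fg.
(* Images of the flag of [L] come first, then preimages of the flag of [N]; at index [size s] both
   descriptions give the kernel of [g]. *)
pose W r : fam X := fun l =>
  (if (r < size s)%N then f l @: U r l else g l @^-1: V (r - size s)%N l)%VS.
have W1 r l : (r <= size s)%N -> W r l = (f l @: U r l)%VS.
  rewrite leq_eqVlt /W => /orP[/eqP ->|-> //]; rewrite ltnn subnn V0 UT //.
  by apply/vspaceP => x; rewrite -memv_preim memv0 (se_ker fg).
have W2 r l : (size s <= r)%N -> W r l = (g l @^-1: V (r - size s)%N l)%VS.
  by rewrite /W leqNgt => /negbTE ->.
exists W; split=> [r l m a x|l|r l|r].
- have [rs|/ltnW rs] := leqP (size s) r.
    by rewrite !W2 // -!memv_preim hom_arrow; apply: stV.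
  by rewrite !W1 // => /memv_imgP[y yU ->]; rewrite -hom_arrow memv_img ?stU.
- by rewrite W1 // U0 limg0.
- rewrite size_cat => le; rewrite W2; last by lia.
  by rewrite VT; [apply/vspaceP => x; rewrite -memv_preim !memvf|lia].
rewrite size_cat nth_cat; case: (ltnP r (size s)) => rs lt.
  have [? lay] := Ulay _ rs; split=> //; apply: layer_push lay => // l; apply: W1; lia.
have [|? lay] := Vlay (r - size s)%N; first lia.
split=> //; apply: layer_pull lay => // l; first exact: W2.
by rewrite W2 ?leqW // subSn.
Qed.

Lemma flag_series X s : E X -> flag X s ->
  exists2 Xs, @composition_series _ _ _ E X (size s) Xs &
    forall r N, (r < size s)%N -> is_quotient (Xs r) (Xs r.+1) N ->
      iso N (interval k Q (nth (ord0, ord0) s r).1 (nth (ord0, ord0) s r).2).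
Proof.
move=> EX [U [stU U0 UT Ulay]].
have tfU r : tfree I (U r) (famT X).
  have [le|/ltnW lt] := leqP (size s) r.
    move=> a b x _ [/andP[ab bn] xU _]; have := xU (Ordinal (leq_trans ab bn)).
    by rewrite UT // memvf /= leqnn ab.
  (* Downward induction from the full family: each layer is an interval with bounds in [I], and
     [tfree_ext] adds it. *)
  rewrite -(subKn lt); elim: (size s - r)%N (leq_subr r (size s)) => [|d IHd] led.
    move=> a b x _ [/andP[ab bn] xU _]; have := xU (Ordinal (leq_trans ab bn)).
    by rewrite UT ?subn0 // memvf /= leqnn ab.
  have [|/andP[Ip _] lay] := Ulay (size s - d.+1)%N; first lia.
  have Ed : (size s - d.+1).+1 = (size s - d)%N by lia.
  rewrite Ed in lay; apply: (tfree_ext hQ I_trans (layer_le lay)) (IHd _); [exact: stU| |lia].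
  exact: layer_tfree Ip.
have WE r l : img (incl (mksub EP EX (stU r) (tfU r))) l = U r l by apply: mksub_img.
have monoU a b : (a <= b <= size s)%N -> fam_le (U a) (U b).
  move=> /andP[]; elim: b => [|b IHb]; first by rewrite leqn0 => /eqP-> _ l.
  rewrite leq_eqVlt => /orP[/eqP -> _ l|ab bs]; first exact: subvv.
  have [_ /layer_le le l] := Ulay b bs.
  by apply: subv_trans (le l); apply: IHb => //; apply: ltnW.
exists (fun r => mksub EP EX (stU r) (tfU r)); last first.
  move=> r N lt qN; apply: iso_sym; apply: (quotient_layer qN).
  have [_ [x xch VE]] := Ulay _ lt; exists x => [|l]; last by rewrite !WE.
  case: xch => ab xU xa; split=> // [l|l m a]; first by rewrite WE.
  by rewrite WE; apply: xa.
split.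
- move=> l x; apply/eqP; rewrite -(mono_eq0 x (incl_mono EP (mksub EP EX (stU 0%N) (tfU 0%N)))).
  by rewrite -memv0 -(U0 l) -WE img_mem.
- apply: bij_iso; first exact: (incl_mono EP).
  by move=> l; rewrite -[limg _]/(img _ l) WE UT.
- move=> a b lt; split.
    by apply/(sub_leP EP EX) => l; rewrite !WE; apply: monoU; lia.
  move=> /(sub_eqP EP) eqab; have [|_ lay] := Ulay a; first lia.
  have [l /eqP] := layer_neq lay; apply; apply/eqP; rewrite eqEsubv (layer_le lay) /=.
  by rewrite -[U a l]WE eqab WE; apply: monoU; lia.
move=> Z Zcmp; set V := img (incl Z).
have cmp r : (r <= size s)%N -> fam_le V (U r) \/ fam_le (U r) V.
  move=> /Zcmp[] /(sub_leP EP EX) H; [left|right] => l; have := H l; by rewrite WE.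
suff [r rs eqr] : exists2 r, (r <= size s)%N & forall l, V l = U r l.
  by exists r => //; apply/(sub_eqP EP) => l; rewrite WE; apply: eqr.
(* Climb the flag while it stays below [V]. When the next term is not below [V], it contains [V]; if
   [V] were then strictly between two terms, it would cut a Bruhat interval. *)
have : forall r, (r <= size s)%N -> fam_le (U r) V \/
    exists2 r', (r' <= size s)%N & forall l, V l = U r' l.
  elim=> [|r IHr] rs; first by left=> l; rewrite U0 sub0v.
  have [leUV|] := IHr (ltnW rs); last by right.
  have [leVU|] := cmp _ rs; last by left.
  have [br [x xch UE]] := Ulay _ rs.
  have xU l : x l \in U r.+1 l by rewrite UE (subvP (addvSr _ _)) ?memv_line.
  have stV : stable V by apply: img_stable.
  have tfUV : tfree I (U r) V by apply: (tfree_sub (W := famT X)) => [l|]; [apply: subvf|apply: (tfU r)].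
  have tfVU : tfree I V (U r.+1) by move=> a b y yV; apply: (incl_tf EP (A := Z)) => l; apply: memvf.
  set p := nth _ s r in br xch.
  have xout (l : 'I_n) : ~~ (p.1 <= l < p.2)%N -> x l \in U r l.
    by case: xch => _ xE _; rewrite -xE negbK.
  have [/existsP[m /andP[pm nVm]]|/existsPn inV] :=
      boolP [exists m : 'I_n, (p.1 <= m < p.2)%N && (x m \notin V m)]; last first.
    left=> l; apply/subvP => y; rewrite UE => /mem_add_line[c yc].
    have xV : x l \in V l.
      have [pl|/xout xl] := boolP (p.1 <= l < p.2)%N; last exact: (subvP (leUV l)).
      by have := inV l; rewrite pl negbK.
    rewrite -(subrK (c *: x l) y) rpredD ?memvZ //.
    exact: (subvP (leUV l)).
  right; exists r; first exact: ltnW.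
  move=> l; apply/eqP; rewrite eqEsubv leUV andbT; apply/subvP => y yV.
  have := subvP (leVU l) _ yV; rewrite UE => /mem_add_line[c yc].
  have [c0|c0] := eqVneq c 0; first by rewrite c0 scale0r subr0 in yc.
  have [pl|/xout xl] := boolP (p.1 <= l < p.2)%N; last first.
    by rewrite -(subrK (c *: x l) y) rpredD // memvZ.
  have Vl : x l \in V l.
    rewrite -[x l](scalerK c0) memvZ // -[c *: _](subKr y) rpredB //.
    exact: (subvP (leUV l)).
  have [b [ltb ib bj]] := switch_inner hQ I_trans leUV stV tfUV tfVU xU xch pl pm Vl nVm.
  by case: (bruhat_inner br ltb ib bj).
case/(_ _ (leqnn _)) => [le|//]; exists (size s) => // l; rewrite UT //.
by apply/eqP; rewrite eqEsubv subvf -(UT (size s)) // le.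
Qed.

End Flags.

(** * Exact sequences of intervals *)

Section IntervalMaps.
Variables (k : fieldType) (n : nat) (Q : rel 'I_n).
Notation bounds := ('I_n.+1 * 'I_n.+1)%type.
Implicit Types (p q : bounds).

Definition covers p (l : 'I_n) : bool := (p.1 <= l < p.2)%N.

Local Notation "''M' p" := (interval k Q p.1 p.2) (at level 8, p at level 2).

(** Commutation of the coordinatewise identity from M_p to M_q with an arrow. Outside the case where
    [p] covers [l] and [q] covers [m], both composites vanish. *)
Definition hom_condition p q :=
  forall l m, Q l m -> covers p l -> covers q m -> covers p m = covers q l.

Lemma crd_inj p l (u v : 'M p l) : crd u = crd v -> u = v.
Proof. by move=> E; rewrite [u]intervalE [v]intervalE E. Qed.

Section Map.
Variables (p q : bounds).
Hypothesis pq : hom_condition p q.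

Lemma interval_map_linear l : linear (fun v : 'M p l => crd v *: ione k Q q.1 q.2 l).
Proof. by move=> c u v; rewrite crd_linear scalerDl scalerA. Qed.

Lemma interval_map_comm l m (a : Q l m) v :
  lfun_of (@interval_map_linear m) (arrow 'M p a v) =
  arrow 'M q a (lfun_of (@interval_map_linear l) v).
Proof.
rewrite !(lfun_ofE (@interval_map_linear _)); cbv beta.
apply: crd_inj; rewrite crdZ crd_one !interval_crd_arrow crdZ crd_one.
rewrite -/(covers p m) -/(covers q m) -/(covers q l).
have [pl|npl] := orP (orbN (covers p l)); last by rewrite [v]interval_out // crd0 !mul0r.
have := pq a pl; case: (covers q m) => [->|_] //; by rewrite !mulr0.
Qed.

Definition interval_map : hom 'M p 'M q := mkhom interval_map_comm.

Lemma interval_mapE l v : crd (interval_map l v) = crd v * (covers q l)%:R.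
Proof. by rewrite [interval_map l v](lfun_ofE (@interval_map_linear l)) crdZ crd_one. Qed.

End Map.

Lemma crd_covers p l (v : 'M p l) : crd v * (covers p l)%:R = crd v.
Proof.
have [pl|npl] := orP (orbN (covers p l)); last by rewrite [v]interval_out // crd0 mul0r.
by rewrite pl mulr1.
Qed.

Variables (p q r s : bounds).
Hypotheses (pq : hom_condition p q) (pr : hom_condition p r).
Hypotheses (qs : hom_condition q s) (rs : hom_condition r s).
Hypothesis add_covers : forall l, (covers p l + covers s l = covers q l + covers r l)%N.

Lemma pair_linear l : linear (fun v : 'M p l =>
  (interval_map pq l v, interval_map pr l v) : oplus 'M q 'M r l).
Proof. by move=> c u v; rewrite !linearP. Qed.

Lemma pair_comm l m (a : Q l m) v :
  lfun_of (@pair_linear m) (arrow 'M p a v) =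
  arrow (oplus 'M q 'M r) a (lfun_of (@pair_linear l) v).
Proof. by rewrite oplus_arrowE !(lfun_ofE (@pair_linear _)) !hom_arrow. Qed.

Definition pair_map : hom 'M p (oplus 'M q 'M r) := mkhom pair_comm.

Lemma diff_linear l : linear (fun v : oplus 'M q 'M r l =>
  interval_map qs l v.1 - interval_map rs l v.2 : 'M s l).
Proof. by move=> c u v; rewrite /= !linearP addrACA -scalerDr. Qed.

Lemma diff_comm l m (a : Q l m) v :
  lfun_of (@diff_linear m) (arrow (oplus 'M q 'M r) a v) =
  arrow 'M s a (lfun_of (@diff_linear l) v).
Proof. by rewrite oplus_arrowE !(lfun_ofE (@diff_linear _)) linearB !hom_arrow. Qed.

Definition diff_map : hom (oplus 'M q 'M r) 'M s := mkhom diff_comm.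

Lemma pair_mapE l v : pair_map l v = (interval_map pq l v, interval_map pr l v).
Proof. exact: lfun_ofE. Qed.

Lemma crd_diff_map l v : crd (diff_map l v) = (crd v.1 - crd v.2) * (covers s l)%:R.
Proof.
rewrite [diff_map l v](lfun_ofE (@diff_linear l)) -scaleN1r addrC crd_linear.
by rewrite !interval_mapE mulN1r addrC mulrBl.
Qed.

Lemma interval_exact : short_exact pair_map diff_map.
Proof.
apply: short_exactP.
- apply: injective_mono => l v; rewrite pair_mapE => -[q0 r0].
  have vq : crd v * (covers q l)%:R = 0 by rewrite -(interval_mapE pq) q0 crd0.
  have vr : crd v * (covers r l)%:R = 0 by rewrite -(interval_mapE pr) r0 crd0.
  apply: crd_inj; rewrite crd0 -crd_covers; move: (add_covers l) vq vr.
  by case: (covers p l); case: (covers q l); case: (covers r l); rewrite ?mulr1 ?mulr0 //; case: (covers s l).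
- apply: surjective_epi => l y.
  (* The first summand is used where [q] covers [l]; otherwise the second coordinate is
     [- crd y]. *)
  exists (crd y *: ione k Q q.1 q.2 l, ((covers q l)%:R - 1) * crd y *: ione k Q r.1 r.2 l).
  apply: crd_inj; rewrite crd_diff_map /= !crdZ !crd_one -/(covers q l) -/(covers r l) -[RHS]crd_covers.
  have := add_covers l; case: (covers s l); rewrite ?mulr0 // !mulr1.
  case: (covers q l); first by rewrite subrr !mul0r subr0 mulr1.
  by case: (covers r l) => [_|]; rewrite ?mulr1 ?mulr0 ?sub0r ?mulN1r ?opprK // addn1.
move=> l v; apply: (sameP eqP); apply: (iffP (mem_img pair_map v)).
  case=> x ->; apply: crd_inj; rewrite crd_diff_map pair_mapE !interval_mapE [RHS]crd0.
  rewrite -[crd x]crd_covers -mulrA -mulrA -mulrBr.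
  have := add_covers l; case: (covers p l); case: (covers q l); case: (covers r l); case: (covers s l) => //;
  by rewrite ?mulr0 ?mul0r ?mulr1 ?subrr ?mulr0 ?mul0r.
move=> v1; have v0 : (crd v.1 - crd v.2) * (covers s l)%:R = 0.
  by rewrite -crd_diff_map v1 crd0.
case: v v0 {v1} => u v /= v0.
rewrite -[crd u]crd_covers -[crd v]crd_covers in v0.
(* The coordinate of the preimage is read from [u] where [q] covers the vertex, and from [v] where
   only [r] does. *)
pose c := crd u * (covers q l)%:R + crd v * (covers r l)%:R * (~~ covers q l)%:R.
have [Ecu Ecv] : crd u * (covers q l)%:R = c * (covers p l)%:R * (covers q l)%:R /\
    crd v * (covers r l)%:R = c * (covers p l)%:R * (covers r l)%:R.
  move: (crd u) (crd v) (add_covers l) @c v0 => a b.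
  case: (covers p l); case: (covers q l); case: (covers r l); case: (covers s l) => //= _;
  rewrite ?(mulr0, mulr1, mul0r, addr0, add0r, subr0, sub0r) //.
  - by move=> /eqP; rewrite subr_eq0 => /eqP.
  - by move=> /eqP; rewrite oppr_eq0 => /eqP.
have Eu : u = interval_map pq l (c *: ione k Q p.1 p.2 l).
  by apply: crd_inj; rewrite interval_mapE crdZ crd_one -Ecu crd_covers.
have Ev : v = interval_map pr l (c *: ione k Q p.1 p.2 l).
  by apply: crd_inj; rewrite interval_mapE crdZ crd_one -Ecv crd_covers.
exists (c *: ione k Q p.1 p.2 l); rewrite pair_mapE.
exact: (f_equal2 Datatypes.pair Eu Ev).
Qed.

End IntervalMaps.

(** * Relations between flags under (JHP) *)

Section Relations.
Variables (k : fieldType) (n : nat) (Q : rel 'I_n) (I : rel nat).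
Hypothesis hQ : type_A Q.
Hypothesis I_trans : forall a b d, I a b -> I b d -> I a d.
Hypothesis I_lt : forall a b, I a b -> (a < b)%N.
Hypothesis I_aligned : forall a b d (l m : 'I_n), (a < b < d)%N -> I a d ->
  l.+1 = m -> b = m -> (Q m l -> I a b) /\ (Q l m -> I b d).
Variable E : rep k Q -> Prop.
Hypothesis EP : forall X, E X <-> torsion_free I X.
Implicit Types (X Y L N : rep k Q) (i j : 'I_n.+1).
Notation bounds := ('I_n.+1 * 'I_n.+1)%type.
Implicit Types (p q : bounds) (s : seq bounds).

Lemma interval_iso_inj p q : (p.1 < p.2)%N -> (q.1 < q.2)%N ->
  iso (interval k Q p.1 p.2) (interval k Q q.1 q.2) -> p = q.
Proof.
case: p q => [i j] [i' j'] /= ij ij' isoM.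
have eq_covers (l : 'I_n) : (i <= l < j)%N = (i' <= l < j')%N.
  have := iso_dim isoM l; rewrite !interval_dim.
  by case: (i <= l < j)%N; case: (i' <= l < j')%N.
have jn := ltn_ord j; have jn' := ltn_ord j'.
have i1 : (i < n)%N by lia.
have i2 : (i' < n)%N by lia.
have j1 : (j.-1 < n)%N by lia.
have j2 : (j'.-1 < n)%N by lia.
have := eq_covers (Ordinal i1); have := eq_covers (Ordinal i2).
have := eq_covers (Ordinal j1); have := eq_covers (Ordinal j2) => /= E1 E2 E3 E4.
congr (_, _); apply: val_inj => /=; lia.
Qed.

Lemma JHP_flag X s s' : JHP E -> E X -> all (fun p => bruhat I p.1 p.2) s ->
  all (fun p => bruhat I p.1 p.2) s' ->
  flag I X s -> flag I X s' -> perm_eq s s'.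
Proof.
move=> jhp EX bs bs' fs fs'.
have [Xs csX qX] := flag_series hQ I_trans I_lt I_aligned EP EX fs.
have [Ys csY qY] := flag_series hQ I_trans I_lt I_aligned EP EX fs'.
have [sz [sg sgP]] := jhp X _ _ Xs Ys EX csX csY.
have bru_lt p : bruhat I p.1 p.2 -> (p.1 < p.2)%N by case/andP => /I_lt.
have sz' : size s' == size s by rewrite sz.
have -> : s = in_tuple s by [].
have -> : s' = Tuple sz' by [].
apply/tuple_permP; exists sg; apply: (@eq_from_nth _ (ord0, ord0)) => [|r rs].
  by rewrite [RHS]size_tuple.
have [N [N' [qN qN' NN']]] := sgP (Ordinal rs).
have isoN := qX _ _ rs qN.
have rs' : (sg (Ordinal rs) < size s')%N by rewrite -sz ltn_ord.
have isoN' := qY _ _ rs' qN'.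
rewrite -[r]/(val (Ordinal rs)) -[in RHS]tnth_nth tnth_mktuple (tnth_nth (ord0, ord0)) /=.
apply: interval_iso_inj.
- exact/bru_lt/(allP bs)/mem_nth.
- exact/bru_lt/(allP bs')/mem_nth.
- exact: iso_trans (iso_sym isoN) (iso_trans NN' isoN').
Qed.

Lemma flag_bruhat X s : flag I X s -> all (fun p => bruhat I p.1 p.2) s.
Proof.
by case=> U [_ _ _ lay]; apply/(all_nthP (ord0, ord0)) => r /lay[].
Qed.

Lemma flag_halves i j (c : 'I_n.+1) s s' : (i < c < j)%N ->
  flag I (interval k Q i c) s -> flag I (interval k Q c j) s' ->
  exists2 s'', flag I (interval k Q i j) s'' & perm_eq s'' (s ++ s').
Proof.
move=> lt fs fs'; have ij : (i < j)%N by lia.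
have [|U [stU [p [q [pq isoU isoQ]]]]] := thin_split hQ (interval_chain k Q ij) _ lt.
  by move=> l y; rewrite [y]intervalE memvZ ?memv_line.
case: pq isoU isoQ => -[-> ->] /= isoU isoQ; [exists (s ++ s')|exists (s' ++ s)] => //.
- exact: flag_cat (sub_quot_exact stU) (flag_iso isoU fs) (flag_iso isoQ fs').
- exact: flag_cat (sub_quot_exact stU) (flag_iso isoU fs') (flag_iso isoQ fs).
by rewrite perm_catC.
Qed.

Lemma flag_exists i j : I i j -> exists s, flag I (interval k Q i j) s.
Proof.
have [N] := ubnP (j - i); elim: N i j => // N IHN i j leN Iij.
have [bij|] := boolP (bruhat I i j); first by exists [:: (i, j)]; apply: flag_simple.
rewrite /bruhat Iij /= => /forallPn[c]; rewrite negbK => /andP[ic cj].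
have lt : (i < c < j)%N by rewrite !I_lt.
have [|s fs] := IHN i c _ ic; first lia.
have [|s' fs'] := IHN c j _ cj; first lia.
by have [s'' fs'' _] := flag_halves lt fs fs'; exists s''.
Qed.

(** The middle term has one flag from its direct sum decomposition and another from the exact
    sequence; (JHP) compares them. *)
Lemma flag_exact p q r t sp sq sr st :
  hom_condition Q p q -> hom_condition Q p r ->
  hom_condition Q q t -> hom_condition Q r t ->
  (forall l, (covers p l + covers t l = covers q l + covers r l)%N) ->
  I q.1 q.2 -> I r.1 r.2 -> JHP E ->
  flag I (interval k Q p.1 p.2) sp -> flag I (interval k Q q.1 q.2) sq ->
  flag I (interval k Q r.1 r.2) sr -> flag I (interval k Q t.1 t.2) st ->
  perm_eq (sq ++ sr) (sp ++ st).
Proof.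
move=> pq pr qt rt add_covers Iq Ir jhp fp fq fr ft.
have f1 := flag_cat (oplus_exact _ _) fq fr.
have f2 := flag_cat (interval_exact k pq pr qt rt add_covers) fp ft.
apply: (JHP_flag jhp _ (flag_bruhat f1) (flag_bruhat f2) f1 f2).
by apply/EP/(tf_ext hQ I_trans (oplus_exact _ _)); apply: tf_interval => //; apply: I_lt.
Qed.

(* The four intervals fit into an exact sequence 0 -> M_p -> M_q + M_r -> M_t -> 0
   whichever way the arrows at b and c point, but their roles depend on it. *)
Lemma flag_square (a b c d : 'I_n.+1) sac sbd sad sbc : (a < b < c)%N -> (c < d)%N ->
  I a c -> I b d -> I a d -> I b c -> JHP E ->
  flag I (interval k Q a c) sac -> flag I (interval k Q b d) sbd ->
  flag I (interval k Q a d) sad -> flag I (interval k Q b c) sbc ->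
  perm_eq (sac ++ sbd) (sad ++ sbc).
Proof.
move=> abc cd Iac Ibd Iad Ibc jhp fac fbd fad fbc.
have one_way (e : 'I_n.+1) : (0 < e < n)%N ->
    (forall l m, Q l m -> ~ (l = e :> nat /\ m.+1 = e)) \/
    (forall l m, Q l m -> ~ (m = e :> nat /\ l.+1 = e)).
  move=> lte; have e1 : (e.-1 < n)%N by lia.
  have e2 : (e < n)%N by lia.
  have [] := hQ (Ordinal e1) (Ordinal e2).
  have -> /= : (e.-1.+1 == e) by lia.
  case/orP => q nq; [left|right] => l m q' [E1 E2]; case/negP: nq.
    have -> : Ordinal e1 = m by apply: val_inj => /=; lia.
    have El : Ordinal e2 = l by apply: val_inj => /=; lia.
    by rewrite El q' andbT; move: q; rewrite El;
       have -> : Ordinal e1 = m by apply: val_inj => /=; lia.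
  have E3 : Ordinal e1 = l by apply: val_inj => /=; lia.
  have E4 : Ordinal e2 = m by apply: val_inj => /=; lia.
  by rewrite E3 E4 q' /=; move: q; rewrite E3 E4.
have dn := ltn_ord d.
have hc p q : (forall l m, Q l m -> (m = l.+1 :> nat \/ l = m.+1 :> nat) ->
    covers p l -> covers q m -> covers p m = covers q l) -> hom_condition Q p q.
  by move=> H l m q'; apply: H => //; exact: (adjacent hQ q').
have ltb : (0 < b < n)%N by lia.
have ltc : (0 < c < n)%N by lia.
have [nb|nb] := one_way b ltb; have [nc|nc] := one_way c ltc.
- rewrite perm_sym perm_catC; apply: perm_trans (_ : perm_eq (sbc ++ sad) (sbd ++ sac)) _.
    rewrite perm_catC.
    apply: (@flag_exact (b, d) (a, d) (b, c) (a, c)) => //=;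
    try (apply: hc => l m q' adj; have := nb l m q'; have := nc l m q'; rewrite /covers /=; lia).
    by move=> l; rewrite /covers /=; lia.
  by rewrite perm_catC.
- rewrite perm_sym perm_catC perm_sym.
  apply: (@flag_exact (b, c) (a, c) (b, d) (a, d)) => //=;
  try (apply: hc => l m q' adj; have := nb l m q'; have := nc l m q'; rewrite /covers /=; lia).
  by move=> l; rewrite /covers /=; lia.
- apply: (@flag_exact (a, d) (a, c) (b, d) (b, c)) => //=;
  try (apply: hc => l m q' adj; have := nb l m q'; have := nc l m q'; rewrite /covers /=; lia).
  by move=> l; rewrite /covers /=; lia.
- rewrite perm_sym.
  apply: (@flag_exact (a, c) (a, d) (b, c) (b, d)) => //=;
  try (apply: hc => l m q' adj; have := nb l m q'; have := nc l m q'; rewrite /covers /=; lia).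
  by move=> l; rewrite /covers /=; lia.
Qed.

End Relations.

(** * Potentials on the inversion graph *)

Section Potential.
Variables (n : nat) (w : 'S_n.+1) (lam : 'I_n.+1 -> 'I_n.+1 -> rat).
Implicit Types (a b c d x y t : 'I_n.+1).
Hypothesis lam_triangle : forall a c b, inverted w a c -> inverted w c b ->
  lam a b = lam a c + lam c b.
Hypothesis lam_square : forall a b c d, (a < b < c)%N -> (c < d)%N ->
  inverted w a c -> inverted w b d -> inverted w a d -> inverted w b c ->
  lam a c + lam b d = lam a d + lam b c.

Let pos a : nat := (w^-1 a)%g.

Let invE a b : inverted w a b = (a < b)%N && (pos b < pos a)%N.
Proof. by []. Qed.

Let pos_inj a b : pos a = pos b -> a = b.
Proof. by move/val_inj/perm_inj. Qed.

Section Step.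
Variables (M : 'I_n.+1) (phi : 'I_n.+1 -> rat).
Hypothesis phiP : forall a b, (b < M)%N -> inverted w a b -> lam a b = phi a - phi b.

Let e x y := [&& (x < M)%N, (y < M)%N & inverted w x y || inverted w y x].
Let T t := inverted w t M.
(** The value forced on the potential at [M] by its neighbour [t]. It must be shown constant on the
    connected components of [e], where [phi] may be shifted freely. *)
Let psi t := phi t - lam t M.

Let notT x : (x < M)%N -> ~~ T x -> (pos x < pos M)%N.
Proof.
rewrite /T invE => xM; rewrite xM /= -leqNgt leq_eqVlt => /orP[/eqP/pos_inj E|//].
by rewrite E ltnn in xM.
Qed.

Let psi_adjacent x y : (y < M)%N -> T x -> T y -> inverted w x y -> psi x = psi y.
Proof.
move=> yM Tx Ty xy; rewrite /psi (lam_triangle xy Ty) (phiP yM xy); ring.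
Qed.

(** If [x] comes before [y] in position, x < y < c < M form the pattern 3412; otherwise [(x, y)] is
    an inversion and the triangle with [M] suffices. *)
Let psi_common_lt x y c : (x < y)%N -> (c < M)%N -> T x -> T y -> ~~ T c ->
  inverted w x c -> inverted w y c -> psi x = psi y.
Proof.
move=> xy cM Tx Ty nTc xc yc; have pc := notT cM nTc.
have yM : (y < M)%N by move: Ty; rewrite /T invE => /andP[].
case: (ltngtP (pos x) (pos y)) => [lt|gt|/pos_inj E]; last by rewrite E ltnn in xy.
  have := lam_square (a := x) (b := y) (c := c) (d := M).
  move: (xc) (yc); rewrite !invE => /andP[_ _] /andP[ycl _].
  move=> /(_ ltac:(lia) cM xc Ty Tx yc).
  rewrite (phiP cM xc) (phiP cM yc) /psi; lra.
by apply: psi_adjacent => //; rewrite invE xy.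
Qed.

Let psi_common x y c : (c < M)%N -> T x -> T y -> ~~ T c ->
  inverted w x c -> inverted w y c -> psi x = psi y.
Proof.
case: (ltngtP x y) => [lt|gt|/val_inj -> //] cM Tx Ty nTc xc yc.
  exact: psi_common_lt xc yc.
by apply/esym; apply: psi_common_lt yc xc.
Qed.

(* Along a path, a run of vertices outside of [T] is dominated by its largest
   vertex [c], which stays adjacent to the last vertex [s] of [T]. *)
Let reached t x := (x < M)%N /\
  ((T x /\ psi x = psi t) \/
   (~~ T x /\ exists s c, [/\ T s, ~~ T c, (x <= c < M)%N, inverted w s c & psi s = psi t])).

Let reached_step t x y : e x y -> reached t x -> reached t y.
Proof.
case/and3P => xM yM xy [_ H]; split=> //.
have [Ty|nTy] := boolP (T y); [left|right]; split=> //.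
  case: H => [[Tx <-]|[nTx [s [c [Ts nTc /andP[xc cM] sc <-]]]]].
    by case/orP: xy => H; [apply/esym|]; apply: psi_adjacent.
  apply: (psi_common (c := c)) => //.
  have px := notT xM nTx; have pc := notT cM nTc.
  by move: xy Ty; rewrite /T !invE; lia.
have py := notT yM nTy.
case: H => [[Tx E]|[nTx [s [c [Ts nTc /andP[xc cM] sc E]]]]].
  exists x, y; split=> //; first by rewrite leqnn.
  by move: xy Tx; rewrite /T !invE; lia.
have [yc|cy] := leqP y c; first by exists s, c; split=> //; rewrite yc.
exists s, y; split=> //; first by rewrite leqnn.
by move: Ts sc; rewrite /T !invE; lia.
Qed.

Let psi_connect x y : T x -> T y -> connect e x y -> psi x = psi y.
Proof.
move=> Tx Ty /connectP[p ep E].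
have reached_path q : forall u, path e u q -> reached x u -> reached x (last u q).
  elim: q => //= z q IHq u /andP[uz zq] ru.
  by apply: IHq => //; apply: reached_step ru.
have: reached x y.
  rewrite E; apply: reached_path ep _.
  by split; [move: Tx; rewrite /T invE => /andP[]|left].
by case=> _ [[_ ->] //|[]]; rewrite Ty.
Qed.

(** Shifting each component by its value of [psi] makes 0 a valid potential at [M]. Components
    without a neighbour of [M] are not shifted. *)
Lemma potential_step : exists phi' : 'I_n.+1 -> rat,
  forall a b, (b <= M)%N -> inverted w a b -> lam a b = phi' a - phi' b.
Proof.
have e_sym : connect_sym e.
  by apply: sym_connect_sym => x y; rewrite /e andbCA orbC.
pose shift x := if [pick t | T t && connect e t x] is Some t then psi t else 0.
have shiftT x : T x -> shift x = psi x.
  move=> Tx; rewrite /shift; case: pickP => [t /andP[Tt tx]|/(_ x)].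
    exact: psi_connect.
  by rewrite Tx connect0.
have shift_e x y : e x y -> shift x = shift y.
  move=> /connect1 xy; rewrite /shift; case: pickP => [t /andP[Tt tx]|nx]; case: pickP => //.
  - move=> t' /andP[Tt' t'y]; apply: psi_connect => //.
    by apply: connect_trans tx (connect_trans xy _); rewrite e_sym.
  - by move=> /(_ t); rewrite Tt (connect_trans tx xy).
  - move=> t' /andP[Tt' t'y]; have := nx t'; rewrite Tt' (connect_trans t'y) //.
    by rewrite e_sym.
exists (fun x => if x == M then 0 else phi x - shift x) => a b bM ab.
have aM : (a < M)%N by move: ab; rewrite invE => /andP[lt _]; apply: leq_trans bM.
have -> : (a == M) = false by apply/negbTE; rewrite -val_eqE /=; lia.
have [E|nE] := eqVneq b M; first by rewrite E in ab *; rewrite shiftT // /psi; ring.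
have bM' : (b < M)%N by move: nE; rewrite -val_eqE /=; lia.
by rewrite (phiP bM' ab) (@shift_e a b) ?/e ?aM ?bM' ?ab //; ring.
Qed.

End Step.

Lemma potential_exists : exists phi : 'I_n.+1 -> rat,
  forall a b, inverted w a b -> lam a b = phi a - phi b.
Proof.
have H m : (m <= n.+1)%N -> exists phi : 'I_n.+1 -> rat, forall a b, (b < m)%N ->
    inverted w a b -> lam a b = phi a - phi b; last first.
  by have [phi phiP] := H _ (leqnn _); exists phi => a b; apply: phiP; apply: ltn_ord.
elim: m => [|m IHm] mn; first by exists (fun=> 0).
have [phi phiP] := IHm (ltnW mn).
have [phi' phi'P] := @potential_step (Ordinal mn) phi phiP.
by exists phi'.
Qed.

End Potential.

(** * Linear independence of the Bruhat vectors *)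

Lemma free_mapP (K : fieldType) (V : vectType K) (T : finType) (A : {set T}) (f : T -> V) :
  free [seq f x | x <- enum A] <->
  (forall c : T -> K, \sum_(x in A) c x *: f x = 0 -> forall x, x \in A -> c x = 0).
Proof.
have nthE (i : 'I_#|A|) : [tuple of map f (enum_tuple A)]`_i = f (enum_val i).
  by rewrite /= (nth_map (enum_val i)) -?cardE // -enum_val_nth.
have -> : [seq f x | x <- enum A] = [tuple of map f (enum_tuple A)] by [].
split=> [/freeP fr c c0 x xA|H]; last first.
  apply/freeP => c c0 i.
  have x0A : enum_val i \in A by apply: enum_valP.
  have := H (fun x => c (enum_rank_in x0A x)) _ _ x0A; rewrite enum_valK_in; apply.
  rewrite big_enum_val /= -[RHS]c0; apply: eq_bigr => j _.
  by rewrite enum_valK_in nthE.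
have := fr (fun i => c (enum_val i)) _ (enum_rank_in xA x).
rewrite enum_rankK_in //; apply; rewrite -[RHS]c0 [RHS]big_enum_val.
by apply: eq_bigr => j _; rewrite nthE.
Qed.

Section Rank.
Variables (n : nat) (w : 'S_n.+1).
Implicit Types (a b c d x y t : 'I_n.+1).
Notation bounds := ('I_n.+1 * 'I_n.+1)%type.

Definition interval_vector (p : bounds) : 'rV[rat]_n := \row_l (covers p l)%:R.

Definition bruhat_pairs : {set bounds} :=
  [set p | inverted w p.1 p.2 &&
    [forall c, ~~ (inverted w p.1 c && inverted w c p.2)]].

Definition bruhat_vectors := [seq interval_vector p | p <- enum bruhat_pairs].

Lemma interval_vectorD a b c : (a <= c <= b)%N ->
  interval_vector (a, b) = interval_vector (a, c) + interval_vector (c, b).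
Proof.
move=> lt; apply/rowP => l; rewrite !mxE /covers /= -natrD; congr _%:R; lia.
Qed.

Lemma inverted_span a b : inverted w a b ->
  interval_vector (a, b) \in <<bruhat_vectors>>%VS.
Proof.
have [N] := ubnP (b - a); elim: N a b => // N IHN a b leN inv_ab.
have [br|nbr] := boolP [forall c, ~~ (inverted w a c && inverted w c b)].
  by apply/memv_span/map_f; rewrite mem_enum inE /= inv_ab.
have [c] := forallPn nbr; rewrite negbK => /andP[ac cb].
have := ac; have := cb; rewrite /inverted => /andP[ltcb _] /andP[ltac _].
rewrite (@interval_vectorD a b c); last lia.
by rewrite rpredD // IHN //; lia.
Qed.

Lemma inverted_lt a b : inverted w a b -> (a < b)%N.
Proof. by case/andP. Qed.

(** The unit vector at [i] is the vector of the pair x = i, y = i+1. If this pair is not inverted,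
    an inversion [(a, b)] across [i] leaves three cases by position: [a] is inverted with both [x]
    and [y], or both are with [b], or [a] is with [x] and [y] with [b]. Each time a difference of
    vectors of inversions remains. *)
Lemma supp_span i : i \in supp w ->
  delta_mx 0 i \in <<bruhat_vectors>>%VS.
Proof.
case/suppP => a [b [/andP[ai ib] ab]].
set x := widen_ord (leqnSn n) i; set y := lift ord0 i.
have xE : x = i :> nat by [].
have yE : y = i.+1 :> nat by [].
have -> : delta_mx 0 i = interval_vector (x, y).
  by apply/rowP => l; rewrite !mxE /covers /= -val_eqE /= /bump; congr _%:R; lia.
have inv_or c d : (c < d)%N -> inverted w c d \/ ((w^-1%g c < w^-1%g d)%N /\ ~~ inverted w c d).
  move=> cd; rewrite /inverted cd /=.
  case: ltngtP => [lt|lt|/val_inj/perm_inj E]; [by left|by right|].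
  by rewrite E ltnn in cd.
have [xy|[pxy nxy]] := inv_or x y (leqnn _); first exact: inverted_span.
have /andP[_ pab] := ab.
have [pya|pay] := ltnP (w^-1%g y) (w^-1%g a).
  have ax : inverted w a x.
    have nax : a != x by apply: contraTneq pya => ->; rewrite -leqNgt ltnW.
    by rewrite /inverted (ltn_trans pxy pya) andbT; move: nax; rewrite -val_eqE /=; lia.
  have ay : inverted w a y by rewrite /inverted pya andbT; lia.
  have -> : interval_vector (x, y) = interval_vector (a, y) - interval_vector (a, x).
    rewrite (@interval_vectorD a y x); last by lia.
    by rewrite addrAC subrr add0r.
  by rewrite rpredB // inverted_span.
have [pbx|pxb] := ltnP (w^-1%g b) (w^-1%g x).
  have xb : inverted w x b by rewrite /inverted pbx andbT; lia.
  have yb : inverted w y b.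
    have nby : b != y by apply: contraTneq pbx => ->; rewrite -leqNgt ltnW.
    by rewrite /inverted (ltn_trans pbx pxy) andbT; move: nby; rewrite -val_eqE /= /bump; lia.
  have -> : interval_vector (x, y) = interval_vector (x, b) - interval_vector (y, b).
    by rewrite (@interval_vectorD x b y) ?addrK //; lia.
  by rewrite rpredB // inverted_span.
have neq c d : c != d -> w^-1%g c != w^-1%g d :> nat.
  by move=> ncd; rewrite (inj_eq val_inj) (inj_eq perm_inj).
have nax : a != x by apply: contraTneq pab => ->; rewrite -leqNgt.
have nby : b != y by apply: contraTneq pab => ->; rewrite -leqNgt.
have ltax : (a < x)%N by move: nax; rewrite -val_eqE /=; lia.
have ltyb : (y < b)%N by move: nby; rewrite -val_eqE /= /bump; lia.
have ax : inverted w a x.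
  by rewrite /inverted ltax (leq_ltn_trans pxb).
have yb : inverted w y b.
  by rewrite /inverted ltyb (leq_trans pab).
have -> : interval_vector (x, y) =
    interval_vector (a, b) - interval_vector (a, x) - interval_vector (y, b).
  rewrite (@interval_vectorD a b y) ?(@interval_vectorD a y x); try lia.
  by rewrite addrAC addrK addrAC subrr add0r.
by rewrite !rpredB // inverted_span.
Qed.

Lemma bruhat_span_dim : \dim <<bruhat_vectors>> = #|supp w|.
Proof.
pose D := [seq (delta_mx 0 i : 'rV[rat]_n) | i <- enum (supp w)].
have -> : <<bruhat_vectors>>%VS = <<D>>%VS.
  apply/eqP; rewrite eqEsubv; apply/andP; split; apply/span_subvP => v /mapP[].
    move=> p; rewrite mem_enum inE => /andP[inv_p _] ->.
    have -> : interval_vector p = \sum_(i in supp w) (covers p i)%:R *: delta_mx 0 i.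
      rewrite {1}[interval_vector p]row_sum_delta (bigID (mem (supp w))) /=.
      rewrite [X in _ + X]big1 ?addr0; last first.
        move=> i nsupp; rewrite mxE; case: (boolP (covers p i)) => [pi|_]; last by rewrite scale0r.
        by case/negP: nsupp; apply/suppP; exists p.1, p.2.
      by apply: eq_bigr => i _; rewrite mxE.
    by apply: rpred_sum => i si; apply/rpredZ/memv_span/map_f; rewrite mem_enum.
  by move=> i; rewrite mem_enum => /supp_span si ->.
have : free D.
  apply/(free_mapP (supp w) (fun i => delta_mx 0 i : 'rV[rat]_n)) => c c0 i si.
  have := congr1 (fun v : 'rV_n => v 0 i) c0; rewrite summxE mxE (bigD1 i) //= big1 ?addr0.
    by rewrite !mxE !eqxx mulr1.
  by move=> j /andP[_ ji]; rewrite !mxE eqxx /= eq_sym (negbTE ji) mulr0.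
by rewrite /free => /eqP ->; rewrite size_map -cardE.
Qed.

Lemma free_bruhat : free bruhat_vectors = (#|supp w| == #|bruhat_pairs|).
Proof. by rewrite /free bruhat_span_dim size_map -cardE. Qed.

Lemma tperm_pair_inj (p q : bounds) : (p.1 < p.2)%N -> (q.1 < q.2)%N ->
  tperm p.1 p.2 = tperm q.1 q.2 -> p = q.
Proof.
case: p q => [a b] [a' b'] /= ab ab' E.
have Ea := congr1 (fun t : 'S_n.+1 => t a) E; rewrite /= tpermL in Ea.
case: tpermP Ea => [-> -> //|aE bE|_ _ bE]; last by rewrite bE ltnn in ab.
by move: ab ab'; rewrite aE bE; lia.
Qed.

Lemma card_bruhat : #|bruhat_inv w| = #|bruhat_pairs|.
Proof.
have lt_p p : p \in bruhat_pairs -> (p.1 < p.2)%N by rewrite inE => /andP[/inverted_lt].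
have <- : [set tperm p.1 p.2 | p in bruhat_pairs] = bruhat_inv w.
  apply/setP => t; apply/imsetP/idP => [[p pB ->]|tB].
    by rewrite tperm_bruhat ?lt_p //; move: pB; rewrite inE.
  have /is_transpositionP[a [b [ab tE]]] : is_transposition t by move: tB; rewrite inE => /andP[].
  exists (a, b) => //; rewrite inE /=.
  by move: tB; rewrite tE tperm_bruhat.
by rewrite card_in_imset // => p q /lt_p lt /lt_p lt'; apply: tperm_pair_inj.
Qed.

End Rank.

(** * The torsion-free class of a sortable element *)

Section Main.
Variables (k : fieldType) (n : nat) (Q : rel 'I_n) (c w : 'S_n.+1).
Hypotheses (hQ : type_A Q) (hc : coxeter_of Q c) (hw : sortable c w).
Notation bounds := ('I_n.+1 * 'I_n.+1)%type.

(** Bounds of chains are natural numbers, hence this form; [b <= n] keeps [inord] away from its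
    default. *)
Definition invn (a b : nat) : bool := (a < b <= n)%N && inverted w (inord a) (inord b).

Lemma invn_ord (a b : 'I_n.+1) : invn a b = inverted w a b.
Proof.
rewrite /invn !inord_val -[(b <= n)%N]ltnS ltn_ord andbT.
by rewrite /inverted; case: ltnP.
Qed.

Lemma invn_lt a b : invn a b -> (a < b)%N.
Proof. by case/andP => /andP[]. Qed.

Lemma invn_trans a b d : invn a b -> invn b d -> invn a d.
Proof.
case/andP => /andP[ab bn] /andP[_ pab] /andP[/andP[bd dn] /andP[_ pbd]].
have ad := ltn_trans ab bd.
by rewrite /invn /inverted ad dn /= !inordK ?ltnS ?ad ?(ltn_trans pbd) // ltnW // (leq_trans ad).
Qed.

Lemma invn_aligned a b d (l m : 'I_n) : (a < b < d)%N -> invn a d ->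
  l.+1 = m -> b = m -> (Q m l -> invn a b) /\ (Q l m -> invn b d).
Proof.
move=> /andP[ab bd] /andP[/andP[_ dn] inv_ad] lm bm.
have bn : (b <= n)%N by lia.
have an : (a <= n)%N by lia.
have := @sortable_aligned n Q c w hc hw (inord a) (inord b) (inord d) l m.
rewrite !inordK ?ltnS // ab bd => /(_ isT inv_ad lm bm)[H1 H2].
by rewrite /invn ab bd bn dn.
Qed.

Local Notation E := (torsion_free_class k Q w).

Lemma torsion_freeP (X : rep k Q) : E X <-> torsion_free invn X.
Proof.
have I_seqE s : I_seq invn s = all (fun p : bounds => (p.1 < p.2)%N &&
    (tperm p.1 p.2 \in Defs.inv w)) s.
  apply: eq_all => p; rewrite invn_ord; case: ltnP => //= lt.
  by rewrite tperm_inv.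
split=> [[s [Is sX]]|].
  by apply/(tf_summand hQ invn_trans invn_aligned); exists s; rewrite I_seqE.
case/(tf_summand hQ invn_trans invn_aligned) => s [Is sX].
by exists s; rewrite -I_seqE.
Qed.

Lemma bruhat_in_pairs (p : bounds) : bruhat invn p.1 p.2 = (p \in bruhat_pairs w).
Proof.
rewrite inE /bruhat invn_ord; congr (_ && _); apply: eq_forallb => d.
by rewrite !invn_ord.
Qed.

Lemma interval_vector_sum (s : seq bounds) : {subset s <= bruhat_pairs w} ->
  \sum_(p in bruhat_pairs w) (count_mem p s)%:R *: interval_vector p =
  \sum_(p <- s) interval_vector p.
Proof.
elim: s => [|q s IHs] sB.
  by rewrite big_nil big1 // => p _; rewrite scale0r.
rewrite big_cons -IHs => [|p ps]; last by apply: sB; rewrite inE ps orbT.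
under eq_bigr do rewrite /= natrD scalerDl.
rewrite big_split /=; congr (_ + _); rewrite (bigD1 q) ?sB ?mem_head //=.
rewrite eqxx scale1r big1 ?addr0 // => p /andP[_ /negbTE npq].
by rewrite eq_sym npq scale0r.
Qed.

Lemma free_JHP : free (bruhat_vectors w) -> JHP E.
Proof.
move=> /free_mapP fr.
apply: (independent_JHP hQ invn_trans invn_lt invn_aligned torsion_freeP).
have sub_pairs s : all (fun p => bruhat invn p.1 p.2) s -> {subset s <= bruhat_pairs w}.
  by move=> /allP bs p /bs; rewrite bruhat_in_pairs.
move=> s s' /sub_pairs bs /sub_pairs bs' eq_dim; apply/allP => q _ /=.
have [qB|nqB] := boolP (q \in bruhat_pairs w); last first.
  by rewrite !(count_memPn _) //; [apply: contra nqB => /bs'|apply: contra nqB => /bs].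
(* Differences of multiplicities are the coefficients of a linear relation, since both sequences
   have the same dimension vector. *)
have := fr (fun p => (count_mem p s)%:R - (count_mem p s')%:R) _ q qB.
rewrite -(eqr_nat rat) -subr_eq0 => -> //.
under eq_bigr do rewrite scalerBl.
rewrite sumrB !interval_vector_sum //; apply/eqP; rewrite subr_eq0; apply/eqP/rowP => l.
have := eq_dim l; rewrite !summxE /dim_vector => /(congr1 (fun m => m%:R : rat)).
by rewrite !natr_sum => E0; under eq_bigr do rewrite mxE; rewrite E0; apply: eq_bigr => p _; rewrite mxE.
Qed.

Lemma flag_choice : exists f : bounds -> seq bounds, forall p : bounds, invn p.1 p.2 ->
  flag invn (interval k Q p.1 p.2) (f p).
Proof.
apply: (@fin_all_exists ('I_n.+1 * 'I_n.+1)%type (fun=> seq bounds)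
  (fun p s => invn p.1 p.2 -> flag invn (interval k Q p.1 p.2) s)) => p.
have [Ip|nIp] := boolP (invn p.1 p.2); last by exists [::].
by have [s fs] := flag_exists k hQ invn_lt Ip; exists s.
Qed.

(** Consecutive differences of [phi] telescope along the interval, which exhibits
    [phi p.1 - phi p.2] as a linear functional of the vector. *)
Lemma interval_vector_potential (phi : 'I_n.+1 -> rat) (p : bounds) : (p.1 < p.2)%N ->
  \sum_l interval_vector p 0 l * (phi (widen_ord (leqnSn n) l) - phi (lift ord0 l)) =
  phi p.1 - phi p.2.
Proof.
move=> lt; pose f m := - phi (inord m).
have pn : (p.2 <= n)%N by rewrite -ltnS.
transitivity (\sum_(p.1 <= m < p.2) (f m.+1 - f m)).
  rewrite (@big_nat_widen _ _ _ _ _ n) // (@big_nat_widenl _ _ _ _ 0) // big_mkord.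
  rewrite [RHS]big_mkcond /=; apply: eq_bigr => l _; rewrite mxE /covers andbC.
  case: (_ && _); rewrite ?mul0r // mul1r /f opprK [RHS]addrC.
  by congr (phi _ - phi _); apply: val_inj; rewrite /= inordK /bump //; have := ltn_ord l; lia.
by rewrite telescope_sumr ?(ltnW lt) // /f !inord_val opprK addrC.
Qed.

Lemma JHP_free : JHP E -> free (bruhat_vectors w).
Proof.
move=> jhp; apply/free_mapP => cf cf0 q qB.
have [f fP] := flag_choice.
have Eint (a b : 'I_n.+1) : invn a b -> E (interval k Q a b).
  by move=> ab; apply/torsion_freeP/(tf_interval hQ invn_aligned) => //; apply: invn_lt.
have permf (a b : 'I_n.+1) s : invn a b -> flag invn (interval k Q a b) s -> perm_eq (f (a, b)) s.
  move=> ab fs; have fab := fP (a, b) ab.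
  exact: (JHP_flag hQ invn_trans invn_lt invn_aligned torsion_freeP jhp (Eint _ _ ab)
    (flag_bruhat fab) (flag_bruhat fs) fab fs).
(* By [permf] this multiplicity does not depend on the flag chosen by [f], so it is additive
   wherever flags can be combined. *)
pose lam (a b : 'I_n.+1) : rat := (count_mem q (f (a, b)))%:R.
have [|a b x d abx xd|phi phiP] := @potential_exists n w lam.
- move=> a b x ab bx.
  have lt : (a < b < x)%N by rewrite !(inverted_lt ab, inverted_lt bx).
  have ax : invn a x by apply: (@invn_trans a b); rewrite invn_ord.
  have ab' : invn a b by rewrite invn_ord.
  have bx' : invn b x by rewrite invn_ord.
  have [s fs ps] := flag_halves hQ lt (fP (a, b) ab') (fP (b, x) bx').
  have /seq.permP/(_ (pred1 q)) := perm_trans (permf _ _ _ ax fs) ps.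
  by rewrite count_cat /lam => ->; rewrite natrD.
- rewrite -!invn_ord => ax bd ad bx.
  have := flag_square hQ invn_trans invn_lt invn_aligned torsion_freeP abx xd ax bd ad bx jhp
    (fP (a, x) ax) (fP (b, d) bd) (fP (a, d) ad) (fP (b, x) bx).
  by move=> /seq.permP/(_ (pred1 q)); rewrite !count_cat /lam -!natrD => ->.
have lamB p : p \in bruhat_pairs w -> lam p.1 p.2 = (p == q)%:R.
  move=> pB; have bp : bruhat invn p.1 p.2 by rewrite bruhat_in_pairs.
  have Ip : invn p.1 p.2 by case/andP: bp.
  have /seq.permP/(_ (pred1 q)) := permf _ _ _ Ip (flag_simple k Q invn_lt bp).
  by rewrite /lam => ->; rewrite /= addn0 -surjective_pairing.
(* The linear extension of [lam]: on Bruhat vectors it is the indicator of [q], so it extracts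
   [cf q] from the relation [cf0]. *)
pose g (v : 'rV[rat]_n) := \sum_l v 0 l * (phi (widen_ord (leqnSn n) l) - phi (lift ord0 l)).
have : g (\sum_(p in bruhat_pairs w) cf p *: interval_vector p) = cf q.
  rewrite /g; under eq_bigr do rewrite summxE mulr_suml.
  rewrite exchange_big /= (bigD1 q) //= [X in _ + X]big1 ?addr0 => [|p /andP[pB npq]].
    under eq_bigr do rewrite mxE -mulrA; rewrite -mulr_sumr interval_vector_potential.
      by rewrite -phiP ?lamB ?eqxx ?mulr1 //; move: qB; rewrite inE => /andP[].
    by apply: (@inverted_lt n w); move: qB; rewrite inE => /andP[].
  under eq_bigr do rewrite mxE -mulrA; rewrite -mulr_sumr interval_vector_potential.
    rewrite -phiP ?lamB ?(negbTE npq) ?mulr0 //; by move: pB; rewrite inE => /andP[].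
  by apply: (@inverted_lt n w); move: pB; rewrite inE => /andP[].
by rewrite cf0 /g big1 // => l _; rewrite mxE mul0r.
Qed.

(** Inverse of the passage from a pair a < b to its transposition; transpositions never meet the
    default. *)
Definition ends (t : 'S_n.+1) : bounds :=
  odflt (ord0, ord0) [pick p : bounds | (p.1 < p.2)%N && (t == tperm p.1 p.2)].

Lemma endsP t : is_transposition t -> ((ends t).1 < (ends t).2)%N /\ t = tperm (ends t).1 (ends t).2.
Proof.
case/is_transpositionP => a [b [ab tE]]; rewrite /ends; case: pickP => /= [p /andP[lt /eqP]|].
  by [].
by move=> /(_ (a, b)); rewrite /= ab tE eqxx.
Qed.

Lemma ends_bruhat t : t \in bruhat_inv w -> bruhat invn (ends t).1 (ends t).2.
Proof.
move=> tB; have [|lt tE] := @endsP t; first by move: tB; rewrite inE => /andP[].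
by rewrite bruhat_in_pairs inE -tperm_bruhat // -tE.
Qed.

Lemma simple_bijection :
  iso_classes_bij (simple_obj E) {t : 'S_n.+1 | t \in bruhat_inv w}.
Proof.
exists (fun t => interval k Q (ends (val t)).1 (ends (val t)).2); split.
- move=> [t tB]; apply: (simple_interval hQ invn_trans invn_lt invn_aligned torsion_freeP).
  exact: ends_bruhat.
- move=> [t tB] [t' tB'] /= isoM; apply: val_inj => /=.
  have tr u : u \in bruhat_inv w -> is_transposition u by rewrite inE => /andP[].
  have [lt tE] := endsP (tr t tB); have [lt' tE'] := endsP (tr t' tB').
  by rewrite tE tE' (interval_iso_inj lt lt' isoM).
move=> X /(simple_classification hQ invn_lt invn_aligned torsion_freeP)[i [j [bij Xij]]].
have ij : (i < j)%N by apply: invn_lt; case/andP: bij.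
have tB : tperm i j \in bruhat_inv w.
  by rewrite tperm_bruhat //; have := bruhat_in_pairs (i, j); rewrite bij inE.
exists (exist (fun t => is_true (t \in bruhat_inv w)) _ tB) => /=.
have [lt tE] := endsP (is_transposition_tperm ij).
by rewrite -(tperm_pair_inj (p := (i, j)) ij lt tE).
Qed.

End Main.

Theorem theorem6 (k : fieldType) (n : nat) (Q : rel 'I_n) (c w : 'S_n.+1)
    (hQ : type_A Q) (hc : coxeter_of Q c) (hw : sortable c w) :
  iso_classes_bij (simple_obj (torsion_free_class k Q w))
    {t : 'S_n.+1 | t \in bruhat_inv w}
  /\
  (JHP (torsion_free_class k Q w) <-> #|supp w| = #|bruhat_inv w|).
Proof.
split; first exact: simple_bijection hQ hc hw.
rewrite card_bruhat; split=> [/(JHP_free hQ hc hw)|/eqP eq_card].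
  by rewrite free_bruhat => /eqP.
have fr : free (bruhat_vectors w) by rewrite free_bruhat eq_card.
exact: (free_JHP hQ hc hw fr).
Qed.
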